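(* Let $\alpha:\mathcal P(E)\to(-\infty,\infty]$ be measurable, bounded from below and not identically $+\infty$, and define $\alpha_n,\rho_n$ as in the context. For any bounded lower semicontinuous $F:\mathcal P(E)\to\mathbb R$, $$\liminf_{n\to\infty}\frac1n\rho_n(nF\circ L_n)\ge\sup_{\nu\in\mathcal P(E)}\big(F(\nu)-\alpha(\nu)\big).$$ If in addition $\alpha$ is convex and has compact sub-level sets, then for any bounded upper semicontinuous $F:\mathcal P(E)\to\mathbb R$, $$\limsup_{n\to\infty}\frac1n\rho_n(nF\circ L_n)\le\sup_{\nu\in\mathcal P(E)}\big(F(\nu)-\alpha(\nu)\big).$$
   Context: $(E,d)$ is a complete separable metric space; $\mathcal P(E)$ has the weak topology and its Borel $\sigma$-field; $B(E^n)$ is the set of bounded measurable real functions on $E^n$. For $x\in E^n$ and $1\le k\le n$, $x_{-k}=(x_i)_{i\ne k}\in E^{n-1}$ and $\pi_{-k}(x)=x_{-k}$. For $\nu\in\mathcal P(E^n)$, $\nu_{-k}:E^{n-1}\to\mathcal P(E)$ is the measurable map (unique $\nu$-a.s.) given by the disintegration $\nu(\mathrm dx_1,\dots,\mathrm dx_n)=\nu_{-k}(x_{-k})(\mathrm dx_k)\,\nu\circ\pi_{-k}^{-1}(\mathrm dx_{-k})$, i.e. the conditional law of the $k$-th coordinate given the others. Define $\alpha_n(\nu)=\int_{E^n}\sum_{k=1}^n\alpha(\nu_{-k}(x_{-k}))\,\nu(\mathrm dx)$ for $\nu\in\mathcal P(E^n)$, and $\rho_n(f)=\sup_{\nu\in\mathcal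 P(E^n)}\big(\int f\,\mathrm d\nu-\alpha_n(\nu)\big)$ for $f\in B(E^n)$. $L_n(x_1,\dots,x_n)=\frac1n\sum_{k=1}^n\delta_{x_k}$ is the empirical measure map. *)

(* Defs.v *)
From HB Require Import structures.
From mathcomp Require Import all_boot all_order all_algebra.
From mathcomp Require Import all_classical all_reals all_analysis.
From mathcomp Require Import measurable_realfun.
Set Implicit Arguments.
Unset Strict Implicit.
Unset Printing Implicit Defensive.
Import Order.TTheory GRing.Theory Num.Theory numFieldTopology.Exports.
Local Open Scope classical_set_scope.
Local Open Scope ring_scope.

Section Defs.
Variables (R : realType) (E : pseudoPMetricType R).

Definition EB : Type := g_sigma_algebraType (@open E).

Definition EnB (n : nat) : Type := g_sigma_algebraType (@open {ptws 'I_n -> E}).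

Definition PE : Type := probability EB R.
Definition PEn (n : nat) : Type := probability (EnB n) R.

Definition Cb : Type :=
  {f : E -> R | continuous f /\ exists M : R, forall x, `|f x| <= M}.

Definition weak_eval (mu : PE) : {ptws Cb -> \bar R} :=
  fun f => (\int[mu]_x (sval f x)%:E)%E.
Definition PEw : Type := initial_topology weak_eval.

Definition PEB : Type := g_sigma_algebraType (@open PEw).

Definition drop_coord n (k : 'I_n) (x : 'I_n -> E) : 'I_n.-1 -> E :=
  fun i => x (lift k i).
Definition ins_coord n (k : 'I_n) (y : 'I_n.-1 -> E) (e : E) : 'I_n -> E :=
  fun i => if unlift k i is Some j then y j else e.

(* kappa is a version of nu_{-k}: a measurable map E^{n-1} -> P(E) with
   nu(dx) = kappa(x_{-k})(dx_k) (nu o pi_{-k}^-1)(dx_{-k}), i.e. for every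
   Borel A of E^n, nu(A) = \int kappa(y)({e | (y,e at k) \in A}) (nu o pi_{-k}^-1)(dy),
   the integral against the image measure being written as an integral against nu. *)
Definition is_cond_law n (nu : PEn n) (k : 'I_n) (kappa : ('I_n.-1 -> E) -> PE)
  : Prop :=
  measurable_fun [set: EnB n.-1] (fun y : EnB n.-1 => (kappa y : PEB)) /\
  forall A : set (EnB n), measurable A ->
    nu A = (\int[nu]_x
      kappa (drop_coord k x) [set e : EB | A (ins_coord k (drop_coord k x) e)])%E.

(* alpha_n(nu) = \int sum_k alpha(nu_{-k}(x_{-k})) nu(dx); the value does not
   depend on the (a.s. unique) versions; we take the sup over all versions. *)
Definition alpha_n (alpha : PE -> \bar R) n (nu : PEn n) : \bar R :=
  ereal_sup [set (\int[nu]_x (\sum_(k < n) alpha (kappa k (drop_coord k x))))%E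
            | kappa in [set kappa : 'I_n -> ('I_n.-1 -> E) -> PE |
                         forall k, is_cond_law nu k (kappa k)]].

Definition rho_n (alpha : PE -> \bar R) n (f : ('I_n -> E) -> R) : \bar R :=
  ereal_sup [set (\int[nu]_x (f x)%:E - alpha_n alpha nu)%E | nu in [set: PEn n]].

(* empirical measure L_{n+1}(x) = 1/(n+1) sum_k delta_{x_k}, obtained by
   normalizing the finite measure sum_{k<n+1} delta_{x_k} (total mass n+1, so the
   fallback argument of mnormalize is never used) *)
Definition empirical n (x : 'I_n.+1 -> E) : PE :=
  mnormalize (msum (fun k : nat => @dirac _ EB (x (inord k)) R) n.+1)
             (@dirac _ EB (x ord0) R).

(* the sequence n |-> 1/n rho_n(n F o L_n), indexed from n = 1 (term m is n = m+1) *)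
Definition scaled_rho (alpha : PE -> \bar R) (F : PE -> R) (m : nat) : \bar R :=
  let n : R := m.+1%:R in
  ((n^-1)%:E * rho_n alpha (fun x : 'I_m.+1 -> E => (n * F (empirical x))%R))%E.

Definition rate_sup (alpha : PE -> \bar R) (F : PE -> R) : \bar R :=
  ereal_sup [set ((F nu)%:E - alpha nu)%E | nu in [set: PE]].

Definition alpha_measurable (alpha : PE -> \bar R) : Prop :=
  measurable_fun [set: PEB] (fun nu : PEB => alpha nu).

Definition alpha_convex (alpha : PE -> \bar R) : Prop :=
  forall (mu1 mu2 mu : PE) (t : R), 0 <= t <= 1 ->
    (forall A : set EB, measurable A -> mu A = (t%:E * mu1 A + (1 - t)%:E * mu2 A)%E) ->
    (alpha mu <= t%:E * alpha mu1 + (1 - t)%:E * alpha mu2)%E.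

Definition compact_sublevels (alpha : PE -> \bar R) : Prop :=
  forall c : R, compact [set nu : PEw | (alpha nu <= c%:E)%E].

Definition weak_lsc (F : PE -> R) : Prop :=
  lower_semicontinuous (fun nu : PEw => (F nu)%:E).
Definition weak_usc (F : PE -> R) : Prop :=
  lower_semicontinuous (fun nu : PEw => (- F nu)%:E).
End Defs.

Arguments EB R E : clear implicits.
Arguments EnB R E n : clear implicits.
Arguments PE R E : clear implicits.
Arguments PEn R E n : clear implicits.
Arguments Cb R E : clear implicits.
Arguments PEw R E : clear implicits.
Arguments PEB R E : clear implicits.

(* Main.v *)
(** Lower bound: with the product law mu^n every conditional law is mu, hence
    [alpha_n (mu^n) = n alpha mu], and the weak law of large numbers gives
    [F (L_n) >= F mu - eps] with high probability.

    Upper bound: a continuous test function is uniformly close to a step function, so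
    finitely many of them are controlled by a finite quantization [q] of the points.
    Let [M_k] be the law of [X_k] given [q X_1, ..., q X_(k-1)].  The martingale form
    of the law of large numbers makes [L_n] weakly close to the average of the [M_k]
    outside a set of probability [O(1/n)], uniformly in [nu].  As [M_k] is a mixture of
    the conditional laws [nu_{-k}], Jensen's inequality gives
    [E alpha (M_k) <= E alpha (nu_{-k})], and convexity of [alpha] handles the average.
    Compactness of the sub-level sets makes the upper semicontinuity of [F] uniform on
    them.  Only finitely many conditionings occur, which is why conditioning on the
    quantized past replaces regular conditional laws given the past itself. *)
Require Import Defs.
From HB Require Import structures.
From mathcomp Require Import all_boot all_order all_algebra.
From mathcomp Require Import all_classical all_reals all_analysis.
From mathcomp Require Import measurable_realfun.
From mathcomp Require Import ring lra.
Import Order.TTheory GRing.Theory Num.Theory numFieldTopology.Exports.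
Set Implicit Arguments.
Unset Strict Implicit.
Unset Printing Implicit Defensive.
Local Open Scope classical_set_scope.
Local Open Scope ring_scope.

(** In [alpha_n] the supremum over versions of the conditional laws would be [-oo] if there were
    none, so the upper bound needs their existence. It is obtained from a Borel retraction of the
    line onto [E] and from sampling the conditional law of a real variable with a uniform one. The
    lower bound needs that every version for a product law agrees almost surely with [mu] on Borel
    sets; this goes through a countable determining class. A point of [PE] is a set function defined
    also on sets that are not Borel, so distinct points can agree on all Borel sets and the weak
    topology need not be Hausdorff. Compact sub-level sets are then not closed for free;
    measurability of [alpha] makes up for it, since no weakly Borel set separates such points.
    Convexity is assumed for two-point mixtures only. Jensen's inequality is reached through finite
    mixtures and lower semicontinuity, itself derived from compactness. Many integrals can be
    infinite, hence the shifts to nonnegative integrands. *)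

(** * Integration against mixtures of measures *)

Section mixtures.
Context d d' (T : measurableType d) (Y : measurableType d') (R : realType).
Import HBNNSimple.
Local Open Scope ereal_scope.

Lemma ge0_measurable_ind (P : (Y -> \bar R) -> Prop) :
  (forall A, measurable A -> P (fun y => (\1_A y)%:E)) ->
  (forall (c : R) f, (0 <= c)%R -> (forall y, 0 <= f y) ->
    measurable_fun setT f -> P f -> P (fun y => c%:E * f y)) ->
  (forall f g, (forall y, 0 <= f y) -> (forall y, 0 <= g y) ->
    measurable_fun setT f -> measurable_fun setT g -> P f -> P g ->
    P (fun y => f y + g y)) ->
  (forall (f_ : (Y -> \bar R)^nat) f,
    (forall n y, 0 <= f_ n y) -> (forall n, measurable_fun setT (f_ n)) ->
    (forall y, {homo f_ ^~ y : m n / (m <= n)%N >-> m <= n}) ->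
    (forall y, f y = limn (f_ ^~ y)) -> (forall n, P (f_ n)) -> P f) ->
  forall f, (forall y, 0 <= f y) -> measurable_fun setT f -> P f.
Proof.
move=> Pi PZ PD Plim f f0 mf.
pose f_ := nnsfun_approx measurableT mf.
apply: (Plim (fun n y => (f_ n y)%:E)).
- by move=> n y; rewrite lee_fin.
- by move=> n; exact/measurable_EFinP.
- by move=> y m n mn; rewrite lee_fin; exact/lefP/nd_nnsfun_approx.
- by move=> y; apply/esym/cvg_lim => //; exact: cvg_nnsfun_approx.
move=> n; set g : {nnsfun Y >-> R} := f_ n.
have -> : (fun y => (g y)%:E) =
  (fun y => \sum_(r <- finmap.enum_fset (fset_set (range g))) (r%:E * (\1_(g @^-1` [set r]) y)%:E)).
  by apply/funext => y; rewrite fimfunE fsbig_finite//= -sumEFin.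
have : all (fun r => (0 <= r)%R) (finmap.enum_fset (fset_set (range g))).
  by apply/allP => r; rewrite in_fset_set// inE => -[y _ <-].
elim: (finmap.enum_fset _) => [_|r rs ih /andP[r0 rs0]].
  (* The closure conditions have no clause for the zero function, so the empty sum is recast as the
     indicator of [set0]. *)
  rewrite (_ : (fun _ => _) = (fun y => (\1_set0 y)%:E)); first exact: Pi.
  by apply/funext => y; rewrite big_nil indic0.
have mg s : measurable (g @^-1` [set s]) by [].
have mi s : measurable_fun setT (fun y => (\1_(g @^-1` [set s]) y)%:E : \bar R).
  exact/measurable_EFinP.
rewrite (_ : (fun _ => _) = (fun y => r%:E * (\1_(g @^-1` [set r]) y)%:E +
    \sum_(s <- rs) (s%:E * (\1_(g @^-1` [set s]) y)%:E))); last first.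
  by apply/funext => y; rewrite big_cons.
apply: PD; last exact: ih.
- by move=> y; rewrite mule_ge0// lee_fin.
- move=> y; rewrite big_seq_cond; apply: sume_ge0 => s; rewrite andbT.
  by move=> /(allP rs0) s0; rewrite mule_ge0// lee_fin.
- exact: measurable_funeM.
- by apply: emeasurable_sum => s; exact: measurable_funeM.
- by apply: PZ => //; exact: Pi.
Qed.

(** The restriction to [A] is for Jensen's inequality on an event, where [m] is a probability scaled
    by the mass of the event. *)
Lemma integral_mixture (P : {measure set T -> \bar R}) (A : set T)
    (k : T -> {measure set Y -> \bar R}) (m : {measure set Y -> \bar R}) :
  measurable A ->
  (forall B, measurable B -> measurable_fun setT (k ^~ B)) ->
  (forall B, measurable B -> m B = \int[P]_(x in A) k x B) ->
  forall f, (forall y, 0 <= f y) -> measurable_fun setT f ->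
  \int[m]_y f y = \int[P]_(x in A) \int[k x]_y f y.
Proof.
move=> mA mk mE.
have mkf f : (forall y, 0 <= f y) -> measurable_fun setT f ->
    measurable_fun A (fun x => \int[k x]_y f y).
  by move=> f0 mf; apply: measurable_funTS; exact: measurable_fun_integral_kernel.
apply: ge0_measurable_ind.
- move=> B mB; rewrite integral_indic// setIT mE//.
  by apply: eq_integral => x _; rewrite integral_indic// setIT.
- move=> c f c0 f0 mf ih; rewrite ge0_integralZl_EFin// ih -ge0_integralZl_EFin//.
  + by apply: eq_integral => x _; rewrite ge0_integralZl_EFin.
  + by move=> x _; exact: integral_ge0.
  + exact: mkf.
- move=> f g f0 g0 mf mg ihf ihg; rewrite ge0_integralD// ihf ihg -ge0_integralD//.
  + by apply: eq_integral => x _; rewrite ge0_integralD.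
  + by move=> x _; exact: integral_ge0.
  + exact: mkf.
  + by move=> x _; exact: integral_ge0.
  + exact: mkf.
move=> f_ f f_0 mf_ ndf fE ih.
have lE (mu : {measure set Y -> \bar R}) :
    \int[mu]_y f y = limn (fun n => \int[mu]_y f_ n y).
  rewrite -monotone_convergence//; first by apply: eq_integral => y _; rewrite fE.
rewrite lE; under eq_fun do rewrite ih.
rewrite -monotone_convergence//; last 3 first.
- by move=> n; exact: mkf.
- by move=> n x _; exact: integral_ge0.
- by move=> x _ a b ab; apply: ge0_le_integral => // y _; exact: ndf.
by apply: eq_integral => x _; rewrite lE.
Qed.

Lemma integral_fin_mixture (I : Type) (s : seq I) (w : I -> R)
    (mu : I -> {measure set Y -> \bar R}) (m : {measure set Y -> \bar R}) :
  (forall i, (0 <= w i)%R) ->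
  (forall B, measurable B -> m B = \sum_(i <- s) (w i)%:E * mu i B) ->
  forall f, (forall y, 0 <= f y) -> measurable_fun setT f ->
  \int[m]_y f y = \sum_(i <- s) (w i)%:E * \int[mu i]_y f y.
Proof.
move=> w0 mE; apply: ge0_measurable_ind.
- move=> B mB; rewrite integral_indic// setIT mE//.
  by apply: eq_bigr => i _; rewrite integral_indic// setIT.
- move=> c f c0 f0 mf ih; rewrite ge0_integralZl_EFin// ih.
  rewrite ge0_sume_distrr; last first.
    by move=> i _; rewrite mule_ge0 ?lee_fin ?integral_ge0.
  by apply: eq_bigr => i _; rewrite ge0_integralZl_EFin// muleCA.
- move=> f g f0 g0 mf mg ihf ihg; rewrite ge0_integralD// ihf ihg -big_split/=.
  apply: eq_bigr => i _; rewrite ge0_integralD//.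
  by apply/esym/ge0_muleDr; exact: integral_ge0.
move=> f_ f f_0 mf_ ndf fE ih.
have cE (mu' : {measure set Y -> \bar R}) :
    \int[mu']_y f_ n y @[n --> \oo] --> \int[mu']_y f y.
  rewrite (_ : \int[mu']_y f y = \int[mu']_y limn (f_ ^~ y)).
    by apply: cvg_monotone_convergence => // y _ a b ab; exact: ndf.
  by apply: eq_integral => y _; rewrite fE.
have := cE m; under eq_cvg do rewrite ih.
move=> /cvg_lim <-//; apply/cvg_lim => //.
apply: cvg_nnesum => [i _|i _]; first by near=> n; rewrite mule_ge0 ?lee_fin ?integral_ge0.
exact: cvgeZl.
Unshelve. all: by end_near. Qed.

End mixtures.

(** * Countable bases and the Borel structure of [E] and of its finite powers *)

Lemma ptws_eval_continuous (I : Type) (T : topologicalType) (i : I) :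
  continuous (fun u : {ptws I -> T} => u i).
Proof.
move=> x A nA.
have /cvg_sup/(_ i) h : nbhs (x : {ptws I -> T}) --> (x : {ptws I -> T}).
  exact: cvg_id.
apply: h.
have := @initial_continuous _ _ (fun u : I -> T => u i) x A nA.
exact.
Qed.

Section separable_spaces.
Context (R : realType) (E : pseudoPMetricType R).

(** Balls of a pseudometric structure need not be open, so the point is required to be interior to
    the ball; halving the radius provides this. *)
Lemma separable_dense_seq : (exists D : set E, countable D /\ dense D) ->
  exists c : nat -> E, forall (x : E) (e : R), 0 < e -> exists i, nbhs x (ball (c i) e).
Proof.
move=> [D [/countable_injP[f finj] dD]].
(* An index that codes no point of [D] receives an arbitrary point, which does no harm: only the
   existence of a good index is claimed. *)
pose c n := get [set x | D x /\ f x = n].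
have cf x : D x -> c (f x) = x.
  move=> Dx; rewrite /c; case: (@getPex _ [set y | D y /\ f y = f x]).
    by exists x.
  by move=> Dy /finj; rewrite !inE => /(_ Dy Dx).
exists c => x e e0.
have e20 : 0 < e / 2 by rewrite divr_gt0.
have xB : nbhs x (interior (ball x (e / 2))).
  by apply/nbhs_interior; exact: nbhsx_ballx.
have [|y [/interior_subset xy Dy]] :=
    dD (interior (ball x (e / 2))) _ (@open_interior _ _).
  by exists x; exact: nbhs_singleton.
exists (f y); rewrite cf//; apply: (@filterS _ _ _ (ball x (e / 2))).
  by move=> z xz; rewrite (splitr e); apply: ball_triangle xz; exact: ball_sym.
exact: nbhsx_ballx.
Qed.

Lemma dense_seq_base (c : nat -> E) :
  (forall (x : E) (e : R), 0 < e -> exists i, nbhs x (ball (c i) e)) ->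
  forall (x : E) V, nbhs x V -> exists i k, nbhs x (ball (c i) (k.+1%:R^-1)) /\
    ball (c i) (k.+1%:R^-1) `<=` V.
Proof.
move=> hc x V /nbhs_ballP[e /= e0 eV].
have [k ke] : exists k, 2 / k.+1%:R < e.
  have [k] := ltr_add_invr (y := 0) (x := e / 2) (divr_gt0 e0 (ltr0Sn _ 1)).
  by rewrite add0r => ke; exists k; rewrite mulrC -ltr_pdivlMr.
have k0 : 0 < k.+1%:R^-1 :> R by rewrite invr_gt0.
have [i xi] := hc x _ k0.
exists i, k; split => // y iy; apply: eV.
apply: (@le_ball _ _ _ (2 / k.+1%:R)); first exact: ltW.
rewrite (_ : 2 / _ = k.+1%:R^-1 + k.+1%:R^-1); last by rewrite mulrDl mul1r.
by apply: ball_triangle iy; apply: ball_sym; exact: nbhs_singleton.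
Qed.

Lemma separable_open_base : (exists D : set E, countable D /\ dense D) ->
  exists U : nat -> set E, (forall j, open (U j)) /\
    forall (x : E) V, nbhs x V -> exists j, U j x /\ U j `<=` V.
Proof.
move=> /separable_dense_seq[c /dense_seq_base hc].
exists (fun j => if @unpickle (nat * nat)%type j is Some p then
  interior (ball (c p.1) (p.2.+1%:R^-1)) else set0); split.
  by move=> j; case: unpickle => [p|]; [exact: open_interior|exact: open0].
move=> x V /hc[i [k [xi ikV]]]; exists (pickle (i, k)); rewrite pickleK/=; split => //.
by apply: subset_trans ikV; exact: interior_subset.
Qed.

(** The boxes around [x] generate a filter; its convergence to [x] in the product topology is
    checked one coordinate at a time. *)
Lemma ptws_nbhs_box n (x : 'I_n -> E) (V : set {ptws 'I_n -> E}) :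
  nbhs (x : {ptws 'I_n -> E}) V ->
  exists W : 'I_n -> set E, (forall i, nbhs (x i) (W i)) /\
    forall y, (forall i, W i (y i)) -> V y.
Proof.
pose F : set_system {ptws 'I_n -> E} :=
  filter_from [set W : 'I_n -> set E | forall i, nbhs (x i) (W i)]
    (fun W => [set y | forall i, W i (y i)]).
have FF : Filter F.
  apply: filter_from_filter.
    by exists (fun=> setT) => i; exact: filterT.
  move=> W W' hW hW'; exists (fun i => W i `&` W' i).
    by move=> i; exact: filterI.
  by move=> y h; split=> i; have [] := h i.
have : F --> (x : {ptws 'I_n -> E}).
  apply/cvg_sup => i A [B [[C oC <-] Cx CA]].
  exists (fun j z => j = i -> C z) => [j|y /(_ i erefl) Cy]; last exact: CA.
  have [->|ji] := eqVneq j i.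
    by apply: (@filterS _ _ _ C) => [z Cz _//|]; exact: open_nbhs_nbhs.
  by apply: filterS filterT => z _ /eqP; rewrite (negbTE ji).
by move=> h /h[W hW WV]; exists W.
Qed.

Lemma continuous_measurable_EB (f : E -> R) : continuous f ->
  measurable_fun setT (f : EB R E -> R).
Proof.
move=> cf; apply: (measurability _ (RGenOInfty.measurableE R)).
move=> _ [_ [a ->] <-]; rewrite setTI; apply: sub_sigma_algebra.
by move/continuousP: cf; apply; exact: interval_open.
Qed.

(** The sigma-algebra of [EnB] is generated by the open sets of the product, not by the coordinates.
    Separability bridges the two: an open set is a countable union of boxes over a countable
    base. *)
Lemma measurable_EnB d (T : measurableType d) n (g : T -> EnB R E n) :
  (exists D : set E, countable D /\ dense D) ->
  (forall i, measurable_fun setT ((fun t => g t i) : T -> EB R E)) ->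
  measurable_fun setT g.
Proof.
move=> /separable_open_base[U [oU bU]] mg.
apply: (@measurability _ _ _ (EnB R E n) setT _ (@open {ptws 'I_n -> E})) ; [by []|]; move=> _ [B oB <-].
(* A box of the base counts only if it lies in [B]; the index type is countable. *)
rewrite setTI; pose G (s : {ffun 'I_n -> nat}) : set T :=
  if `[< forall y : 'I_n -> E, (forall i, U (s i) (y i)) -> B y >] then
    \bigcap_(i in [set: 'I_n]) ((fun t => g t i) @^-1` U (s i)) else set0.
have -> : g @^-1` B = \bigcup_s G s.
  apply/seteqP; split => [t Bgt|t [s _]].
    have /ptws_nbhs_box[W [nW WB]] : nbhs (g t : {ptws 'I_n -> E}) B.
      by apply: open_nbhs_nbhs.
    have /choice[s hs] : forall i, exists j, U j (g t i) /\ U j `<=` W i.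
      by move=> i; exact: bU.
    exists (finfun s) => //; rewrite /G asboolT.
      by move=> i _ /=; rewrite ffunE; have [] := hs i.
    by move=> y Uy; apply: WB => i; have [_] := hs i; apply; rewrite -ffunE.
  by rewrite /G; case: asboolP => // UB gU; apply: UB => i; exact: gU.
apply: countable_bigcupT_measurable => // s; rewrite /G; case: ifP => // _.
apply: fin_bigcap_measurable => // i _; rewrite -[X in measurable X]setTI.
by apply: mg => //; exact: sub_sigma_algebra.
Qed.

Lemma measurable_coord n (i : 'I_n) :
  measurable_fun setT ((fun x : EnB R E n => x i) : EnB R E n -> EB R E).
Proof.
apply: (@measurability _ _ _ (EB R E) setT _ (@open E)) ; [by []|]; move=> _ [B oB <-]; rewrite setTI.
apply: sub_sigma_algebra.
have h := (continuousP _).1 (@ptws_eval_continuous 'I_n E i).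
exact: h.
Qed.

Lemma measurable_drop_coord n (k : 'I_n) :
  (exists D : set E, countable D /\ dense D) ->
  measurable_fun setT (drop_coord k : EnB R E n -> EnB R E n.-1).
Proof. by move=> sepE; apply: measurable_EnB => // i; exact: measurable_coord. Qed.

Lemma measurable_ins_coord d (T : measurableType d) n (k : 'I_n)
    (g : T -> EnB R E n.-1) (h : T -> EB R E) :
  (exists D : set E, countable D /\ dense D) ->
  measurable_fun setT g -> measurable_fun setT h ->
  measurable_fun setT ((fun t => ins_coord k (g t) (h t)) : T -> EnB R E n).
Proof.
move=> sepE mg mh; apply: measurable_EnB => // i; rewrite /ins_coord.
by case: unlift => [j|//]; exact: (measurableT_comp (measurable_coord j)).
Qed.

Lemma ins_drop_coord n (k : 'I_n) (x : 'I_n -> E) :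
  ins_coord k (drop_coord k x) (x k) = x.
Proof.
apply/funext => i; rewrite /ins_coord /drop_coord.
by case: unliftP => [j ->|->].
Qed.

Lemma ins_coordK n (k : 'I_n) (y : 'I_n.-1 -> E) e : ins_coord k y e k = e.
Proof. by rewrite /ins_coord unlift_none. Qed.

Lemma ins_coord_lift n (k : 'I_n) (y : 'I_n.-1 -> E) e j :
  ins_coord k y e (lift k j) = y j.
Proof. by rewrite /ins_coord liftK. Qed.

Lemma drop_ins_coord n (k : 'I_n) (y : 'I_n.-1 -> E) e :
  drop_coord k (ins_coord k y e) = y.
Proof. by apply/funext => i; rewrite /drop_coord ins_coord_lift. Qed.

End separable_spaces.

(** * The weak topology and its Borel sigma-algebra *)

Section weak_topology.
Context (R : realType) (E : pseudoPMetricType R).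

(** Values in [0,1] keep all integrals nonnegative and finite, and make the class stable under
    [1 - f]. Any bounded continuous function is an affine image of such an [f]. *)
Definition test_fun (f : E -> R) := continuous f /\ forall x, 0 <= f x <= 1.

Definition ev (f : E -> R) (mu : PE R E) : R := fine (\int[mu]_x (f x)%:E)%E.

Lemma integral_cst_probability d (T : measurableType d) (mu : probability T R) (r : R) :
  (\int[mu]_x r%:E = r%:E)%E.
Proof.
rewrite integral_cst// -[RHS]mule1; congr (_ * _)%E; exact: probability_setT.
Qed.

Lemma integral_unit_fin d (T : measurableType d) (mu : probability T R) (f : T -> R) :
  measurable_fun setT f -> (forall x, 0 <= f x <= 1) ->
  (0 <= \int[mu]_x (f x)%:E <= 1)%E.
Proof.
move=> mf f01; apply/andP; split.
  by apply: integral_ge0 => x _; rewrite lee_fin; have /andP[] := f01 x.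
apply: (@le_trans _ _ (\int[mu]_x (cst 1%E x))%E).
  apply: ge0_le_integral => //.
  - by move=> x _; rewrite lee_fin; have /andP[] := f01 x.
  - exact/measurable_EFinP.
  - by move=> x _; rewrite lee_fin; have /andP[] := f01 x.
by rewrite integral_cst// mul1e; exact: probability_le1.
Qed.

Lemma measurable_test f : test_fun f -> measurable_fun setT (f : EB R E -> R).
Proof. by move=> [cf _]; exact: continuous_measurable_EB. Qed.

Lemma test_fun_norm f x : test_fun f -> `|f x| <= 1.
Proof. by move=> tf; have /andP[h0 h1] := tf.2 x; rewrite ger0_norm. Qed.

Lemma evE f (mu : PE R E) : test_fun f -> (\int[mu]_x (f x)%:E)%E = (ev f mu)%:E.
Proof.
move=> tf; rewrite /ev fineK//.
have /andP[h0 h1] := integral_unit_fin mu (measurable_test tf) tf.2.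
by rewrite ge0_fin_numE// (le_lt_trans h1)// ltry.
Qed.

Lemma ev01 f (mu : PE R E) : test_fun f -> 0 <= ev f mu <= 1.
Proof.
move=> tf; rewrite -!lee_fin -evE//.
exact: integral_unit_fin (measurable_test tf) tf.2.
Qed.

Lemma test_funC f : test_fun f -> test_fun (fun x => 1 - f x).
Proof.
move=> [cf f01]; split => x; last by have := f01 x; lra.
by apply: cvgB; [exact: cvg_cst|exact: cf].
Qed.

Lemma integrable_bounded d (T : measurableType d) (mu : probability T R)
    (f : T -> R) (M : R) : measurable_fun setT f -> (forall x, `|f x| <= M) ->
  mu.-integrable setT (EFin \o f).
Proof.
move=> mf fM; apply: (@le_integrable _ _ _ _ _ measurableT _ (EFin \o cst M)) => //.
- exact/measurable_EFinP.
- by move=> x _ /=; rewrite lee_fin (le_trans (fM x))// ler_norm.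
- exact: finite_measure_integrable_cst.
Qed.

Lemma evC f (mu : PE R E) : test_fun f -> ev (fun x => 1 - f x) mu = 1 - ev f mu.
Proof.
move=> tf; apply: EFin_inj; rewrite -evE; last exact: test_funC.
rewrite EFinB -evE//; under eq_integral do rewrite EFinB.
have If : (mu : probability _ _).-integrable setT (EFin \o f).
  apply: (@integrable_bounded _ _ _ _ 1); first exact: measurable_test.
  by move=> x; exact: test_fun_norm.
rewrite integralB_EFin//; last exact: finite_measure_integrable_cst.
by rewrite integral_cst_probability.
Qed.

Lemma nbhs_ev f (mu : PEw R E) (e : R) : test_fun f -> 0 < e ->
  nbhs mu [set m : PEw R E | `|ev f m - ev f mu| < e].
Proof.
move=> tf e0; have hF : continuous f /\ exists M : R, forall x, `|f x| <= M.
  by split; [exact: tf.1|exists 1 => x; exact: test_fun_norm].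
pose F : Cb R E := exist _ f hF.
have h : (fun m : PEw R E => weak_eval m F) @ mu --> weak_eval mu F.
  apply: (@continuous_comp _ _ _ (@weak_eval R E : PEw R E -> {ptws Cb R E -> \bar R})
    (fun u => u F)).
    exact: initial_continuous.
  exact: ptws_eval_continuous.
have h' : (fun m : PEw R E => ev f m) @ mu --> ev f mu.
  have h1 : weak_eval mu F = (ev f mu)%:E := evE mu tf.
  by rewrite h1 in h; exact: fine_cvg h.
move/cvgrPdist_lt : h' => /(_ _ e0); apply: filterS => m /=.
by rewrite distrC.
Qed.

(** Sets given by finitely many test functions form a filter base at [mu]. The filter converges to
    [mu] in the initial topology because each bounded continuous function rescales to a test
    function. *)
Lemma nbhs_weakP (mu : PEw R E) (U : set (PEw R E)) : nbhs mu U ->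
  exists (fs : seq (E -> R)) (e : R), [/\ 0 < e,
    forall f, List.In f fs -> test_fun f &
    forall m, (forall f, List.In f fs -> `|ev f m - ev f mu| < e) -> U m].
Proof.
rewrite nbhsE => -[_ [[B oB <-] Bmu] BU].
pose F : set_system (PEw R E) :=
  filter_from [set p : seq (E -> R) * R |
      0 < p.2 /\ forall f, List.In f p.1 -> test_fun f]
    (fun p => [set m | forall f, List.In f p.1 -> `|ev f m - ev f mu| < p.2]).
have FF : Filter F.
  apply: filter_from_filter; first by exists ([::], 1).
  move=> [s e] [s' e'] /= [e0 ts] [e'0 ts'].
  exists (s ++ s', Num.min e e') => /=.
    split; first by rewrite lt_min e0.
    by move=> f /List.in_app_iff[]; [exact: ts|exact: ts'].
  move=> m h; split => f fs; have := h f; rewrite List.in_app_iff lt_min.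
    by move=> /(_ (or_introl fs)) /andP[].
  by move=> /(_ (or_intror fs)) /andP[].
have : @weak_eval R E @ F --> weak_eval mu.
  apply/cvg_sup => -[f [cf [M fM]]] A.
  move=> [C [[C' oC' <-] C'mu CA]].
  (* The added 1 makes the bound strictly positive, so that the rescaling is invertible. *)
  pose M' := `|M| + 1.
  have M'0 : 0 < M' by rewrite ltr_pwDr.
  have fM' x : `|f x| <= M' by rewrite (le_trans (fM x))// ler_wpDr// ler_norm.
  pose g x := (f x + M') / (2 * M').
  have tg : test_fun g.
    split => x.
      by apply: cvgM; [apply: cvgD; [exact: cf|exact: cvg_cst]|exact: cvg_cst].
    rewrite /g divr_ge0 ?mulr_ge0 ?(ltW M'0)//=; last first.
      by have := fM' x; rewrite ler_norml; lra.
    rewrite ler_pdivrMr ?mul1r ?mulr_gt0//.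
    by have := fM' x; rewrite ler_norml; lra.
  have fE m : weak_eval m (exist _ f (conj cf (ex_intro _ M fM))) =
      (2 * M' * ev g m - M')%:E.
    rewrite /weak_eval/= EFinB EFinM -evE//.
    have mf := continuous_measurable_EB cf.
    have If : (m : probability _ _).-integrable setT (EFin \o f).
      exact: (@integrable_bounded _ _ _ _ M').
    have Ig : (m : probability _ _).-integrable setT (EFin \o g).
      apply: (@integrable_bounded _ _ _ _ 1); first exact: measurable_test.
      by move=> x; exact: test_fun_norm.
    rewrite -integralZl//.
    rewrite -[X in (_ - X)%E](integral_cst_probability (m : probability _ _)).
    rewrite -integralB//; last 2 first.
    - exact: integrableZl.
    - exact: finite_measure_integrable_cst.
    apply: eq_integral => x _; rewrite /= -EFinM -EFinB /g; congr EFin.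
    by field; rewrite gt_eqF.
  have : nbhs (2 * M' * ev g mu - M')%:E C'.
    by rewrite -fE; exact: open_nbhs_nbhs.
  rewrite /nbhs/= /ereal_nbhs/= => /nbhs_ballP[e /= e0 eC'].
  exists ([:: g], e / (2 * M')) => /=.
    by split => [|_ [<-|//]]; rewrite ?divr_gt0// mulr_gt0.
  move=> m /(_ g (or_introl erefl)); rewrite ltr_pdivlMr ?mulr_gt0// => mg.
  apply: CA => /=; rewrite /preimage/= fE; apply: eC'; rewrite /ball/=.
  have M2 : 0 < 2 * M' by rewrite mulr_gt0.
  have -> : 2 * M' * ev g mu - M' - (2 * M' * ev g m - M') =
    - ((ev g m - ev g mu) * (2 * M')) by ring.
  by rewrite normrN normrM (gtr0_norm M2).
move=> /(_ B); case; first by exact: open_nbhs_nbhs.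
move=> [fs e] /= [e0 tfs] h; exists fs, e; split => // m hm.
by apply: BU; exact: h.
Qed.

(** The data [s] range over a countable type; from this the countable family in [measurable_PEB] is
    made. *)
Definition step_fun (U : nat -> set E) (s : seq (nat * rat)) (x : E) : R :=
  \big[Num.max/0]_(p <- s) (ratr p.2 * \1_(U p.1) x).

Lemma step_fun_ge0 U s x : 0 <= step_fun U s x.
Proof. exact: bigmax_ge_id. Qed.

Lemma measurable_step_fun U s : (forall j, open (U j)) ->
  measurable_fun setT (step_fun U s : EB R E -> R).
Proof.
move=> oU; rewrite /step_fun; elim: s => [|p s ih].
  by under eq_fun do rewrite big_nil; exact: measurable_cst.
under eq_fun do rewrite big_cons; apply: measurable_maxr => //.
apply: measurable_funM; first exact: measurable_cst.
by apply: measurable_indic; exact: sub_sigma_algebra.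
Qed.

Lemma step_fun_le U s x (y : R) : 0 <= y ->
  (forall p, p \in s -> ratr p.2 * \1_(U p.1) x <= y) -> step_fun U s x <= y.
Proof.
move=> y0; rewrite /step_fun; elim: s => [|p s ih] h; first by rewrite big_nil.
rewrite big_cons ge_max h ?mem_head//= ih// => q qs.
by apply: h; rewrite inE qs orbT.
Qed.

Lemma le_step_fun U s x p : p \in s -> ratr p.2 * \1_(U p.1) x <= step_fun U s x.
Proof.
rewrite /step_fun; elim: s => [//|q s ih]; rewrite inE big_cons le_max.
by move=> /orP[/eqP ->|/ih ->]; rewrite ?lexx ?orbT.
Qed.

(** Near each point [f] stays above any rational below its value, so [f] is the increasing limit of
    the step functions under it; monotone convergence concludes. *)
Lemma step_fun_approx U f (mu : PE R E) (a : R) :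
  (forall j, open (U j)) -> (forall (x : E) V, nbhs x V -> exists j, U j x /\ U j `<=` V) ->
  test_fun f -> a < ev f mu ->
  exists s, (forall x, step_fun U s x <= f x) /\
    (a%:E < \int[mu]_x (step_fun U s x)%:E)%E.
Proof.
move=> oU bU tf af.
pose good (p : nat * rat) := `[< forall x, ratr p.2 * \1_(U p.1) x <= f x >].
(* Admissible pairs among the first [n] codes: these lists grow with [n], which makes the step
   functions monotone. *)
pose s_ n := [seq p <- pmap (@unpickle (nat * rat)%type) (iota 0 n) | good p].
have mem_s n p : (p \in s_ n) = good p && (p \in pmap unpickle (iota 0 n)).
  by rewrite mem_filter.
have in_s n p : good p -> (pickle p < n)%N -> p \in s_ n.
  move=> gp pn; rewrite mem_s gp/= mem_pmap; apply/mapP.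
  by exists (pickle p); rewrite ?pickleK// mem_iota.
have s_le n x : step_fun U (s_ n) x <= f x.
  apply: step_fun_le => [|p]; first by have /andP[] := tf.2 x.
  by rewrite mem_s => /andP[/asboolP + _]; exact.
have s_mono x : {homo (fun n => step_fun U (s_ n) x) : m n / (m <= n)%N >-> m <= n}.
  move=> m n mn; apply: step_fun_le => [|p]; first exact: step_fun_ge0.
  rewrite mem_s => /andP[gp]; rewrite mem_pmap => /mapP[i].
  rewrite mem_iota/= => im pE; apply: le_step_fun.
  rewrite mem_s gp mem_pmap; apply/mapP; exists i => //.
  by rewrite mem_iota/= (leq_trans im).
have lim_s x : (step_fun U (s_ n) x)%:E @[n --> \oo] --> (f x)%:E.
  apply: cvg_EFin; first by near=> n.
  apply/cvgrPdist_le => e e0.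
  have [q /itvP qI] : exists q : rat, ratr q \in `](f x - e), (f x)[.
    have [|q ?] := @rat_in_itvoo R (f x - e) (f x); last by exists q.
    by rewrite ltrBlDr ltrDl.
  have : nbhs x [set y | ratr q < f y].
    apply: (tf.1 x [set r | ratr q < r]); apply: open_nbhs_nbhs.
    by split; [exact: open_gt|rewrite /= qI].
  move=> /bU[j [Ujx Ujq]].
  have gp : good (j, q).
    apply/asboolP => y /=; rewrite indicE; case: (boolP (y \in U j)) => [|_].
      by rewrite inE mulr1 => /Ujq /ltW.
    by rewrite mulr0; have /andP[] := tf.2 y.
  exists (pickle (j, q)).+1 => // n /= qn.
  have := s_le n x; have := le_step_fun U x (in_s n _ gp qn).
  rewrite /= indicE mem_set// mulr1 => h1 h2.
  rewrite ger0_norm ?subr_ge0// lerBlDr -lerBlDl.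
  by apply: le_trans h1; rewrite ltW// qI.
have int_s : (\int[mu]_x (step_fun U (s_ n) x)%:E @[n --> \oo] -->
    \int[mu]_x (f x)%:E)%E.
  have -> : (\int[mu]_x (f x)%:E = \int[mu]_x limn (fun n => (step_fun U (s_ n) x)%:E))%E.
    by apply: eq_integral => x _; apply/esym/cvg_lim.
  apply: cvg_monotone_convergence => //.
  - by move=> n; apply/measurable_EFinP; exact: measurable_step_fun.
  - by move=> n x _; rewrite lee_fin step_fun_ge0.
  - by move=> x _ m n mn; rewrite lee_fin s_mono.
apply: contrapT => /forallNP h; move: af; apply/negP; rewrite -leNgt -lee_fin -evE//.
rewrite -(cvg_lim _ int_s)//; apply: lime_le; first by apply/cvg_ex; eexists; exact: int_s.
by near=> n; rewrite leNgt; apply/negP => an; apply: (h (s_ n)).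
Unshelve. all: by end_near. Qed.

(** A rational threshold between [a] and the integral turns the condition on [m] into one of
    countably many. *)
Lemma step_fun_lower U f (mu : PE R E) (a : R) :
  (forall j, open (U j)) -> (forall (x : E) V, nbhs x V -> exists j, U j x /\ U j `<=` V) ->
  test_fun f -> a < ev f mu ->
  exists p : seq (nat * rat) * rat,
    ((ratr p.2)%:E < \int[mu]_x (step_fun U p.1 x)%:E)%E /\
    forall m : PE R E, ((ratr p.2)%:E < \int[m]_x (step_fun U p.1 x)%:E)%E -> a < ev f m.
Proof.
move=> oU bU tf /(step_fun_approx oU bU tf)[s [sf as_]].
have ms := measurable_step_fun s oU.
have s01 x : 0 <= step_fun U s x <= 1.
  by rewrite step_fun_ge0 (le_trans (sf x))//; have /andP[] := tf.2 x.
have fin_s : (\int[mu]_x (step_fun U s x)%:E)%E \is a fin_num.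
  have /andP[h0 h1] := integral_unit_fin mu ms s01.
  by rewrite ge0_fin_numE// (le_lt_trans h1)// ltry.
have [q /itvP qI] : exists q : rat,
    ratr q \in `]a, (fine (\int[mu]_x (step_fun U s x)%:E)%E)[.
  by have [|q ?] := @rat_in_itvoo R a (fine (\int[mu]_x (step_fun U s x)%:E)%E);
    [rewrite -lte_fin fineK|exists q].
exists (s, q); split => /=; first by rewrite -(fineK fin_s) lte_fin qI.
move=> m qm; rewrite -lte_fin -evE//; apply: lt_le_trans (_ : (ratr q)%:E <= _)%E.
  by rewrite lte_fin qI.
apply: (le_trans (ltW qm)); apply: ge0_le_integral => //.
- by move=> x _; rewrite lee_fin step_fun_ge0.
- exact/measurable_EFinP.
- by apply/measurable_EFinP; exact: measurable_test.
- by move=> x _; rewrite lee_fin.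
Qed.

(* Second countability of the weak topology, in the only form used here: the
   countably many sets {m | q < \int g dm}, g a rational step function below open
   sets of a base, refine every weak neighbourhood. *)
Lemma measurable_PEB d (T : measurableType d) (k : T -> PE R E) :
  (exists D : set E, countable D /\ dense D) ->
  (forall B : set (EB R E), measurable B -> measurable_fun setT (fun t => k t B)) ->
  measurable_fun setT (k : T -> PEB R E).
Proof.
move=> /separable_open_base[U [oU bU]] mk.
pose bas (c : seq (seq (nat * rat) * rat)) : set (PE R E) :=
  [set m : PE R E | forall p, p \in c ->
  ((ratr p.2)%:E < \int[m]_x (step_fun U p.1 x)%:E)%E].
apply: (@measurability _ _ _ (PEB R E) setT _ (@open (PEw R E))); first by [].
move=> _ [B oB <-]; rewrite setTI.
pose G c := if `[< bas c `<=` B >] then k @^-1` bas c else set0.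
have -> : k @^-1` B = \bigcup_c G c.
  apply/seteqP; split => [t Bt|t [c _]]; last by rewrite /G; case: asboolP => // h /h.
  have /nbhs_weakP[fs [e [e0 tfs hfs]]] : nbhs (k t : PEw R E) B.
    by apply: open_nbhs_nbhs.
  have [c [kc hc]] : exists c, bas c (k t) /\ forall m, bas c m ->
      forall f, List.In f fs -> `|ev f m - ev f (k t)| < e.
    elim: fs tfs {hfs} => [_|f fs ih tfs]; first by exists [::].
    have [g gfs|c [kc hc]] := ih; first by apply: tfs; right.
    have tf : test_fun f by apply: tfs; left.
    have [p [kp hp]] : exists p : seq (nat * rat) * rat,
        ((ratr p.2)%:E < \int[k t]_x (step_fun U p.1 x)%:E)%E /\
        forall m : PE R E, ((ratr p.2)%:E < \int[m]_x (step_fun U p.1 x)%:E)%E ->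
        ev f (k t) - e < ev f m.
      by apply: step_fun_lower => //; rewrite ltrBlDr ltrDl.
    (* Step functions bound [ev] only from below; the upper bound on [ev f] is the lower bound for
       [1 - f]. *)
    have [p' [kp' hp']] : exists p : seq (nat * rat) * rat,
        ((ratr p.2)%:E < \int[k t]_x (step_fun U p.1 x)%:E)%E /\
        forall m : PE R E, ((ratr p.2)%:E < \int[m]_x (step_fun U p.1 x)%:E)%E ->
        ev (fun x => 1 - f x) (k t) - e < ev (fun x => 1 - f x) m.
      by apply: step_fun_lower => //; [exact: test_funC|rewrite ltrBlDr ltrDl].
    exists (p :: p' :: c); split.
      by move=> q; rewrite !inE => /or3P[/eqP ->|/eqP ->|/kc].
    move=> m hm g /= [<-|gfs]; last first.
      by apply: hc gfs => q qc; apply: hm; rewrite !inE qc !orbT.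
    have := hp m (hm p _); rewrite inE eqxx => /(_ isT) h1.
    have := hp' m (hm p' _); rewrite !inE eqxx orbT => /(_ isT).
    by rewrite !evC// ltr_norml; lra.
  exists c => //; rewrite /G asboolT// => m hm; apply: hfs; exact: hc.
apply: countable_bigcupT_measurable => // c; rewrite /G; case: ifP => // _.
elim: c => [|p c ih].
  by rewrite (_ : _ @^-1` _ = setT)//; apply/seteqP; split => // t _ p.
rewrite (_ : _ @^-1` _ =
    [set t | ((ratr p.2)%:E < \int[k t]_x (step_fun U p.1 x)%:E)%E] `&` k @^-1` bas c).
  apply: measurableI => //; rewrite -[X in measurable X]setTI.
  apply: emeasurable_fun_o_infty => //.
  apply: (@measurable_fun_integral_kernel _ _ _ _ _ (fun t => k t)) => //.
    by move=> z; rewrite lee_fin step_fun_ge0.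
  by apply/measurable_EFinP; exact: measurable_step_fun.
apply/seteqP; split => [t h|t [h1 h2] q].
  by split=> [|q qc]; apply: h; rewrite inE ?eqxx// qc orbT.
by rewrite inE => /orP[/eqP ->//|]; exact: h2.
Qed.

Lemma measurable_ev d (T : measurableType d) (k : T -> PE R E) f :
  measurable_fun setT (k : T -> PEB R E) -> test_fun f ->
  measurable_fun setT (fun t => ev f (k t)).
Proof.
move=> mk tf; apply: (measurability _ (RGenOInfty.measurableE R)).
move=> _ [_ [a ->] <-]; rewrite setTI.
have mO : measurable ([set m | a < ev f m] : set (PEB R E)).
  apply: sub_sigma_algebra => /=; rewrite openE => m /= am.
  apply: filterS (nbhs_ev m tf (_ : 0 < ev f m - a)); last by rewrite subr_gt0.
  by move=> m' /=; rewrite ltr_norml; lra.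
rewrite (_ : _ @^-1` _ = k @^-1` [set m | a < ev f m]); last first.
  by apply/seteqP; split => t /=; rewrite in_itv/= andbT.
by rewrite -[X in measurable X]setTI; exact: mk.
Qed.

Lemma continuous_contract : continuous (@contract R).
Proof.
move=> x; apply/cvgrPdist_lt => e e0; have := nbhsx_ballx x e e0.
by apply: filterS => y.
Qed.

(** Multiples of the distance to the complement, truncated at 1, increase to the indicator. The
    distance is extended real, and infinite if the complement is empty, hence [contract]. *)
Lemma open_test_approx (G : set E) : open G ->
  exists f_ : nat -> E -> R, [/\ forall n, test_fun (f_ n),
    forall x, {homo f_ ^~ x : m n / (m <= n)%N >-> m <= n} &
    forall x, f_ n x @[n --> \oo] --> (\1_G x : R)].
Proof.
move=> oG; pose h x : R := contract (edist_inf (~` G) x).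
have h0 x : 0 <= h x.
  by rewrite /h -contract0 le_contract edist_inf_ge0.
have ch : continuous h.
  move=> x; apply: (@continuous_comp _ _ _ (edist_inf (~` G)) (@contract R)).
    exact: edist_inf_continuous.
  exact: continuous_contract.
exists (fun n x => Num.min 1 (n%:R * h x)); split.
- move=> n; split => x.
    apply: (@continuous_min _ _ (cst 1) (fun x => n%:R * h x) x); first exact: cvg_cst.
    by apply: cvgM; [exact: cvg_cst|exact: ch].
  by rewrite le_min ler01 mulr_ge0//= ge_min lexx.
- move=> x m n mn; rewrite le_min ge_min lexx/= ge_min.
  by rewrite ler_wpM2r ?orbT// ler_nat.
- move=> x; rewrite indicE; case: (boolP (x \in G)) => [|/negP]; rewrite inE => Gx.
    have hx : 0 < h x.
      have /nbhs_ballP[e /= e0 eG] : nbhs x G by apply: open_nbhs_nbhs.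
      rewrite /h -contract0 lt_contract (@lt_le_trans _ _ e%:E)//.
      apply: le_ereal_inf_tmp => _ [a Ga <-]; rewrite leNgt; apply/negP.
      by move=> /edist_lt_ball /eG.
    apply/cvgrPdist_le => e e0; near=> n.
    rewrite (_ : Num.min _ _ = 1) ?subrr ?normr0 ?ltW//.
    apply/min_idPl; rewrite -ler_pdivrMr//; near: n.
    exact: nbhs_infty_ger.
  rewrite (_ : (fun _ => _) = cst 0); first exact: cvg_cst.
  apply/funext => n; rewrite /h edist_inf0// contract0 mulr0.
  by apply/min_idPr.
Unshelve. all: by end_near. Qed.

(** Converse of [measurable_PEB]. Open sets are handled by test functions increasing to the
    indicator; they are stable under intersection, so a Dynkin argument reaches all Borel sets. *)
Lemma measurable_PEB_eval d (T : measurableType d) (k : T -> PE R E) :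
  measurable_fun setT (k : T -> PEB R E) ->
  forall B : set (EB R E), measurable B -> measurable_fun setT (fun t => k t B).
Proof.
move=> mk B mB.
apply: (@dynkin_induction _ (EB R E) (@open E)
  (fun A => measurable_fun setT (fun t => k t A))) => //.
- by move=> A A'; exact: openI.
- rewrite (_ : (fun _ => _) = cst 1%E); first exact: measurable_cst.
  by apply/funext => t; exact: probability_setT.
- move=> G /[dup] oG /open_test_approx[f_ [tf ndf cf]].
  apply: (@emeasurable_fun_cvg _ _ _ _ (fun n t => (ev (f_ n) (k t))%:E)).
    by move=> n; apply/measurable_EFinP; exact: measurable_ev.
  move=> t _; have mG : measurable (G : set (EB R E)) by exact: sub_sigma_algebra.
  rewrite -(setIT G) -integral_indic//; under eq_cvg do rewrite -evE//.
  have -> : (\int[k t]_x (\1_G x)%:E = \int[k t]_x limn (fun n => (f_ n x)%:E))%E.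
    apply: eq_integral => x _; apply/esym/cvg_lim => //.
    by apply: cvg_EFin; [near=> n|exact: cf].
  apply: cvg_monotone_convergence => //.
  + by move=> n; apply/measurable_EFinP; exact: measurable_test.
  + by move=> n x _; rewrite lee_fin; have /andP[] := (tf n).2 x.
  + by move=> x _ m n mn; rewrite lee_fin ndf.
- move=> S mS mkS; rewrite (_ : (fun _ => _) = (fun t => 1 - k t S)%E).
    by apply: emeasurable_funB => //; exact: measurable_cst.
  by apply/funext => t; rewrite probability_setC.
- move=> F mF tF mkF.
  apply: (@emeasurable_fun_cvg _ _ _ _ (fun n t => \sum_(0 <= i < n) k t (F i))%E).
    by move=> n; exact: emeasurable_sum.
  move=> t _; apply: measure_semi_sigma_additive => //.
  exact: bigcup_measurable.
Unshelve. all: by end_near. Qed.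

End weak_topology.

(** * Coding bit sequences by points of the Cantor set *)

Section ternary_expansions.
Context {R : realType}.
Implicit Type b : nat -> bool.

Definition tern_sum b n : R := \sum_(i < n) (2 * (b i)%:R / 3 ^+ i.+1).

(* Digits in {0, 2} only, so the first digit is read off by comparing with 1/2. *)
Definition tern b : R := limn (tern_sum b).

Lemma tern_sumS b n :
  tern_sum b n.+1 = (2 * (b 0%N)%:R + tern_sum (b \o succn) n) / 3.
Proof.
rewrite /tern_sum big_ord_recl/= expr1 [RHS]mulrDl.
congr (_ + _).
rewrite mulr_suml; apply: eq_bigr => i _; rewrite /bump/= add1n [in LHS]exprSr invfM.
by rewrite mulrA.
Qed.

Lemma tern_sum01 b n : 0 <= tern_sum b n <= 1.
Proof.
elim: n b => [|n ih] b; first by rewrite /tern_sum big_ord0 lexx ler01.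
rewrite tern_sumS; have := ih (b \o succn).
have : 0 <= ((b 0%N)%:R : R) <= 1 by case: (b 0%N); rewrite /= ?lexx ?ler01.
lra.
Qed.

Lemma cvg_tern_sum b : tern_sum b n @[n --> \oo] --> tern b.
Proof.
apply: nondecreasing_is_cvgn.
  apply/nondecreasing_seqP => n; rewrite /tern_sum big_ord_recr/= lerDl.
  by rewrite divr_ge0// mulr_ge0.
by exists 1 => _ [n _ <-]; have /andP[] := tern_sum01 b n.
Qed.

Lemma tern01 b : 0 <= tern b <= 1.
Proof.
have c := @cvg_tern_sum b; apply/andP; split.
  apply: limr_ge; first by apply/cvg_ex; eexists; exact: c.
  by near=> n; have /andP[] := tern_sum01 b n.
apply: limr_le; first by apply/cvg_ex; eexists; exact: c.
by near=> n; have /andP[] := tern_sum01 b n.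
Unshelve. all: by end_near. Qed.

Lemma ternS b : tern b = (2 * (b 0%N)%:R + tern (b \o succn)) / 3.
Proof.
have c : tern_sum b n.+1 @[n --> \oo] --> tern b.
  by rewrite cvg_shiftS; exact: cvg_tern_sum.
move: c; under eq_cvg do rewrite tern_sumS.
move=> /cvg_lim <-//; apply/cvg_lim => //.
by apply: cvgMr_tmp; apply: cvgD; [exact: cvg_cst|exact: cvg_tern_sum].
Qed.

(** Deletes the first digit of a point of the Cantor set. It is piecewise affine on the whole line,
    so the digits are Borel functions there. *)
Definition tern_shift (t : R) : R := 3 * t - 2 * \1_[set s : R | 1 / 2 <= s] t.

Definition tern_digit (j : nat) (t : R) : bool := 1 / 2 <= iter j tern_shift t.

Lemma tern_digit0 b : (1 / 2 <= tern b) = b 0%N.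
Proof.
rewrite ternS; have := tern01 (b \o succn).
case: (b 0%N) => /= h; first by apply/idP; lra.
by apply/negbTE; rewrite -ltNge; lra.
Qed.

Lemma tern_shiftE b : tern_shift (tern b) = tern (b \o succn).
Proof.
rewrite /tern_shift indicE (_ : (_ \in _) = (1 / 2 <= tern b)); last first.
  by apply/idP/idP; rewrite inE.
by rewrite tern_digit0 [in 3 * _]ternS; field.
Qed.

Lemma tern_digitE b j : tern_digit j (tern b) = b j.
Proof.
have -> : tern_digit j (tern b) = (1 / 2 <= tern (fun i => b (j + i)%N)).
  rewrite /tern_digit; congr (_ <= _).
  elim: j => [//|j ih]; rewrite iterS ih tern_shiftE; congr tern.
  by apply/funext => i /=; rewrite addnS.
by rewrite tern_digit0 addn0.
Qed.

Lemma measurable_tern_shift : measurable_fun setT tern_shift.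
Proof.
apply: measurable_funB.
  by apply: measurable_funM => //; exact: measurable_cst.
apply: measurable_funM; first exact: measurable_cst.
apply: measurable_indic; rewrite (_ : [set _ | _] = `[1 / 2, +oo[%classic)//.
by apply/seteqP; split => s /=; rewrite in_itv/= andbT.
Qed.

Lemma measurable_tern_digit j : measurable [set t | tern_digit j t].
Proof.
have m : measurable_fun setT (iter j tern_shift).
  elim: j => [|j ih]; first exact: measurable_id.
  exact: (measurableT_comp measurable_tern_shift).
rewrite (_ : [set t | _] = iter j tern_shift @^-1` `[1 / 2, +oo[%classic).
  by rewrite -[X in measurable X]setTI; apply: m.
by apply/seteqP; split => s /=; rewrite in_itv/= andbT.
Qed.

End ternary_expansions.

(** * The space as a Borel retract of the line *)

Section borel_retract.
Context (R : realType) (E : pseudoPMetricType R).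

Lemma measurable_ball_interior (x : E) (e : R) :
  measurable (interior (ball x e) : set (EB R E)).
Proof. by apply: sub_sigma_algebra; exact: open_interior. Qed.

(* A point is coded by the indices of the balls of a countable base containing it;
   the decoder follows, at each radius, the first ball that the code contains. *)
Lemma borel_retract_of_line :
  hausdorff_space E ->
  (forall G : set_system E, ProperFilter G -> cauchy G -> cvg G) ->
  (exists D : set E, countable D /\ dense D) ->
  exists (phi : EB R E -> R) (psi : R -> EB R E),
    [/\ measurable_fun setT phi, measurable_fun setT psi,
        forall x, 0 <= phi x <= 1 & forall x, psi (phi x) = x].
Proof.
move=> hE cE /separable_dense_seq[c hc].
pose B (j : nat) : set E := if @unpickle (nat * nat)%type j is Some p then
  interior (ball (c p.1) (p.2.+1%:R^-1)) else set0.
have mB j : measurable (B j : set (EB R E)).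
  by rewrite /B; case: unpickle => [p|//]; exact: measurable_ball_interior.
pose phi (x : EB R E) : R := tern (fun j => x \in B j).
pose dig (i k : nat) (t : R) := tern_digit (pickle (i, k)) t.
have mdig i k : measurable [set t | dig i k t] by exact: measurable_tern_digit.
(* Centre of the first ball of radius 1/(k+1) marked in the code [t]; the default 0 accounts for the
   second set of the union that describes the level sets below. *)
pose idx k t : nat := if pselect (exists i, dig i k t) is left h then ex_minn h else 0%N.
have midx k (Z : set nat) : measurable [set t | Z (idx k t)].
  have -> : [set t | Z (idx k t)] = \bigcup_(i in Z) [set t | idx k t = i].
    apply/seteqP; split => [t Zt|t [i Zi /= ->]//]; by exists (idx k t).
  apply: bigcup_measurable => i _.
  have -> : [set t | idx k t = i] =
     ([set t | dig i k t] `&` \bigcap_(l in [set l | (l < i)%N]) ~` [set t | dig l k t])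
     `|` (if i == 0%N then \bigcap_l ~` [set t | dig l k t] else set0).
    apply/seteqP; split => t /=.
      rewrite /idx; case: pselect => [h|h].
        case: ex_minnP => m dm mmin <-; left; split => // l /= lm dl.
        by have := mmin l dl; rewrite leqNgt lm.
      by move=> <-; right => l _ dl; apply: h; exists l.
    rewrite /idx; case: pselect => [h|h].
      case: ex_minnP => m dm mmin [[di li]|].
        apply/eqP; rewrite eqn_leq mmin//= leqNgt; apply/negP => mi.
        by have := li m mi.
      by case: ifP => // _ /(_ m Logic.I).
    by case=> [[di _]|]; [exfalso; apply: h; exists i|case: eqP].
  apply: measurableU; last first.
    by case: ifP => // _; apply: bigcapT_measurable => l; exact: measurableC.
  by apply: measurableI => //; apply: bigcap_measurableType => l _; exact: measurableC.
have midx2 k l (Z : nat -> nat -> Prop) : measurable [set t | Z (idx k t) (idx l t)].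
  have -> : [set t | Z (idx k t) (idx l t)] =
      \bigcup_i ([set t | [set i] (idx k t)] `&` [set t | Z i (idx l t)]).
    apply/seteqP; split => [t Zt|t [i _ [/= -> //]]]; by exists (idx k t).
  by apply: bigcupT_measurable => i; apply: measurableI; exact: midx.
pose u t (k : nat) : E := c (idx k t).
pose psi (t : R) : EB R E := lim (u t @ \oo).
(* The codes whose centres converge, in Cauchy form: all quantifiers are countable, so [C] is
   Borel. *)
pose C := [set t | forall p : nat, exists N, forall m, (N <= m)%N ->
  ball (c (idx N t)) (p.+1%:R^-1) (c (idx m t))].
have CP t : C t -> cvg (u t @ \oo).
  move=> Ct; apply: cE; apply: cauchy_exP => e e0.
  have [p pe] := ltr_add_invr (y := 0) (x := e) e0.
  rewrite add0r in pe; have [N hN] := Ct p; exists (u t N); exists N => // m /= Nm.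
  by apply: le_ball (hN _ Nm); exact: ltW.
have PC t : cvg (u t @ \oo) -> C t.
  move=> /cvg_ballP h p.
  have p0 : 0 < p.+1%:R^-1 / 2 :> R by rewrite divr_gt0.
  have [N _ hN] := h _ p0; exists N => m Nm; rewrite [_^-1]splitr.
  by apply: (@ball_triangle _ _ (lim (u t @ \oo))); [apply: ball_sym|]; apply: hN => /=.
have mC : measurable C.
  have -> : C = \bigcap_(p in setT) \bigcup_N \bigcap_(m in [set m | (N <= m)%N])
      [set t | ball (c (idx N t)) (p.+1%:R^-1) (c (idx m t))].
    apply/seteqP; split => t; first by move=> h p _; have [N hN] := h p; exists N.
    by move=> h p; have [N _ hN] := h p Logic.I; exists N.
  apply: bigcap_measurableType => p _; apply: bigcupT_measurable => N.
  apply: bigcap_measurableType => m _.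
  exact: (midx2 N m (fun i j => ball (c i) (p.+1%:R^-1) (c j))).
exists phi, psi; split.
- apply: (@measurable_fun_cvg _ _ _ _ (fun n (x : EB R E) => tern_sum (fun j => x \in B j) n)).
    move=> n; rewrite /tern_sum; apply: measurable_sum => i.
    apply: measurable_funM; last exact: measurable_cst.
    apply: measurable_funM; first exact: measurable_cst.
    rewrite (_ : (fun _ => _) = \1_(B i)); first exact: measurable_indic.
    by apply/funext => x; rewrite indicE.
  by move=> x _; exact: cvg_tern_sum.
- apply: (@measurability _ _ _ (EB R E) setT _ (@open E)); first by [].
  move=> _ [V oV <-]; rewrite setTI.
  (* A limit lies in the open [V] iff the terms eventually keep a fixed distance from its
     complement. Outside [C], [lim] returns [point], so these codes are all in the preimage or all
     out of it. *)
  pose Vp p := [set x : E | ball x (p.+1%:R^-1) `<=` V].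
  have -> : psi @^-1` V = (C `&` \bigcup_p \bigcup_N \bigcap_(m in [set m | (N <= m)%N])
       [set t | Vp p (c (idx m t))]) `|` (if `[< V point >] then ~` C else set0).
    apply/seteqP; split => t /=.
      move=> Vt; have [Ct|Ct] := pselect (C t); last first.
        right; rewrite asboolT//; move: Vt; rewrite /psi.
        rewrite /lim /lim_in; case: xgetP => [l _ hl|//].
        by case: Ct; apply: PC; apply/cvg_ex; exists l.
      left; split => //.
      have /nbhs_ballP[e /= e0 eV] : nbhs (lim (u t @ \oo)) V by apply: open_nbhs_nbhs.
      have [p pe] := ltr_add_invr (y := 0) (x := e / 2) (divr_gt0 e0 (ltr0Sn _ 1)).
      rewrite add0r in pe.
      have e20 : 0 < e / 2 by rewrite divr_gt0.
      have /cvg_ballP /(_ _ e20)[N _ hN] := CP _ Ct.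
      exists p => //; exists N => // m /= Nm y my; apply: eV; rewrite (splitr e).
      by apply: ball_triangle (hN m Nm) _; apply: le_ball my; exact: ltW.
    case=> [[Ct [p _ [N _ hN]]]|]; last first.
      case: asboolP => // Vpt Ct; rewrite /psi /lim /lim_in; case: xgetP => [l _ hl|//].
      by case: Ct; apply: PC; apply/cvg_ex; exists l.
    have p0 : 0 < p.+1%:R^-1 :> R by rewrite invr_gt0.
    have /cvg_ballP /(_ _ p0)[M _ hM] := CP _ Ct.
    apply: (hN (maxn N M)); rewrite /= ?leq_maxl//.
    by apply: ball_sym; apply: hM; rewrite /= leq_maxr.
  apply: measurableU; last by case: ifP => // _; exact: measurableC.
  apply: measurableI => //; apply: bigcupT_measurable => p.
  apply: bigcupT_measurable => N; apply: bigcap_measurableType => m _.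
  exact: (midx m (fun i => Vp p (c i))).
- by move=> x; exact: tern01.
(* In the code of [x] the balls marked are those with [x] in their interior; one exists at each
   radius, so the chosen centres tend to [x]. *)
- move=> x; have hx k : ball (u (phi x) k) (k.+1%:R^-1) x.
    have k0 : 0 < k.+1%:R^-1 :> R by rewrite invr_gt0.
    rewrite /u /idx; case: pselect => [h|h].
      case: ex_minnP => m; rewrite /dig /phi tern_digitE /B pickleK inE/=.
      by move=> /interior_subset.
    have [i xi] := hc x _ k0.
    case: h; exists i; rewrite /dig /phi tern_digitE /B pickleK inE/=.
    exact: xi.
  apply: (@cvg_lim _ hE) => //; apply/cvg_ballP => e e0.
  have [p pe] := ltr_add_invr (y := 0) (x := e) e0.
  rewrite add0r in pe; exists p => // k /= pk.
  apply: ball_sym; apply: le_ball (hx k); apply: le_trans (ltW pe).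
  by rewrite lef_pV2 ?posrE// ler_nat.
Unshelve. all: by end_near. Qed.

End borel_retract.

(** * Unnormalised laws on an event *)

Section trace_laws.
Context d d' (T : measurableType d) (Y : measurableType d') (R : realType).

Section trace_law.
Variables (mu : {measure set T -> \bar R}) (f : T -> Y) (D : set T).
Variables (mf : measurable_fun setT f) (mD : measurable D).

(** Law of [f] on the event [D], without normalisation. The term carries its measurability proofs so
    that its measure structure can be inferred. *)
Definition trace_law (mf : measurable_fun setT f) (mD : measurable D) (B : set Y) :
  \bar R := mu (f @^-1` B `&` D).

Let trace_law0 : trace_law mf mD set0 = 0%E.
Proof. by rewrite /trace_law preimage_set0 set0I measure0. Qed.

Let trace_law_ge0 B : (0 <= trace_law mf mD B)%E.
Proof. exact: measure_ge0. Qed.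

Let trace_law_sigma_additive : semi_sigma_additive (trace_law mf mD).
Proof.
have mfI B : measurable B -> measurable (f @^-1` B `&` D).
  by move=> mB; apply: measurableI => //; rewrite -[X in measurable X]setTI; exact: mf.
move=> F mF tF mUF; rewrite /trace_law preimage_bigcup setI_bigcupl.
apply: measure_semi_sigma_additive.
- by move=> n; exact: mfI.
- apply/trivIsetP => /= i j _ _ ij; rewrite setIACA -preimage_setI.
  by move/trivIsetP : tF => /(_ _ _ _ _ ij) ->//; rewrite preimage_set0 set0I.
- by rewrite -setI_bigcupl -preimage_bigcup; exact: mfI.
Qed.

HB.instance Definition _ := isMeasure.Build _ _ _ (trace_law mf mD)
  trace_law0 trace_law_ge0 trace_law_sigma_additive.

End trace_law.

Section trace_law_finite.
Variables (mu : {finite_measure set T -> \bar R}) (f : T -> Y) (D : set T).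
Variables (mf : measurable_fun setT f) (mD : measurable D).

Let trace_law_fin : fin_num_fun (trace_law mu mf mD).
Proof.
move=> B mB; rewrite /trace_law fin_num_measure//; apply: measurableI => //.
by rewrite -[X in measurable X]setTI; exact: mf.
Qed.

HB.instance Definition _ := Measure_isFinite.Build _ _ _ (trace_law mu mf mD)
  trace_law_fin.

End trace_law_finite.
End trace_laws.

(** * Sampling a conditional law with a uniform variable *)

Section randomization.
Context {R : realType}.
Local Open Scope ereal_scope.

Definition unif01 : probability (measurableTypeR R) R := uniform_prob (@ltr01 R).

Lemma unif01_le (c : \bar R) : 0 <= c -> unif01 [set u : R | u%:E <= c] = mine 1 c.
Proof.
move=> c0; pose e : R := fine (mine 1 c).
have e1 : mine 1 c = e%:E.
  rewrite /e fineK// ge0_fin_numE ?le_min ?lee01//.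
  by rewrite (@le_lt_trans _ _ 1)// ?ge_min ?lexx// ltry.
have e01 : (0 <= e <= 1)%R by rewrite -!lee_fin -e1 le_min lee01 c0/= ge_min lexx.
rewrite /unif01 /= /uniform_prob integral_uniform_pdf.
have -> : [set u : R | u%:E <= c] `&` `[0%R, 1%R] = `[0%R, e]%classic.
  apply/seteqP; split => u /=; rewrite !in_itv/=.
    move=> [uc /andP[u0 u1]]; rewrite u0/= -lee_fin -e1 le_min uc andbT.
    by rewrite lee_fin.
  move=> /andP[u0]; rewrite -lee_fin -e1 le_min => /andP[u1 uc].
  by rewrite u0 -lee_fin u1.
rewrite (eq_integral (cst 1)); last first.
  move=> u; rewrite inE/= in_itv/= /uniform_pdf => /andP[u0 ue].
  by rewrite u0 (le_trans ue) ?(andP e01).2//= subr0 invr1.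
rewrite integral_cst//= mul1e lebesgue_measure_itv/= e1 lte_fin.
case: ltP => [e0|]; first by rewrite oppr0 adde0.
by move=> e0; congr EFin; apply/eqP; rewrite eq_le e0 (andP e01).1.
Qed.

(** Two rounds of uniqueness: for fixed [C] the half-lines determine the trace on the second factor,
    and then rectangles determine the measure. *)
Lemma finite_measure_eq_rect d (Y : measurableType d)
    (m1 m2 : {measure set (Y * R) -> \bar R}) : m1 setT < +oo ->
  (forall C t, measurable C -> m1 (C `*` `]-oo, t[%classic) = m2 (C `*` `]-oo, t[%classic)) ->
  forall A, measurable A -> m1 A = m2 A.
Proof.
move=> m1oo h.
have fin (B : set (Y * R)) : measurable B -> m1 B < +oo.
  by move=> mB; apply: le_lt_trans m1oo; apply: le_measure; rewrite ?inE.
have step C D : measurable C -> measurable D -> m1 (C `*` D) = m2 (C `*` D).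
  move=> mC mD.
  have mCT : measurable (C `*` [set: R]) by exact: measurableX.
  have E (m : {measure set (Y * R) -> \bar R}) (D' : set R) :
      m (C `*` D') = trace_law m (@measurable_snd _ _ Y R) mCT D'.
    rewrite /trace_law; congr (m _); apply/seteqP; split => -[y u]/=; tauto.
  rewrite !E; set M1 := trace_law m1 _ _; set M2 := trace_law m2 _ _.
  have := @measure_unique _ R _ (@RGenInftyO.G R) (fun n => `]-oo, n%:R[%classic)
    _ _ _ _ M1 M2 _ _ D mD.
  apply => //.
  - exact: RGenInftyO.measurableE.
  - move=> _ _ [x ->] [y ->]; exists (Num.min x y).
    by apply/seteqP; split => u /=; rewrite !in_itv/= lt_min => /andP.
  - by move=> i; exists i%:R.
  - apply/seteqP; split => // u _; exists (Num.truncn (Num.max 0 (u : R))%R).+1 => //=.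
    rewrite in_itv/=; apply: le_lt_trans (_ : (Num.max 0 (u : R) < _)%R); last exact: truncnS_gt.
    by rewrite le_max lexx orbT.
  - by move=> _ [x ->]; have := h C x mC; rewrite (E m1) (E m2).
  - move=> k; have : measurable (C `*` `]-oo, (k%:R : R)[%classic) by exact: measurableX.
    by move=> /fin; rewrite (E m1).
move=> A mA; apply: (measure_unique [set A1 `*` A2 | A1 in measurable & A2 in measurable]
   (fun=> setT)) => //.
- exact: measurable_prod_measurableType.
- move=> _ _ [X1 mX1 [X2 mX2 <-]] [Y1 mY1 [Y2 mY2 <-]].
  rewrite -setXI; exists (X1 `&` Y1); first exact: measurableI.
  by exists (X2 `&` Y2) => //; exact: measurableI.
- by move=> i; exists setT => //; exists setT => //; rewrite setXTT.
- by rewrite bigcup_const//; exists 0%N.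
- by move=> _ [X1 mX1 [X2 mX2 <-]]; exact: step.
Qed.

(** Splitting [C] according to where the first density exceeds the maximum of the others reduces a
    maximum to its parts, each below [V]. *)
Lemma integral_bigmax_le d (Y : measurableType d) (mu V : {measure set Y -> \bar R})
    (I : eqType) (L : seq I) (h : I -> Y -> \bar R) :
  (forall q y, 0 <= h q y) -> (forall q, measurable_fun setT (h q)) ->
  (forall q, q \in L -> forall B, measurable B -> \int[mu]_(y in B) h q y <= V B) ->
  forall C, measurable C -> \int[mu]_(y in C) (\big[maxe/0]_(q <- L) h q y) <= V C.
Proof.
move=> h0 mh; elim: L => [|q L ih] hV C mC.
  by under eq_integral do rewrite big_nil; rewrite integral0.
pose M y := \big[maxe/0]_(q <- L) h q y.
have M0 y : 0 <= M y by exact: bigmax_ge_id.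
have mM : measurable_fun setT M.
  rewrite /M; elim: (L) => [|r s ihs].
    by under eq_fun do rewrite big_nil; exact: measurable_cst.
  by under eq_fun do rewrite big_cons; exact: measurable_maxe.
have mD : measurable [set y | M y <= h q y].
  by rewrite -[X in measurable X]setTI; exact: measurable_fun_lee.
pose C1 := C `&` [set y | M y <= h q y]; pose C2 := C `\` [set y | M y <= h q y].
have mC1 : measurable C1 by exact: measurableI.
have mC2 : measurable C2 by exact: measurableD.
have dC : [disjoint C1 & C2].
  rewrite disj_set2E; apply/eqP/seteqP; split => // y [[_ h1] [_ h2]].
  exact: (h2 h1).
have CE : C = C1 `|` C2 by rewrite /C1 /C2 setUIDK.
have mmax : measurable_fun setT (fun y => maxe (h q y) (M y)) by exact: measurable_maxe.
under eq_integral do rewrite big_cons -/(M _).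
rewrite CE ge0_integral_setU//; last 2 first.
- exact: measurable_funTS.
- by move=> y _; rewrite le_max h0.
rewrite measureU//; last by apply/eqP; rewrite -disj_set2E.
apply: leeD.
  rewrite (eq_integral (h q)); first by apply: hV => //; exact: mem_head.
  by move=> y; rewrite inE => -[_ /= hy]; apply/max_idPl.
rewrite (eq_integral M); first by apply: ih => // r rL; apply: hV; rewrite inE rL orbT.
by move=> y; rewrite inE => -[_ /= /negP hy]; apply/max_idPr; rewrite ltW// ltNge.
Qed.

Lemma prod_unif01_subgraph d (Y : measurableType d) (mu : probability Y R)
    (g : Y -> \bar R) (C : set Y) : (forall y, 0 <= g y) -> measurable_fun setT g ->
  measurable C ->
  (mu \x unif01) [set p | C p.1 /\ p.2%:E <= g p.1] = \int[mu]_(y in C) mine 1 (g y).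
Proof.
move=> g0 mg mC; rewrite /product_measure1 [RHS]integral_mkcond.
apply: eq_integral => y _ /=; rewrite patchE; case: ifPn; rewrite ?notin_setE ?inE => Cy.
  rewrite -unif01_le//; congr (unif01 _).
  by apply/seteqP; split => u; rewrite /xsection/= inE/= => //-[].
rewrite (_ : xsection _ _ = set0) ?measure0//.
by apply/seteqP; split => u //; rewrite /xsection/= inE/= => -[].
Qed.

(** Quantile transform: [h q] is the conditional probability of T <= q given [X], and [Psi] inverts
    it in [u]. The [h q] are monotone in [q] only almost everywhere. No null set is removed: the two
    measures are compared on half-lines through finitely many [h q] at a time. *)
Lemma randomization d d' (Om : measurableType d) (Y : measurableType d')
    (P : probability Om R) (X : Om -> Y) (T : Om -> R) :
  measurable_fun setT X -> measurable_fun setT T -> (forall w, (0 <= T w <= 1)%R) ->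
  exists Psi : Y * R -> R, measurable_fun setT Psi /\
    forall A : set (Y * R), measurable A ->
      P [set w | A (X w, T w)] = \int[P]_w unif01 [set u | A (X w, Psi (X w, u))].
Proof.
move=> mX mT T01.
pose X' : {mfun Om >-> Y} := mfun_Sub (mem_set mX).
pose PX : probability Y R := distribution P X'.
have mTq (t : R) : measurable [set w | (T w <= t)%R].
  rewrite (_ : [set w | _] = T @^-1` `]-oo, t]%classic).
    by rewrite -[X in measurable X]setTI; exact: mT.
  by apply/seteqP; split => w /=; rewrite in_itv.
have mTt (t : R) : measurable [set w | (T w < t)%R].
  rewrite (_ : [set w | _] = T @^-1` `]-oo, t[%classic).
    by rewrite -[X in measurable X]setTI; exact: mT.
  by apply/seteqP; split => w /=; rewrite in_itv.
have mXB B : measurable B -> measurable (X @^-1` B).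
  by move=> mB; rewrite -[X in measurable X]setTI; exact: (mX measurableT).
have /choice[h hh] : forall q : rat, exists f : Y -> \bar R,
    [/\ forall y, 0 <= f y, PX.-integrable setT f & forall B, measurable B ->
      P (X @^-1` B `&` [set w | (T w <= ratr q)%R]) = \int[PX]_(y in B) f y].
  move=> q; have := @radon_nikodym_finite _ _ R PX (trace_law P mX (mTq (ratr q))).
  apply; apply/null_content_dominatesP => B mB PB0; apply/eqP.
  rewrite eq_le measure_ge0 andbT -PB0; apply: le_measure; rewrite ?inE//.
  - by apply: measurableI => //; exact: mXB.
  - exact: mXB.
have h0 q y : 0 <= h q y by have [] := hh q.
have mh q : measurable_fun setT (h q).
  by have [_ ih _] := hh q; exact: measurable_int ih.
have hP q B : measurable B ->
    P (X @^-1` B `&` [set w | (T w <= ratr q)%R]) = \int[PX]_(y in B) h q y.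
  by have [_ _] := hh q; exact.
(* The point 1 keeps the set nonempty and the condition on [q] bounds it below by 0, so its infimum
   is meaningful for every [u]. *)
pose S y (u : R) : set R :=
  [set 1%R] `|` [set ratr q | q in [set q : rat | (0 <= (ratr q : R))%R /\ u%:E <= h q y]].
pose Psi (p : Y * R) : R := inf (S p.1 p.2).
have S_lb y u : has_lbound (S y u).
  by exists 0%R => _ [-> //|[q [q0 _] <-]].
have Psi_le1 p : (Psi p <= 1)%R by apply: ge_inf; [exact: S_lb|left].
have Psi_lt p (t : R) : (t <= 1)%R -> (Psi p < t)%R <->
    exists q : rat, [/\ (0 <= (ratr q : R))%R, ((ratr q : R) < t)%R & p.2%:E <= h q p.1].
  move=> t1; split.
    case/inf_lt; first by exists 1%R; left.
    move=> _ [-> |[q [q0 uq] <-] qt]; first by rewrite ltNge t1.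
    by exists q.
  by move=> [q [q0 qt uq]]; apply: le_lt_trans qt; apply: ge_inf => //; right; exists q.
pose okq (t : R) (q : rat) := ((0 <= (ratr q : R)) && ((ratr q : R) < t))%R.
have mle q : measurable [set p : Y * R | p.2%:E <= h q p.1].
  rewrite -[X in measurable X]setTI; apply: measurable_fun_lee => //.
    by apply/measurable_EFinP; exact: measurable_snd.
  by apply: (measurableT_comp (mh q)); exact: measurable_fst.
have mPsi : measurable_fun setT Psi.
  apply: (measurability _ (RGenInftyO.measurableE R)) => _ [_ [t ->] <-].
  rewrite setTI; have [t1|t1] := ltP 1%R t.
    rewrite (_ : _ @^-1` _ = setT)//; apply/seteqP; split => // p _ /=.
    by rewrite in_itv/= (le_lt_trans _ t1).
  rewrite (_ : _ @^-1` _ = \bigcup_q (if okq t q then [set p : Y * R | p.2%:E <= h q p.1]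
      else set0)).
    by apply: bigcupT_measurable_rat => q; case: ifP.
  apply/seteqP; split => p /=; rewrite in_itv/= Psi_lt//.
    by move=> [q [q0 qt uq]]; exists q => //; rewrite /okq q0 qt.
  by move=> [q _]; case: ifP => // /andP[q0 qt] uq; exists q.
have mid : measurable_fun setT (fun p : Y * R => (p.1, Psi p)).
  by apply: measurable_fun_pair => //; exact: measurable_fst.
have mXT : measurable_fun setT (fun w => (X w, T w)) by exact: measurable_fun_pair.
exists Psi; split => // A mA.
pose m1 := trace_law P mXT measurableT.
pose m2 := trace_law (PX \x unif01) mid measurableT.
have -> : P [set w | A (X w, T w)] = m1 A by rewrite /m1 /trace_law setIT.
have -> : \int[P]_w unif01 [set u | A (X w, Psi (X w, u))] = m2 A.
  rewrite /m2 /trace_law setIT /product_measure1.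
  have mA' : measurable ((fun p : Y * R => (p.1, Psi p)) @^-1` A).
    by rewrite -[X in measurable X]setTI; exact: (mid measurableT).
  have e := @ge0_integral_distribution _ _ _ _ _ P X'
    (unif01 \o xsection ((fun p : Y * R => (p.1, Psi p)) @^-1` A))
    (measurable_fun_xsection unif01 mA') (fun y => measure_ge0 _ _).
  apply: etrans (esym e); apply: eq_integral => w _ /=; congr (unif01 _).
  by apply/seteqP; split => u; rewrite /xsection/= inE.
apply: finite_measure_eq_rect => //.
  apply: le_lt_trans (ltry 1); apply: (@probability_le1 _ _ _ P).
  by apply: measurableI => //; rewrite preimage_setT.
move=> C t mC.
have e1 : m1 (C `*` `]-oo, t[%classic) = P (X @^-1` C `&` [set w | (T w < t)%R]).
  rewrite /m1 /trace_law setIT.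
  rewrite (_ : _ @^-1` _ = X @^-1` C `&` [set w | (T w < t)%R])//.
have e2 : m2 (C `*` `]-oo, t[%classic) =
    (PX \x unif01) [set p | C p.1 /\ (Psi p < t)%R].
  rewrite /m2 /trace_law setIT.
  rewrite (_ : (fun p : Y * R => _) @^-1` _ = [set p | C p.1 /\ (Psi p < t)%R])//.
apply: (etrans e1 (etrans _ (esym e2))) => {e1 e2}.
have [t1|t1] := ltP 1%R t.
  rewrite (_ : [set w | _] = setT); last first.
    by apply/seteqP; split => // w _ /=; have /andP[_ Tw] := T01 w; exact: le_lt_trans t1.
  rewrite (_ : [set p | _] = C `*` setT); last first.
    apply/seteqP; split => [p [] //|p [Cp _]]; split => //.
    exact: le_lt_trans t1.
  rewrite product_measure1E// setIT; transitivity (PX C * 1); first by rewrite mule1.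
  by congr (_ * _); apply/esym; exact: (@probability_setT _ _ _ unif01).
pose L n := [seq q <- pmap (@unpickle rat) (iota 0 n) | okq t q].
have mem_L q n : okq t q -> (pickle q < n)%N -> q \in L n.
  move=> oq qn; rewrite mem_filter oq mem_pmap; apply/mapP.
  by exists (pickle q); rewrite ?pickleK// mem_iota.
have L_ok q n : q \in L n -> okq t q by rewrite mem_filter => /andP[].
have L_mono m n : (m <= n)%N -> {subset L m <= L n}.
  move=> mn q; rewrite !mem_filter !mem_pmap => /andP[-> /mapP[i]].
  rewrite mem_iota => /= im qE; apply/mapP; exists i => //.
  by rewrite mem_iota/= (leq_trans im).
(* [W n] and [Z n] test the first rationals of [0,t) only; they increase to the two events to be
   compared. *)
pose W n := [set p : Y * R | C p.1 /\ exists2 q, q \in L n & p.2%:E <= h q p.1].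
pose Z n := [set w : Om | C (X w) /\ exists2 q, q \in L n & (T w <= ratr q)%R].
have mC1 : measurable [set p : Y * R | C p.1].
  rewrite -[X in measurable X]setTI; exact: (@measurable_fst _ _ Y R).
have mW n : measurable (W n).
  rewrite (_ : W n = [set p | C p.1] `&`
      \bigcup_(q in [set` L n]) [set p : Y * R | p.2%:E <= h q p.1]).
    apply: measurableI => //; apply: fin_bigcup_measurable => //.
  by apply/seteqP; split => [p [Cp [q qL pq]]|p [Cp [q qL pq]]]; split => //; exists q.
have mZ n : measurable (Z n).
  rewrite (_ : Z n = X @^-1` C `&`
      \bigcup_(q in [set` L n]) [set w | (T w <= ratr q)%R]).
    apply: measurableI; first exact: mXB.
    by apply: fin_bigcup_measurable.
  by apply/seteqP; split => [p [Cp [q qL pq]]|p [Cp [q qL pq]]]; split => //; exists q.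
have UW : [set p | C p.1 /\ (Psi p < t)%R] = \bigcup_n W n.
  apply/seteqP; split => p /=.
    move=> [Cp]; rewrite Psi_lt// => -[q [q0 qt pq]].
    by exists (pickle q).+1 => //; split => //; exists q => //; apply: mem_L; rewrite /okq ?q0.
  move=> [n _ [Cp [q /L_ok /andP[q0 qt] pq]]]; split => //; rewrite Psi_lt//.
  by exists q.
have UZ : X @^-1` C `&` [set w | (T w < t)%R] = \bigcup_n Z n.
  apply/seteqP; split => w /=.
    move=> [Cw Tw]; have [q] := rat_in_itvoo Tw.
    rewrite in_itv/= => /andP[Tq qt]; exists (pickle q).+1 => //; split => //.
    exists q; last exact: ltW.
    by apply: mem_L => //; rewrite /okq qt andbT (le_trans _ (ltW Tq))//; have /andP[] := T01 w.
  move=> [n _ [Cw [q /L_ok /andP[q0 qt] Tq]]]; split => //=.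
  exact: le_lt_trans qt.
have nW : nondecreasing_seq W.
  move=> m n mn; apply/subsetPset => p [Cp [q qL pq]]; split => //.
  by exists q => //; exact: L_mono qL.
have nZ : nondecreasing_seq Z.
  move=> m n mn; apply/subsetPset => p [Cp [q qL pq]]; split => //.
  by exists q => //; exact: L_mono qL.
have cW := nondecreasing_cvg_mu (mu := PX \x unif01) mW (bigcupT_measurable _ mW) nW.
have cZ := nondecreasing_cvg_mu (mu := P) mZ (bigcupT_measurable _ mZ) nZ.
rewrite UW UZ; apply/eqP; rewrite eq_le; apply/andP; split.
  rewrite -(cvg_lim _ cZ)//; apply: lime_le; first by apply/cvg_ex; eexists; exact: cZ.
  near=> n; rewrite /=.
  (* T is below some rational of [L n] iff it is below the largest, so a single density controls
     [Z n]. *)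
  have [L0|[q qL qmax]] : L n = [::] \/ exists2 q, q \in L n & {in L n, forall r, (r <= q)%O}.
    elim: (L n) => [|q s [->|[r rs rmax]]]; first by left.
      by right; exists q; rewrite ?mem_head// => r; rewrite inE => /eqP ->.
    right; have [qr|rq] := leP q r.
      exists r; first by rewrite inE rs orbT.
      by move=> x; rewrite inE => /orP[/eqP ->//|/rmax].
    exists q; first exact: mem_head.
    by move=> x; rewrite inE => /orP[/eqP ->//|/rmax xr]; rewrite (le_trans xr)// ltW.
    rewrite (_ : Z n = set0) ?measure0//.
    by apply/seteqP; split => // w [_ [q]]; rewrite L0.
  apply: (@le_trans _ _ (P (X @^-1` C `&` [set w | (T w <= ratr q)%R]))).
    apply: le_measure; rewrite ?inE//.
      by apply: measurableI => //; exact: mXB.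
    move=> w [Cw [r /qmax rq Tr]]; split => //=.
    by rewrite (le_trans Tr)// ler_rat.
  apply: (@le_trans _ _ ((PX \x unif01) [set p | C p.1 /\ p.2%:E <= h q p.1])); last first.
    apply: le_measure; rewrite ?inE//.
    - exact: (measurableI _ _ mC1 (mle q)).
    - exact: bigcupT_measurable.
    - by move=> p [Cp pq]; exists n => //; split => //; exists q.
  rewrite prod_unif01_subgraph//.
  (* [h q] is at most 1 only almost everywhere. Where it reaches 1, the trivial bound by the law of
     [X] replaces it. *)
  have mD : measurable [set y | 1 <= h q y].
    by rewrite -[X in measurable X]setTI; apply: measurable_fun_lee => //; exact: measurable_cst.
  pose C1 := C `&` [set y | 1 <= h q y]; pose C2 := C `\` [set y | 1 <= h q y].
  have mC1' : measurable C1 by exact: measurableI.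
  have mC2 : measurable C2 by exact: measurableD.
  have dC : [disjoint C1 & C2].
    rewrite disj_set2E; apply/eqP/seteqP; split => // y [[_ h1] [_ h2]].
  exact: (h2 h1).
  have CE : C = C1 `|` C2 by rewrite /C1 /C2 setUIDK.
  rewrite CE ge0_integral_setU//; last 2 first.
  - apply: measurable_funTS; apply: measurable_mine => //; exact: measurable_cst.
  - by move=> y _; rewrite le_min lee01 h0.
  rewrite preimage_setU setIUl measureU//; last 3 first.
  - by apply: measurableI => //; exact: mXB.
  - by apply: measurableI => //; exact: mXB.
  - rewrite setIACA -preimage_setI (_ : C1 `&` C2 = set0) ?preimage_set0 ?set0I//.
    by apply/eqP; rewrite -disj_set2E.
  apply: leeD.
    rewrite (eq_integral (cst 1)); last first.
      by move=> y; rewrite inE => -[_ /= hy]; apply/min_idPl.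
    rewrite integral_cst// mul1e; apply: le_measure; rewrite ?inE//.
      by apply: measurableI => //; exact: mXB.
    exact: mXB.
  apply: (@le_trans _ _ (\int[PX]_(y in C2) h q y)).
    by rewrite -(hP q C2 mC2); exact: lexx.
  rewrite le_eqVlt; apply/orP; left; apply/eqP; apply: eq_integral.
  move=> y; rewrite inE => -[_ /= /negP hy]; apply/esym/min_idPr.
  by rewrite ltW// ltNge.
rewrite -(cvg_lim _ cW)//; apply: lime_le; first by apply/cvg_ex; eexists; exact: cW.
near=> n; rewrite /=.
(* [W n] lies under the graph of the maximum [g]. Each [h q] is a density below the law of [X] on
   the event T < t, hence so is [g]. *)
pose g y := \big[maxe/0]_(q <- L n) h q y.
have g0 y : 0 <= g y by exact: bigmax_ge_id.
have mg : measurable_fun setT g.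
  rewrite /g; elim: (L n) => [|r s ihs].
    by under eq_fun do rewrite big_nil; exact: measurable_cst.
  by under eq_fun do rewrite big_cons; exact: measurable_maxe.
have le_g q y : q \in L n -> h q y <= g y.
  rewrite /g; elim: (L n) => [//|r s ihs]; rewrite inE big_cons le_max.
  by move=> /orP[/eqP ->|/ihs ->]; rewrite ?lexx ?orbT.
have mle_g : measurable [set p : Y * R | p.2%:E <= g p.1].
  rewrite -[X in measurable X]setTI; apply: measurable_fun_lee => //.
    by apply/measurable_EFinP; exact: measurable_snd.
  by apply: (measurableT_comp mg); exact: measurable_fst.
apply: (@le_trans _ _ ((PX \x unif01) [set p | C p.1 /\ p.2%:E <= g p.1])).
  apply: le_measure; rewrite ?inE//.
  - exact: mW.
  - exact: (measurableI _ _ mC1 mle_g).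
  - by move=> p [Cp [q qL pq]]; split => //; apply: le_trans pq _; exact: le_g.
rewrite prod_unif01_subgraph//; apply: (@le_trans _ _ (\int[PX]_(y in C) g y)).
  apply: ge0_le_integral => //.
  - by move=> y _; rewrite le_min lee01 g0.
  - by apply: measurable_funTS; apply: measurable_mine => //; exact: measurable_cst.
  - exact: measurable_funTS.
  - by move=> y _; rewrite ge_min lexx orbT.
rewrite -UZ.
have := @integral_bigmax_le _ _ PX (trace_law P mX (mTt t)) _ (L n) h h0 mh.
apply => // q /L_ok /andP[q0 qt] B mB; rewrite -hP//.
apply: le_measure; rewrite ?inE//.
- by apply: measurableI => //; exact: mXB.
- by apply: measurableI => //; exact: mXB.
- by move=> w [Bw Tw]; split => //=; exact: le_lt_trans qt.
Unshelve. all: by end_near. Qed.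

End randomization.

(** * Existence of the conditional laws *)

Section conditional_laws.
Context (R : realType) (E : pseudoPMetricType R).

Lemma exists_pushforward d d' (T : measurableType d) (Y : measurableType d')
    (P : probability T R) (f : T -> Y) : measurable_fun setT f ->
  exists m : probability Y R, forall B, m B = P (f @^-1` B).
Proof.
by move=> mf; exists (distribution P (mfun_Sub (mem_set mf) : {mfun T >-> Y})).
Qed.

(** The coordinate [x k] is read on the line through [phi], sampled given the other coordinates as
    [Psi (y, u)], and brought back to [E] by [psi]; [kappa y] is the law of the result for uniform
    [u]. *)
Lemma cond_law_exists n (nu : PEn R E n) (k : 'I_n) :
  hausdorff_space E ->
  (forall G : set_system E, ProperFilter G -> cauchy G -> cvg G) ->
  (exists D : set E, countable D /\ dense D) ->
  exists kappa : ('I_n.-1 -> E) -> PE R E, is_cond_law nu k kappa.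
Proof.
move=> hE cE sE; have [phi [psi [mphi mpsi phi01 phiK]]] := borel_retract_of_line hE cE sE.
have mX := measurable_drop_coord k sE.
have mT : measurable_fun setT (fun x : EnB R E n => phi (x k)).
  by apply: (measurableT_comp mphi); exact: measurable_coord.
have [Psi [mPsi hPsi]] := randomization nu mX mT (fun x => phi01 (x k)).
have mf (y : EnB R E n.-1) : measurable_fun setT (fun u : R => psi (Psi (y, u))).
  by apply: (measurableT_comp mpsi); exact: measurable_fun_pair2.
have /choice[kappa hkappa] := fun y => exists_pushforward unif01 (mf y).
exists kappa; split.
  apply: measurable_PEB => // B mB.
  rewrite (_ : (fun y => kappa y B) =
      (fun y => unif01 ((fun u => psi (Psi (y, u))) @^-1` B))); last first.
    by apply/funext => y; exact: hkappa.
  have mA : measurable ((psi \o Psi) @^-1` B).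
    rewrite -[X in measurable X]setTI.
    exact: (measurableT_comp mpsi mPsi).
  have := @measurable_fun_xsection _ _ _ _ R unif01 _ mA.
  congr measurable_fun; apply/funext => y /=; congr (unif01 _).
  by apply/seteqP; split => u; rewrite /xsection/= inE.
move=> A mA.
pose ins (p : EnB R E n.-1 * R) : EnB R E n := ins_coord k p.1 (psi p.2).
have mins : measurable_fun setT ins.
  apply: (@measurable_ins_coord R E _ _ n k
      (fun p : EnB R E n.-1 * R => p.1) (fun p => psi p.2)) => //.
    exact: (@measurable_fst _ _ (EnB R E n.-1) R).
  by apply: (measurableT_comp mpsi); exact: measurable_snd.
have := hPsi (ins @^-1` A); rewrite -[X in measurable X]setTI => /(_ (mins _ _ mA))-/(_ measurableT).
rewrite (_ : [set w | _] = A); last first.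
  by apply/seteqP; split => x; rewrite /ins/= phiK ins_drop_coord.
by move=> ->; apply: eq_integral => x _; rewrite hkappa.
Qed.

End conditional_laws.

(** * Finite measurable partitions *)

Lemma measurable_truncn (R : realType) : measurable_fun setT (@Num.truncn R).
Proof.
have mge l : measurable [set t : R | (l <= Num.truncn t)%N].
  case: l => [|l]; first by rewrite (_ : [set t | _] = setT)//; apply/seteqP.
  rewrite (_ : [set t | _] = `[l.+1%:R, +oo[%classic)//.
  by apply/seteqP; split => t /=; rewrite in_itv/= andbT truncn_gt_nat.
move=> _ Z _; rewrite setTI (_ : _ @^-1` _ = \bigcup_(l in Z)
    ([set t | (l <= Num.truncn t)%N] `\` [set t | (l.+1 <= Num.truncn t)%N])).
  by apply: bigcup_measurable => l _; exact: measurableD.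
apply/seteqP; split => [t Zt|t [l Zl [/= lt /negP]]].
  by exists (Num.truncn t) => //; split => //=; apply/negP; rewrite -leqNgt.
by rewrite -ltnNge ltnS => tl; rewrite (_ : Num.truncn t = l)//; apply/eqP; rewrite eqn_leq tl.
Qed.

Section finite_partitions.
Context d (T : measurableType d) (R : realType).

(* The cells are the level sets of the integer parts of (N + 1) * phi_i. *)
Lemma finite_quantization (r : nat) (phi : 'I_r -> T -> R) (e : R) :
  (forall i, measurable_fun setT (phi i)) -> (forall i x, 0 <= phi i x <= 1) -> 0 < e ->
  exists (S : finType) (q : T -> S), (forall s, measurable [set x | q x = s]) /\
    forall x y i, q x = q y -> `|phi i x - phi i y| <= e.
Proof.
move=> mphi phi01 e0.
have [N Ne] : exists N, N.+1%:R^-1 < e.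
  by have [N] := ltr_add_invr (y := 0) e0; rewrite add0r => ?; exists N.
(* There are N + 2 cells per function because the value 1 has integer part N + 1. *)
pose q (x : T) : {ffun 'I_r -> 'I_N.+2} :=
  [ffun i => inord (Num.truncn (N.+1%:R * phi i x))].
have N0 : (0 : R) < N.+1%:R by [].
have trunc_lt i x : (Num.truncn (N.+1%:R * phi i x) < N.+2)%N.
  rewrite ltnS -(ler_nat R); apply: (@le_trans _ _ (N.+1%:R * phi i x)).
    by rewrite truncn_le// mulr_ge0//; have /andP[] := phi01 i x.
  by rewrite ler_piMr//; have /andP[] := phi01 i x.
have q_close x y i : q x = q y -> `|phi i x - phi i y| <= N.+1%:R^-1.
  move=> /(congr1 (fun h : {ffun _ -> _} => nat_of_ord (h i))).
  rewrite !ffunE !inordK// => xy.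
  have /andP[x1 x2] := truncn_itv (mulr_ge0 (ltW N0) (proj1 (andP (phi01 i x)))).
  have /andP[y1 y2] := truncn_itv (mulr_ge0 (ltW N0) (proj1 (andP (phi01 i y)))).
  rewrite xy in x1 x2.
  rewrite -(ler_pM2l N0) divff ?gt_eqF// -[X in X * `|_|]gtr0_norm// -normrM mulrBr.
  rewrite -[(Num.truncn _).+1%:R]natr1 in x2; rewrite -[(Num.truncn _).+1%:R]natr1 in y2.
  rewrite ler_norml; lra.
have mq j : measurable [set x | q x = j].
  rewrite (_ : [set x | q x = j] = \bigcap_(i in [set: 'I_r])
     (phi i @^-1` [set t | inord (Num.truncn (N.+1%:R * t)) = j i :> 'I_N.+2])).
    apply: fin_bigcap_measurable => // i _.
    rewrite -[X in measurable X]setTI; apply: mphi => //.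
    rewrite (_ : [set t | _] = (fun t : R => Num.truncn (N.+1%:R * t)) @^-1`
       [set l | inord l = j i :> 'I_N.+2])//.
    rewrite -[X in measurable X]setTI.
    have mt : measurable_fun setT (fun t : R => Num.truncn (N.+1%:R * t)).
      apply: (measurableT_comp (@measurable_truncn R)).
      by apply: measurable_funM => //; exact: measurable_cst.
    exact: mt.
  apply/seteqP; split => [x /= xj i _|x xj].
    by rewrite /= -xj ffunE.
  by apply/ffunP => i; rewrite ffunE; exact: xj.
exists {ffun 'I_r -> 'I_N.+2}, q; split => // x y i xy.
by apply: le_trans (q_close x y i xy) (ltW Ne).
Qed.

Local Open Scope ereal_scope.

Lemma ge0_integral_finpart (mu : {measure set T -> \bar R}) (J : finType)
    (idx : T -> J) (A : set T) (g : T -> \bar R) :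
  measurable A -> (forall j, measurable (A `&` [set x | idx x = j])) ->
  (forall x, 0 <= g x) -> measurable_fun A g ->
  \int[mu]_(x in A) g x = \sum_(j : J) \int[mu]_(x in A `&` [set x | idx x = j]) g x.
Proof.
move=> mA mj g0 mg; rewrite integral_mkcond.
rewrite (eq_integral (fun x => \sum_(j : J) (g \_ (A `&` [set x | idx x = j])) x)).
  rewrite ge0_integral_sum//.
  - by apply: eq_bigr => j _; rewrite [RHS]integral_mkcond.
  - move=> j; apply/(measurable_restrictT _ (mj j)).
    by apply: measurable_funS mg => // x [].
  - by move=> j x _; rewrite patchE; case: ifP.
move=> x _; rewrite patchE; case: ifPn => [|/negP]; rewrite inE => Ax.
  rewrite (bigD1 (idx x))//= big1 ?adde0.
    by rewrite patchE ifT// inE.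
  by move=> j jx; rewrite patchE ifF//; apply/negP; rewrite inE => -[_ /= e]; rewrite e eqxx in jx.
by rewrite big1// => j _; rewrite patchE ifF//; apply/negP; rewrite inE => -[].
Qed.

Lemma measurable_fun_finvalued d' (Y : measurableType d') (J : finType)
    (idx : T -> J) (A : set T) (G : J -> Y) :
  (forall j, measurable (A `&` [set x | idx x = j])) ->
  measurable_fun A (fun x => G (idx x)).
Proof.
move=> mj _ B mB; rewrite (_ : _ `&` _ = \bigcup_(j in [set j | B (G j)])
    (A `&` [set x | idx x = j])).
  by apply: fin_bigcup_measurable.
apply/seteqP; split => [x [Ax Bx]|x [j Bj [Ax /= xj]]]; first by exists (idx x).
by split => //=; rewrite xj.
Qed.

Lemma ge0_integral_finvalued (mu : {measure set T -> \bar R}) (J : finType)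
    (idx : T -> J) (A : set T) (G : J -> \bar R) :
  measurable A -> (forall j, measurable (A `&` [set x | idx x = j])) ->
  (forall j, 0 <= G j) ->
  \int[mu]_(x in A) G (idx x) = \sum_(j : J) G j * mu (A `&` [set x | idx x = j]).
Proof.
move=> mA mj G0; rewrite (@ge0_integral_finpart _ _ idx)//; last first.
  exact: measurable_fun_finvalued.
apply: eq_bigr => j _; rewrite (eq_integral (cst (G j))).
  by rewrite integral_cst.
by move=> x; rewrite inE => -[_ /= ->].
Qed.

End finite_partitions.

(** * Finite mixtures *)

Section finite_mixtures.
Context d (T : measurableType d) (R : realType).

Lemma exists_mixture2 (m1 m2 : probability T R) (t : R) : 0 <= t <= 1 ->
  exists m : probability T R, forall B, m B = (t%:E * m1 B + (1 - t)%:E * m2 B)%E.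
Proof.
move=> /andP[t0 t1]; have t1' : 0 <= 1 - t by rewrite subr_ge0.
pose mu := measure_add (mscale (NngNum t0) m1) (mscale (NngNum t1') m2).
have muE B : mu B = (t%:E * m1 B + (1 - t)%:E * m2 B)%E.
  by rewrite /mu measure_addE.
(* The total mass is 1: [mnormalize] keeps the values and supplies the probability structure. *)
exists (mnormalize mu m1) => B; rewrite /= /mnormalize.
have -> : (mu : {measure set T -> \bar R}) setT = 1%E.
  by apply: (etrans (muE setT)); rewrite !probability_setT !mule1 -EFinD addrC subrK.
by rewrite onee_eq0/= invr1 mule1.
Qed.

Lemma weighted_sum_eq0 (I : Type) (s : seq I) (w : I -> R) (x : I -> \bar R) :
  (forall i, 0 <= w i) -> \sum_(i <- s) w i = 0 -> (\sum_(i <- s) (w i)%:E * x i = 0)%E.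
Proof.
move=> w0; elim: s => [|i s ih]; first by rewrite !big_nil.
rewrite !big_cons => /eqP; rewrite paddr_eq0//; last exact: sumr_ge0.
by move=> /andP[/eqP -> /eqP /ih ->]; rewrite mul0e adde0.
Qed.

Lemma rescale_weighted_sum (I : Type) (s : seq I) (w : I -> R) (x : I -> \bar R) (r : R) :
  (forall i, 0 <= w i) -> (forall i, 0 <= x i)%E -> 0 < r ->
  (r%:E * (\sum_(i <- s) (w i / r)%:E * x i) = \sum_(i <- s) (w i)%:E * x i)%E.
Proof.
move=> w0 x0 r0; rewrite ge0_sume_distrr.
  by apply: eq_bigr => i _; rewrite muleA -EFinM mulrCA divff ?mulr1// gt_eqF.
by move=> i _; rewrite mule_ge0// lee_fin divr_ge0// ltW.
Qed.

End finite_mixtures.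

(** * Lower semicontinuity of [alpha] and Jensen's inequality *)

Section rate_function.
Context (R : realType) (E : pseudoPMetricType R).

(** Two-point convexity splits off the first weight and the tail is rescaled to mass 1. A tail of
    weight zero cannot be rescaled and is treated apart. *)
Lemma alpha_convex_mixture (a : PE R E -> \bar R) : (forall m, 0 <= a m)%E ->
  alpha_convex a -> forall (I : Type) (s : seq I) (w : I -> R) (mu : I -> PE R E),
  (forall i, 0 <= w i) -> \sum_(i <- s) w i = 1 ->
  exists m : PE R E, (forall B, m B = \sum_(i <- s) (w i)%:E * mu i B)%E /\
    (a m <= \sum_(i <- s) (w i)%:E * a (mu i))%E.
Proof.
move=> a0 ca I s; elim: s => [|i s ih] w mu w0.
  by rewrite big_nil => /esym/eqP; rewrite oner_eq0.
rewrite big_cons => ws; have r0 : 0 <= \sum_(j <- s) w j by exact: sumr_ge0.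
have [rz|rnz] := eqVneq (\sum_(j <- s) w j) 0.
  rewrite rz addr0 in ws; exists (mu i); split => [B|].
    by rewrite big_cons ws mul1e weighted_sum_eq0// adde0.
  by rewrite big_cons ws mul1e weighted_sum_eq0// adde0.
have rp : 0 < \sum_(j <- s) w j by rewrite lt_neqAle eq_sym rnz.
have [||m' [m'E am']] := ih (fun j => w j / \sum_(j <- s) w j) mu.
- by move=> j; rewrite divr_ge0.
- by rewrite -mulr_suml divff.
have rE : 1 - w i = \sum_(j <- s) w j by rewrite -ws addrC addKr.
have wi1 : 0 <= w i <= 1 by rewrite w0 -ws lerDl.
have [m mE] := exists_mixture2 (mu i) m' wi1.
exists m; split => [B|].
  rewrite big_cons mE rE m'E rescale_weighted_sum// => j; exact: measure_ge0.
rewrite big_cons; apply: (le_trans (ca _ _ _ _ wi1 (fun B _ => mE B))).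
rewrite leeD2l// rE -(rescale_weighted_sum _ w0 (fun j => a0 (mu j)) rp).
by rewrite lee_wpmul2l// lee_fin.
Qed.

(** The sets containing both points or neither form a sigma-algebra, and weakly open sets are among
    them. *)
Lemma test_indistinguishable (mu nu : PE R E) :
  (forall f, test_fun f -> ev f mu = ev f nu) ->
  forall B : set (PEB R E), measurable B -> B mu -> B nu.
Proof.
move=> h; suff: forall B : set (PEB R E), measurable B -> (B mu <-> B nu).
  by move=> H B mB; exact: (H B mB).1.
pose H := [set B : set (PE R E) | B mu <-> B nu].
suff : <<s (@open (PEw R E)) >> `<=` H by move=> sH B mB; exact: (sH B mB).
have swap (m1 m2 : PEw R E) : (forall f, test_fun f -> ev f m1 = ev f m2) ->
    forall B : set (PEw R E), open B -> B m1 -> B m2.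
  move=> e B oB B1.
  have /nbhs_weakP[fs [r [r0 tfs hfs]]] : nbhs m1 B by apply: open_nbhs_nbhs.
  by apply: hfs => f ff; rewrite e ?subrr ?normr0//; exact: tfs.
apply: smallest_sub; last first.
  by move=> B oB; split; apply: (swap _ _ _ _ oB) => f tf; rewrite h.
split => //.
- by move=> A HA; rewrite setTD; split => nA /HA.
- by move=> A HA; split => -[n _ Anx]; exists n => //; exact/(HA n).
Qed.

(** If the bound [b] failed near [m], every neighbourhood of [m] would meet the sub-level set [K].
    Compactness gives a cluster point [y] in [K]; no test function separates it from [m], so [m] is
    in the Borel set [K] as well. *)
Lemma lsc_of_compact_sublevels (alpha : PE R E -> \bar R) :
  alpha_measurable alpha -> compact_sublevels alpha ->
  lower_semicontinuous (fun nu : PEw R E => alpha nu).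
Proof.
move=> ma ka m b bm; pose K := [set nu : PEw R E | (alpha nu <= b%:E)%E].
apply: contrapT => hV.
have FF : ProperFilter (within K (nbhs m)).
  apply: Build_ProperFilter_ex => A.
  rewrite /within/= => nA; apply: contrapT => A0; apply: hV.
  eexists; first exact: nA.
  move=> y yA; rewrite ltNge; apply/negP => Ky; apply: A0; exists y.
  exact: yA.
have [|y [Ky cy]] := ka b (within K (nbhs m)) FF; first exact: withinT.
have [f [tf fy]] : exists f, test_fun f /\ ev f y != ev f m.
  apply: contrapT => hf; move: bm; apply/negP; rewrite -leNgt.
  have mK : measurable (K : set (PEB R E)).
    rewrite -[X in measurable X]setTI; exact: emeasurable_fun_infty_c.
  apply: (test_indistinguishable _ mK Ky) => f tf.
  by apply/eqP; apply: contrapT => /negP e; apply: hf; exists f.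
pose e := `|ev f y - ev f m| / 2.
have e0 : 0 < e by rewrite divr_gt0// normr_gt0 subr_eq0.
have nm : within K (nbhs m) [set z | `|ev f z - ev f m| < e].
  by apply: filterS (nbhs_ev m tf e0) => z.
have [z [zm zy]] := cy _ _ nm (nbhs_ev y tf e0).
have : `|ev f y - ev f m| < e + e.
  rewrite (_ : _ - _ = (ev f z - ev f m) - (ev f z - ev f y)); last by ring.
  by apply: le_lt_trans (ler_normB _ _) _; exact: ltrD.
by rewrite -splitr ltxx.
Qed.

Lemma measurable_sublevel_cst (alpha : PE R E -> \bar R) : alpha_measurable alpha ->
  forall mu nu : PE R E, (forall f, test_fun f -> ev f mu = ev f nu) -> alpha mu = alpha nu.
Proof.
move=> ma mu nu h.
have mS (v : \bar R) : measurable ([set m | alpha m = v] : set (PEB R E)).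
  rewrite (_ : [set m | _] = alpha @^-1` [set v])//.
  by rewrite -[X in measurable X]setTI; apply: ma.
by have := test_indistinguishable h (mS (alpha mu)) erefl.
Qed.

(** If the inequality failed, [a] would exceed some [b] on a neighbourhood of [m] given by finitely
    many test functions. Quantizing their values along [k] and picking one good point per cell gives
    a finite mixture [m'] in that neighbourhood with a(m') <= b. Working with mass [p] avoids
    conditioning the space. *)
Lemma jensen_PE (a : PE R E -> \bar R) d (T : measurableType d) (P : probability T R)
    (A : set T) (p : R) (k : T -> PE R E) (m : PE R E) :
  (forall mu, 0 <= a mu)%E -> alpha_convex a -> alpha_measurable a ->
  lower_semicontinuous (fun nu : PEw R E => a nu) ->
  measurable_fun setT (k : T -> PEB R E) ->
  measurable A -> P A = p%:E -> 0 < p ->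
  (forall B : set (EB R E), measurable B -> p%:E * m B = \int[P]_(x in A) k x B)%E ->
  (p%:E * a m <= \int[P]_(x in A) a (k x))%E.
Proof.
move=> a0 ca ma la mk mA PA p0 mE.
have mak : measurable_fun setT (fun x => a (k x)).
  exact: (measurableT_comp (ma : measurable_fun setT (a : PEB R E -> _))).
rewrite leNgt; apply/negP => Im.
have I0 : (0 <= \int[P]_(x in A) a (k x))%E by exact: integral_ge0.
have [r rE] : exists r, (\int[P]_(x in A) a (k x) = r%:E)%E.
  exists (fine (\int[P]_(x in A) a (k x))%E); rewrite fineK// ge0_fin_numE//.
  by apply: lt_le_trans Im _; exact: leey.
rewrite rE in Im.
have rpm : ((r / p)%:E < a m)%E by rewrite mulrC EFinM lte_pdivrMl.
have [b [rb bm]] : exists b : R, r / p < b /\ (b%:E < a m)%E.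
  move: rpm; case: (a m) => [v| |//].
    by rewrite lte_fin => h; exists ((r / p + v) / 2); rewrite lte_fin; split; lra.
  by move=> _; exists (r / p + 1); rewrite ltry; split => //; lra.
have [V nV Vb] := la m b bm.
have [fs [e [e0 tfs fsV]]] := nbhs_weakP nV.
pose fi (i : 'I_(size fs)) : E -> R := nth (fun=> 0) fs i.
have fi_in i : List.In (fi i) fs.
  rewrite /fi; move: (ltn_ord i); move: (nat_of_ord i).
  elim: (fs) => [//|g s ih] [|j] /=; first by left.
  by move=> js; right; exact: ih.
have in_fi f : List.In f fs -> exists i, f = fi i.
  move=> ffs; suff [j [js ->]] : exists j, (j < size fs)%N /\ f = nth (fun=> 0) fs j.
    by exists (Ordinal js).
  move: ffs; elim: (fs) => [//|g s ih] /= [->|/ih[j [js jE]]]; first by exists 0%N.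
  by exists j.+1.
have tf i : test_fun (fi i) by exact: tfs.
pose phi i x := ev (fi i) (k x).
have mphi i : measurable_fun setT (phi i) by exact: measurable_ev.
have phi01 i x : 0 <= phi i x <= 1 by exact: ev01.
have e20 : 0 < e / 2 by rewrite divr_gt0.
have [J [idx [midx0 idx_close]]] := finite_quantization mphi phi01 e20.
have midx j : measurable (A `&` [set x | idx x = j]) by exact: measurableI.
pose C j := A `&` [set x | idx x = j].
pose q j : R := fine (P (C j)).
have qE j : P (C j) = (q j)%:E by rewrite fineK//; apply: fin_num_measure; exact: midx.
have q0 j : 0 <= q j by rewrite fine_ge0.
have sumI : (\sum_j \int[P]_(x in C j) a (k x) = r%:E)%E.
  rewrite -rE (@ge0_integral_finpart _ _ _ _ _ idx)//.
  exact: measurable_funTS.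
have sumq : \sum_j q j = p.
  apply: EFin_inj; rewrite -PA -sumEFin.
  have := @ge0_integral_finvalued _ _ _ P _ idx A (fun=> 1%E) mA midx (fun=> lee01).
  rewrite integral_cst// mul1e => ->; apply: eq_bigr => j _.
  by rewrite mul1e -qE.
(* The slack between the average r/p and [b], which the choice of points may use up. *)
pose dlt := b - r / p.
have dlt0 : 0 < dlt by rewrite subr_gt0.
(* Some point of a cell of positive mass has a value at most the cell average plus [dlt]. On a null
   cell any of its points will do, as its weight is 0. *)
have /choice[z hz] : forall j, exists x, (C j !=set0 -> C j x) /\
    ((q j)%:E * a (k x) <= \int[P]_(x in C j) a (k x) + (q j * dlt)%:E)%E.
  move=> j; have [[x0 Cx0]|C0] := pselect (C j !=set0); last first.
    exists point; split => //.
    have -> : q j = 0.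
      by rewrite /q (_ : C j = set0) ?measure0//; apply/eqP/negPn/negP => /set0P.
    by rewrite mul0e mul0r adde0 integral_ge0.
  have [qz|qnz] := eqVneq (q j) 0.
    by exists x0; split => //; rewrite qz mul0e mul0r adde0 integral_ge0.
  have qp : 0 < q j by rewrite lt_neqAle eq_sym qnz q0.
  apply: contrapT => /forallNP hx.
  have Ifin : (\int[P]_(x in C j) a (k x))%E \is a fin_num.
    rewrite ge0_fin_numE ?integral_ge0//.
    apply: (@le_lt_trans _ _ r%:E); last exact: ltry.
    rewrite -rE; apply: ge0_subset_integral => //.
    - exact: midx.
    - exact: measurable_funTS.
    - exact: subIsetl.
  pose Ij := fine (\int[P]_(x in C j) a (k x))%E.
  have IjE : (\int[P]_(x in C j) a (k x))%E = Ij%:E by rewrite fineK.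
  have big x : C j x -> ((Ij / q j + dlt)%:E <= a (k x))%E.
    move=> Cx; rewrite leNgt; apply/negP => ax; apply: (hx x); split => //.
    rewrite IjE -EFinD -lee_pdivlMl// -EFinM; apply: ltW; apply: lt_le_trans ax _.
    rewrite lee_fin mulrDr [_^-1 * (_ * _)]mulKf// mulrC//.
  have : (((Ij / q j + dlt) * q j)%:E <= \int[P]_(x in C j) a (k x))%E.
    rewrite EFinM -qE -(integral_cst P (midx j)); apply: ge0_le_integral => //.
    + move=> x _; rewrite lee_fin addr_ge0 ?divr_ge0// ?(ltW dlt0)//.
      by rewrite fine_ge0// integral_ge0.
    + exact: measurable_funTS.
  rewrite IjE lee_fin mulrDl divfK// => h.
  have : 0 < dlt * q j by rewrite mulr_gt0.
  lra.
have wsum : \sum_j (q j / p) = 1 by rewrite -mulr_suml sumq divff// gt_eqF.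
have [|m' [m'E am']] := alpha_convex_mixture a0 ca (s := index_enum _)
    (w := fun j => q j / p) (fun j => k (z j)) _ wsum.
  by move=> j; rewrite divr_ge0// ltW.
have am'b : (a m' <= b%:E)%E.
  apply: (le_trans am').
  rewrite -(@lee_pmul2l _ p%:E)// ?lte_fin//.
  rewrite rescale_weighted_sum//.
  apply: (@le_trans _ _ (\sum_j (\int[P]_(x in C j) a (k x) + (q j * dlt)%:E))%E).
    by apply: lee_sum => j _; have [] := hz j.
  rewrite big_split/= sumI sumEFin -mulr_suml sumq -EFinD lee_fin /dlt.
  by rewrite mulrBr [p * (r / p)]mulrC divfK ?gt_eqF//; lra.
suff /Vb : V m' by rewrite ltNge am'b.
apply: fsV => f /in_fi[i ->].
have evm : (p * ev (fi i) m)%:E = (\int[P]_(x in A) (phi i x)%:E)%E.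
  rewrite EFinM -evE//.
  have := @integral_mixture _ _ T (EB R E) R P A (fun x => k x)
    (mscale (NngNum (ltW p0)) m) mA (measurable_PEB_eval mk).
  move=> /(_ mE (fun x => (fi i x)%:E)).
  rewrite ge0_integral_mscale//=; last 2 first.
  - by apply/measurable_EFinP; exact: measurable_test.
  - by move=> x _; rewrite lee_fin; have /andP[] := (tf i).2 x.
  move=> -> //.
  - by apply: eq_integral => x _; rewrite evE.
  - by move=> x; rewrite lee_fin; have /andP[] := (tf i).2 x.
  - by apply/measurable_EFinP; exact: measurable_test.
pose psi x := ev (fi i) (k (z (idx x))).
have evm' : (p * ev (fi i) m')%:E = (\int[P]_(x in A) (psi x)%:E)%E.
  rewrite EFinM -evE//.
  rewrite (@integral_fin_mixture _ (EB R E) R _ (index_enum _) (fun j => q j / p)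
    (fun j => k (z j)) m')//.
  - rewrite rescale_weighted_sum//; last first.
      move=> j; apply: integral_ge0 => x _.
      by rewrite lee_fin; have /andP[] := (tf i).2 x.
    rewrite /psi (@ge0_integral_finvalued _ _ _ P _ idx A
      (fun j => (ev (fi i) (k (z j)))%:E))//.
      by apply: eq_bigr => j _; rewrite evE// muleC -qE.
    by move=> j; rewrite lee_fin; have /andP[] := ev01 (k (z j)) (tf i).
  - by move=> j; rewrite divr_ge0// ltW.
  - by move=> B _; exact: m'E.
  - by move=> x; rewrite lee_fin; have /andP[] := (tf i).2 x.
  - by apply/measurable_EFinP; exact: measurable_test.
have psi01 x : 0 <= psi x <= 1 by exact: ev01.
have mpsi : measurable_fun A psi.
  exact: (measurable_fun_finvalued (fun j => ev (fi i) (k (z j)))).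
pose e' := e / 2.
have close x : A x -> `|phi i x - psi x| <= e'.
  move=> Ax; apply: idx_close.
  by have [hC _] := hz (idx x); have [_ /= ->] := hC (ex_intro _ x (conj Ax erefl)).
have le_int (g h : T -> R) : measurable_fun A g -> measurable_fun A h ->
    (forall x, 0 <= g x) -> (forall x, 0 <= h x) ->
    (forall x, A x -> g x <= h x + e') ->
    (\int[P]_(x in A) (g x)%:E <= \int[P]_(x in A) (h x)%:E + (e' * p)%:E)%E.
  move=> mg mh g0 h0 gh.
  have -> : (e' * p)%:E = (\int[P]_(x in A) (cst e'%:E x))%E.
    by rewrite (integral_cst P mA) EFinM -PA.
  have mgE : measurable_fun A (EFin \o g) by exact/measurable_EFinP.
  have mhE : measurable_fun A (EFin \o h) by exact/measurable_EFinP.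
  have g0E x : A x -> (0 <= (g x)%:E)%E by rewrite lee_fin.
  have h0E x : A x -> (0 <= (h x)%:E)%E by rewrite lee_fin.
  have e'0 x : A x -> (0 <= cst e'%:E x)%E by move=> _; rewrite /= lee_fin ltW.
  rewrite -(ge0_integralD P mA h0E mhE e'0 (measurable_cst _)).
  apply: ge0_le_integral => //.
  by apply: emeasurable_funD => //; exact: measurable_cst.
have phi0 x : 0 <= phi i x by have /andP[] := phi01 i x.
have psi0 x : 0 <= psi x by have /andP[] := psi01 x.
have mphiA : measurable_fun A (phi i) by exact: measurable_funTS.
have h1 : p * ev (fi i) m <= p * ev (fi i) m' + e' * p.
  rewrite -lee_fin EFinD evm evm'; apply: le_int => // x /close.
  by rewrite ler_norml; lra.
have h2 : p * ev (fi i) m' <= p * ev (fi i) m + e' * p.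
  rewrite -lee_fin EFinD evm evm'; apply: le_int => // x /close.
  by rewrite ler_norml; lra.
have e'e : e' < e by rewrite /e'; lra.
apply: le_lt_trans e'e; rewrite ler_norml.
rewrite -(ler_pM2l p0) -[X in _ && X](ler_pM2l p0); lra.
Qed.

End rate_function.

(** * Martingale differences on a finite path space *)

Section prefix_martingale.
Context (R : realFieldType) (n : nat) (S : finType).
Local Notation Pi := {ffun 'I_n -> S}.
Variables (p : Pi -> R) (f : S -> R).
Hypotheses (p0 : forall pi, 0 <= p pi) (f01 : forall s, 0 <= f s <= 1).

(** Prefixes of all lengths share one finite type: the entries from [k] on are erased to [None]. *)
Definition prefix_of (k : nat) (pi : Pi) : {ffun 'I_n -> option S} :=
  [ffun j : 'I_n => if (j < k)%N then Some (pi j) else None].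

Definition prefix_mass (k : nat) (t : {ffun 'I_n -> option S}) : R :=
  \sum_(pi | prefix_of k pi == t) p pi.

(* Equal to 0 on prefixes of mass zero, by the convention x / 0 = 0. *)
Definition prefix_mean (k : 'I_n) (t : {ffun 'I_n -> option S}) : R :=
  (\sum_(pi | prefix_of k pi == t) p pi * f (pi k)) / prefix_mass k t.

(** The martingale difference: conditioning is on the strict past, which excludes coordinate [k]. *)
Definition dev (k : 'I_n) (pi : Pi) : R := f (pi k) - prefix_mean k (prefix_of k pi).

Lemma prefix_mass_ge0 k t : 0 <= prefix_mass k t.
Proof. exact: sumr_ge0. Qed.

Lemma prefix_mean_mass k t : prefix_mean k t * prefix_mass k t =
  \sum_(pi | prefix_of k pi == t) p pi * f (pi k).
Proof.
have [m0|m0] := eqVneq (prefix_mass k t) 0; last by rewrite divfK.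
rewrite m0 mulr0 big1// => pi pit; rewrite (_ : p pi = 0) ?mul0r//.
by have /psumr_eq0P := m0; apply.
Qed.

Lemma prefix_mean01 k t : 0 <= prefix_mean k t <= 1.
Proof.
apply/andP; split.
  rewrite divr_ge0 ?prefix_mass_ge0// sumr_ge0// => pi _; rewrite mulr_ge0//.
  by have /andP[] := f01 (pi k).
have [m0|m0] := eqVneq (prefix_mass k t) 0; first by rewrite /prefix_mean m0 invr0 mulr0.
rewrite ler_pdivrMr ?mul1r; last by rewrite lt_neqAle eq_sym m0 prefix_mass_ge0.
by apply: ler_sum => pi _; rewrite ler_piMr//; have /andP[] := f01 (pi k).
Qed.

(** On the paths with a common prefix [h] is constant, and [dev] has weighted sum zero by the
    definition of the mean. *)
Lemma dev_orthogonal (k : 'I_n) (h : Pi -> R) :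
  (forall pi pi', prefix_of k pi = prefix_of k pi' -> h pi = h pi') ->
  \sum_pi p pi * (h pi * dev k pi) = 0.
Proof.
move=> hh; rewrite (partition_big (prefix_of k) predT)//= big1// => t _.
have [pi0 /eqP pi0t|no] := pickP (fun pi => prefix_of k pi == t); last first.
  by rewrite big_pred0.
rewrite (eq_bigr (fun pi => h pi0 * (p pi * f (pi k) - prefix_mean k t * p pi))).
  rewrite -mulr_sumr sumrB -mulr_sumr -/(prefix_mass k t) prefix_mean_mass subrr.
  by rewrite mulr0.
move=> pi /eqP pit; rewrite (hh pi pi0) ?pit ?pi0t// /dev pit; ring.
Qed.

Lemma dev_norm k pi : `|dev k pi| <= 1.
Proof.
have := f01 (pi k); have := prefix_mean01 k (prefix_of k pi).
by rewrite /dev ler_norml; lra.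
Qed.

Lemma prefix_of_lt k (j : 'I_n) (pi pi' : Pi) : (j < k)%N ->
  prefix_of k pi = prefix_of k pi' -> pi j = pi' j.
Proof. by move=> jk /ffunP/(_ j); rewrite !ffunE jk => -[]. Qed.

Lemma prefix_of_le j k (pi pi' : Pi) : (j <= k)%N ->
  prefix_of k pi = prefix_of k pi' -> prefix_of j pi = prefix_of j pi'.
Proof.
move=> jk h; apply/ffunP => i; rewrite !ffunE; case: ifP => // ij.
by rewrite (prefix_of_lt (leq_trans ij jk) h).
Qed.

(** Partial sums depend on the past only, so cross terms vanish and each new difference adds at most
    1 to the second moment. *)
Lemma sum_dev_sqr : \sum_pi p pi = 1 ->
  \sum_pi p pi * (\sum_k dev k pi) ^+ 2 <= n%:R.
Proof.
move=> p1; pose M k pi := \sum_(j < n | (j < k)%N) dev j pi.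
suff H k : (k <= n)%N -> \sum_pi p pi * M k pi ^+ 2 <= k%:R.
  apply: le_trans (H n (leqnn n)); rewrite le_eqVlt; apply/orP; left; apply/eqP.
  apply: eq_bigr => pi _; congr (_ * _ ^+ 2); apply: eq_bigl => j.
  by rewrite ltn_ord.
elim: k => [_|k ih kn].
  by rewrite big1// => pi _; rewrite /M big_pred0// expr0n/= mulr0.
pose k' := Ordinal kn.
have MS pi : M k.+1 pi = M k pi + dev k' pi.
  rewrite /M (bigD1 k')//= addrC; congr (_ + _); apply: eq_bigl => j.
  by rewrite ltnS ltn_neqAle -val_eqE/= andbC.
rewrite (eq_bigr (fun pi => p pi * M k pi ^+ 2 + (2 * (p pi * (M k pi * dev k' pi))
  + p pi * dev k' pi ^+ 2))); last by move=> pi _; rewrite MS; ring.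
rewrite big_split/= -[k.+1%:R]natr1; apply: lerD; first by apply: ih; exact: ltnW.
rewrite big_split/= -mulr_sumr dev_orthogonal; last first.
  move=> pi pi' e; apply: eq_bigr => j jk; rewrite /dev.
  by rewrite (prefix_of_lt jk e) (prefix_of_le (ltnW jk) e).
rewrite mulr0 add0r -p1; apply: ler_sum => pi _; rewrite ler_piMr//.
rewrite -real_normK ?num_real// expr_le1//; exact: dev_norm.
Qed.

Lemma dev_chebyshev (e : R) : \sum_pi p pi = 1 -> (0 < n)%N -> 0 < e ->
  \sum_(pi | e * n%:R <= `|\sum_k dev k pi|) p pi <= (n%:R * e ^+ 2)^-1.
Proof.
move=> p1 n0 e0; have n0R : 0 < n%:R :> R by rewrite ltr0n.
have en0 : 0 < e * n%:R by rewrite mulr_gt0.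
apply: (@le_trans _ _ (\sum_pi p pi * (\sum_k dev k pi) ^+ 2 / (e * n%:R) ^+ 2)).
  rewrite big_mkcond/=; apply: ler_sum => pi _; case: ifPn => h.
    rewrite -mulrA ler_peMr// ler_pdivlMr ?exprn_gt0// mul1r.
    by rewrite -[X in _ <= X]real_normK ?num_real// lerXn2r// nnegrE ?ltW.
  by apply: divr_ge0; [apply: mulr_ge0 => //; exact: sqr_ge0|exact: sqr_ge0].
rewrite -mulr_suml ler_pdivrMr ?exprn_gt0//; apply: (le_trans (sum_dev_sqr p1)).
rewrite le_eqVlt; apply/orP; left; apply/eqP; field.
by rewrite !gt_eqF.
Qed.

End prefix_martingale.

(** * Integrals against mixtures and empirical measures *)

Section empirical_measure.
Context (R : realType) (E : pseudoPMetricType R).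

Lemma empiricalE n (x : 'I_n.+1 -> E) (B : set (EB R E)) :
  empirical x B = (\sum_(k < n.+1) (n.+1%:R^-1)%:E * (@dirac _ (EB R E) (x k) R B))%E.
Proof.
rewrite /empirical /= /mnormalize.
pose mu := msum (fun k : nat => @dirac _ (EB R E) (x (inord k)) R) n.+1.
have muE (A : set (EB R E)) : mu A = (\sum_(k < n.+1) @dirac _ (EB R E) (x k) R A)%E.
  by rewrite /mu /msum; apply: eq_bigr => k _; rewrite inord_val.
have -> : (mu : {measure set (EB R E) -> \bar R}) setT = (n.+1%:R : R)%:E.
  apply: (etrans (muE setT)).
  rewrite (eq_bigr (fun=> 1%:E)); last by move=> k _; rewrite diracT.
  by rewrite sumEFin sumr_const card_ord.
rewrite eqe pnatr_eq0/= muleC -ge0_sume_distrr//.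
by congr (_ * _)%E; exact: muE.
Qed.

Lemma ev_mixture (I : Type) (s : seq I) (w : I -> R) (mu : I -> PE R E) (m : PE R E) f :
  test_fun f -> (forall i, 0 <= w i) ->
  (forall B : set (EB R E), measurable B -> m B = \sum_(i <- s) (w i)%:E * mu i B)%E ->
  ev f m = \sum_(i <- s) w i * ev f (mu i).
Proof.
move=> tf w0 mE; apply: EFin_inj; rewrite -evE//.
rewrite (@integral_fin_mixture _ (EB R E) R _ s w mu m w0 mE)//.
- by rewrite -sumEFin; apply: eq_bigr => i _; rewrite EFinM evE.
- by move=> y; rewrite lee_fin; have /andP[] := tf.2 y.
- by apply/measurable_EFinP; exact: measurable_test.
Qed.

Lemma ev_close (m : PE R E) f (h : E -> R) (c e : R) : test_fun f ->
  measurable_fun setT (h : EB R E -> R) -> (forall x, 0 <= h x) -> 0 <= e ->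
  (forall x, `|f x - h x| <= e) -> (\int[m]_x (h x)%:E = c%:E)%E -> `|ev f m - c| <= e.
Proof.
move=> tf mh h0 e0 fh hc.
have mf := measurable_test tf.
have f0 x : 0 <= f x by have /andP[] := tf.2 x.
have le_int (g1 g2 : EB R E -> R) : measurable_fun setT g1 -> measurable_fun setT g2 ->
    (forall x, 0 <= g1 x) -> (forall x, 0 <= g2 x) -> (forall x, g1 x <= g2 x + e) ->
    (\int[m]_x (g1 x)%:E <= \int[m]_x (g2 x)%:E + e%:E)%E.
  move=> mg1 mg2 g10 g20 g12.
  rewrite -(integral_cst_probability (m : probability _ _) e).
  rewrite -(@ge0_integralD _ (EB R E) R m setT measurableT (EFin \o g2) (cst e%:E)); last 4 first.
  - by move=> x _; rewrite lee_fin.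
  - exact/measurable_EFinP.
  - by move=> x _; rewrite lee_fin.
  - exact: measurable_cst.
  apply: ge0_le_integral => //.
  - by move=> x _; rewrite lee_fin.
  - exact/measurable_EFinP.
  - by apply: emeasurable_funD; [exact/measurable_EFinP|exact: measurable_cst].
  - by move=> x _; rewrite /= -EFinD lee_fin.
have h1 : ev f m <= c + e.
  rewrite -lee_fin EFinD -hc -evE//; apply: le_int => // x.
  by have := fh x; rewrite ler_norml; lra.
have h2 : c <= ev f m + e.
  rewrite -lee_fin EFinD -hc -evE//; apply: le_int => // x.
  by have := fh x; rewrite ler_norml; lra.
by rewrite ler_norml; lra.
Qed.

Lemma ev_dirac f (x : E) : test_fun f -> ev f (@dirac _ (EB R E) x R) = f x.
Proof.
move=> tf; rewrite /ev integral_dirac//.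
  by rewrite diracT mul1e.
by apply/measurable_EFinP; exact: measurable_test.
Qed.

Lemma ev_empirical n (x : 'I_n.+1 -> E) f : test_fun f ->
  ev f (empirical x) = n.+1%:R^-1 * \sum_(k < n.+1) f (x k).
Proof.
move=> tf; rewrite (@ev_mixture _ (index_enum _) (fun=> n.+1%:R^-1)
  (fun k => @dirac _ (EB R E) (x k) R : PE R E))//.
- by rewrite mulr_sumr; apply: eq_bigr => k _; rewrite ev_dirac.
- by move=> B _; rewrite empiricalE.
Qed.

End empirical_measure.

(** * Laws of a coordinate given the quantized past *)

Section prefix_laws.
Context (R : realType) (E : pseudoPMetricType R) (n : nat) (nu : PEn R E n).
Context (S : finType) (q : E -> S).

Definition path_of (x : 'I_n -> E) : {ffun 'I_n -> S} := [ffun j => q (x j)].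

Definition path_prob (pi : {ffun 'I_n -> S}) : R := fine (nu [set x | path_of x = pi]).

(** Stated as a product, so that [m k t] is arbitrary at a prefix of mass zero. *)
Definition prefix_laws (m : 'I_n -> {ffun 'I_n -> option S} -> PE R E) :=
  forall (k : 'I_n) t (B : set (EB R E)), measurable B ->
  ((prefix_mass path_prob k t)%:E * m k t B =
    nu [set x | prefix_of k (path_of x) = t /\ B (x k)])%E.

Hypothesis mq : forall s, measurable ([set e | q e = s] : set (EB R E)).

Lemma measurable_path_eq pi : measurable ([set x | path_of x = pi] : set (EnB R E n)).
Proof.
rewrite (_ : [set x | _] = \bigcap_(j in [set: 'I_n])
    ((fun x : EnB R E n => x j : EB R E) @^-1` [set e | q e = pi j])).
  apply: fin_bigcap_measurable => // j _; rewrite -[X in measurable X]setTI.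
  by apply: (@measurable_coord R E n j) => //.
apply/seteqP; split => [x <- j _|x h]; first by rewrite /= ffunE.
by apply/ffunP => j; rewrite ffunE; exact: h.
Qed.

Lemma measurable_path (Q : pred {ffun 'I_n -> S}) :
  measurable ([set x | Q (path_of x)] : set (EnB R E n)).
Proof.
rewrite (_ : [set x | _] = \bigcup_(pi in [set pi | Q pi]) [set x | path_of x = pi]).
  by apply: fin_bigcup_measurable => // pi _; exact: measurable_path_eq.
apply/seteqP; split => [x Qx|x [pi Qpi /= ->]//]; by exists (path_of x).
Qed.

Lemma path_probE (Q : pred {ffun 'I_n -> S}) :
  nu [set x | Q (path_of x)] = (\sum_(pi | Q pi) path_prob pi)%:E.
Proof.
have mA := measurable_path Q.
have mj pi : measurable ([set x : EnB R E n | Q (path_of x)] `&` [set x | path_of x = pi]).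
  by apply: measurableI => //; exact: measurable_path_eq.
have := @ge0_integral_finvalued _ _ R nu _ path_of _ (fun=> 1%E) mA mj (fun=> lee01).
rewrite integral_cst// mul1e => ->; rewrite [in RHS]big_mkcond -sumEFin.
apply: eq_bigr => pi _; rewrite mul1e; case: ifPn => Qpi.
  rewrite /path_prob fineK; last by apply: fin_num_measure; exact: measurable_path_eq.
  by congr (nu _); apply/seteqP; split => [x []//|x /= xpi]; split => //=; rewrite xpi.
rewrite (_ : _ `&` _ = set0) ?measure0//.
by apply/seteqP; split => // x [/= + xpi]; rewrite xpi (negbTE Qpi).
Qed.

Lemma path_prob_ge0 pi : 0 <= path_prob pi.
Proof. by rewrite fine_ge0. Qed.

Lemma sum_path_prob : \sum_pi path_prob pi = 1.
Proof.
apply: EFin_inj; rewrite -(path_probE predT) -[RHS](@probability_setT _ _ _ nu).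
by congr (nu _); apply/seteqP.
Qed.

Lemma prefix_massE k t :
  nu [set x | prefix_of k (path_of x) = t] = (prefix_mass path_prob k t)%:E.
Proof.
rewrite -(path_probE (fun pi => prefix_of k pi == t)); congr (nu _).
by apply/seteqP; split => x /= /eqP.
Qed.

Lemma measurable_prefix k t :
  measurable ([set x | prefix_of k (path_of x) = t] : set (EnB R E n)).
Proof.
rewrite (_ : [set x | _] = [set x | (fun pi => prefix_of k pi == t) (path_of x)]).
  exact: (@measurable_path (fun pi => prefix_of k pi == t)).
by apply/seteqP; split => x /= /eqP.
Qed.

Lemma exists_prefix_laws : exists m, prefix_laws m.
Proof.
suff /choice[m hm] : forall kt : 'I_n * {ffun 'I_n -> option S}, exists mu : PE R E,
    forall B : set (EB R E), measurable B ->
    ((prefix_mass path_prob kt.1 kt.2)%:E * mu B =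
      nu [set x | prefix_of kt.1 (path_of x) = kt.2 /\ B (x kt.1)])%E.
  by exists (fun k t => m (k, t)) => k t B mB; exact: hm (k, t) B mB.
move=> [k t] /=; have mA := measurable_prefix k t.
have w0 : 0 <= prefix_mass path_prob k t by apply: prefix_mass_ge0; exact: path_prob_ge0.
pose tl := trace_law nu (@measurable_coord R E n k) mA.
have tlE B : tl B = nu [set x | prefix_of k (path_of x) = t /\ B (x k)].
  by rewrite /tl /trace_law; congr (nu _); apply/seteqP; split => x /= [].
have [wz|wnz] := eqVneq (prefix_mass path_prob k t) 0.
  exists point => B mB; rewrite wz mul0e; apply/esym/eqP.
  rewrite eq_le measure_ge0 andbT -tlE.
  have <- : nu [set x | prefix_of k (path_of x) = t] = 0%E by rewrite prefix_massE wz.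
  apply: le_measure; rewrite ?inE//.
    apply: measurableI => //; rewrite -[X in measurable X]setTI.
    by apply: (@measurable_coord R E n k) => //.
exists (mnormalize tl point) => B mB; rewrite /= /mnormalize.
have -> : (tl : {measure set _ -> \bar R}) setT = (prefix_mass path_prob k t)%:E.
  by apply: (etrans (tlE setT)); rewrite -prefix_massE; congr (nu _);
    apply/seteqP; split => x //= [].
rewrite eqe (negbTE wnz)/= muleCA -EFinM divff// mule1; exact: tlE.
Qed.

(** Connects the laws on [E] with the finite martingale. Multiplied by the mass of the prefix, both
    sides become sums over paths. *)
Lemma prefix_laws_mean m (g : S -> R) (k : 'I_n) t : prefix_laws m ->
  (forall s, 0 <= g s <= 1) -> 0 < prefix_mass path_prob k t ->
  (\int[m k t]_e (g (q e))%:E = (prefix_mean path_prob g k t)%:E)%E.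
Proof.
move=> hm g01 w0.
have g0 s : (0 <= (g s)%:E)%E by rewrite lee_fin; have /andP[] := g01 s.
have -> : (\int[m k t]_e (g (q e))%:E =
    \sum_s (g s)%:E * m k t [set e | q e = s])%E.
  have mj s : measurable ([set: EB R E] `&` [set e | q e = s]) by rewrite setTI.
  rewrite (@ge0_integral_finvalued _ (EB R E) R (m k t) _ q setT
    (fun s => (g s)%:E) measurableT mj g0).
  by apply: eq_bigr => s _; rewrite setTI.
have key : ((prefix_mass path_prob k t)%:E * \sum_s (g s)%:E * m k t [set e | q e = s] =
    (prefix_mean path_prob g k t * prefix_mass path_prob k t)%:E)%E.
  rewrite prefix_mean_mass; last exact: path_prob_ge0.
  rewrite ge0_sume_distrr; last by move=> s _; rewrite mule_ge0.
  rewrite (partition_big (fun pi : {ffun 'I_n -> S} => pi k) predT)//= -[RHS]sumEFin.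
  apply: eq_bigr => s _; rewrite muleCA hm//.
  rewrite (_ : [set x | _] = [set x | (fun pi : {ffun 'I_n -> S} =>
      (prefix_of k pi == t) && (pi k == s)) (path_of x)]); last first.
    apply/seteqP; split => x /=; first by move=> [-> <-]; rewrite eqxx ffunE eqxx.
    by rewrite ffunE => /andP[/eqP -> /eqP ->].
  rewrite (path_probE (fun pi : {ffun 'I_n -> S} => (prefix_of k pi == t) && (pi k == s))).
  rewrite -EFinM mulr_sumr; congr EFin; apply: eq_bigr => pi /andP[_ /eqP ->].
  by rewrite mulrC.
have e : (\sum_s (g s)%:E * m k t [set e | q e = s] = ((prefix_mass path_prob k t)^-1)%:E *
  ((prefix_mass path_prob k t)%:E * \sum_s (g s)%:E * m k t [set e | q e = s]))%E.
  by rewrite muleA -EFinM mulVf ?mul1e// gt_eqF.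
by rewrite e key -EFinM mulrCA mulVf ?mulr1// gt_eqF.
Qed.

End prefix_laws.

(** * A law of large numbers uniform in the joint law *)

Section prefix_law_of_large_numbers.
Context (R : realType) (E : pseudoPMetricType R).

Lemma list_In_nth (T : Type) (x0 : T) (fs : seq T) f : List.In f fs ->
  exists i : 'I_(size fs), f = nth x0 fs i.
Proof.
move=> ffs; suff [j [js ->]] : exists j, (j < size fs)%N /\ f = nth x0 fs j.
  by exists (Ordinal js).
move: ffs; elim: fs => [//|g s ih] /= [->|/ih[j [js jE]]]; first by exists 0%N.
by exists j.+1.
Qed.

Lemma list_nth_In (T : Type) (x0 : T) (fs : seq T) (i : 'I_(size fs)) :
  List.In (nth x0 fs i) fs.
Proof.
move: (ltn_ord i); move: (nat_of_ord i); elim: fs {i} => [//|g s ih] [|j] /=; first by left.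
by move=> js; right; exact: ih.
Qed.

(** The order of quantifiers is the point: [q] and [C] are fixed before [n] and [nu], so the bound
    C/(n+1) is uniform over all laws. *)
Lemma prefix_lln (fs : seq (E -> R)) (e : R) :
  (forall f, List.In f fs -> test_fun f) -> 0 < e ->
  exists (S : finType) (q : E -> S) (C : R),
    (forall s, measurable ([set x | q x = s] : set (EB R E))) /\
    forall n (nu : PEn R E n.+1) m, prefix_laws nu q m ->
    exists bad : pred {ffun 'I_n.+1 -> S},
      (nu [set x | bad (path_of q x)] <= (C / n.+1%:R)%:E)%E /\
      forall x, ~~ bad (path_of q x) ->
        (forall k : 'I_n.+1, 0 < prefix_mass (path_prob nu q) k (prefix_of k (path_of q x))) /\
        forall f, List.In f fs ->
          `|ev f (empirical x) -
            n.+1%:R^-1 * \sum_k ev f (m k (prefix_of k (path_of q x)))| < e.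
Proof.
move=> tfs e0; pose fi (i : 'I_(size fs)) : E -> R := nth (fun=> 0) fs i.
have tf i : test_fun (fi i) by apply: tfs; exact: list_nth_In.
(* Error budget: e/5 for quantizing the points, e/5 for quantizing under the laws, e/2 for the
   martingale, in total less than [e]. *)
have e5 : 0 < e / 5 by rewrite divr_gt0.
have e2 : 0 < e / 2 by rewrite divr_gt0.
have [S [q [mq hq]]] := @finite_quantization _ (EB R E) R _ fi _
  (fun i => measurable_test (tf i)) (fun i => (tf i).2) e5.
pose rep s : E := get [set x | q x = s].
have repP x : q (rep (q x)) = q x.
  by rewrite /rep; apply: (@getPex _ [set y | q y = q x]); exists x.
pose g i s := fi i (rep s).
have g01 i s : 0 <= g i s <= 1 by exact: (tf i).2.
have fg i x : `|fi i x - g i (q x)| <= e / 5 by apply: hq; rewrite repP.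
(* One Chebyshev bound at level e/2 for each test function. *)
exists S, q, ((size fs)%:R * (e / 2) ^- 2); split => // n nu m hm.
pose p := path_prob nu q.
have p0 pi : 0 <= p pi by exact: path_prob_ge0.
have p1 : \sum_pi p pi = 1 by exact: sum_path_prob.
pose dv i k pi := dev p (g i) k pi.
pose badi i (pi : {ffun 'I_n.+1 -> S}) := e / 2 * n.+1%:R <= `|\sum_k dv i k pi|.
(* Null paths are declared bad at no cost; off the bad set every prefix then has positive mass and
   its law is determined. *)
exists (fun pi => (p pi == 0) || [exists i, badi i pi]); split.
  rewrite (path_probE nu mq (fun pi => (p pi == 0) || [exists i, badi i pi])) lee_fin.
  apply: (@le_trans _ _ (\sum_i \sum_(pi | badi i pi) p pi)).
    rewrite (eq_bigr (fun i => \sum_pi if badi i pi then p pi else 0)); last first.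
      by move=> i _; rewrite big_mkcond.
    rewrite exchange_big/= big_mkcond; apply: ler_sum => pi _.
    have s0 : 0 <= \sum_i (if badi i pi then p pi else 0).
      by apply: sumr_ge0 => i _; case: ifP.
    case: ifPn => // /orP[/eqP pz|/existsP[i bi]].
      by move: s0; rewrite -/(p pi) pz.
    rewrite (bigD1 i)//= bi lerDl; apply: sumr_ge0 => j _; by case: ifP.
  apply: (@le_trans _ _ (\sum_(i < size fs) (n.+1%:R * (e / 2) ^+ 2)^-1)).
    by apply: ler_sum => i _; exact: dev_chebyshev.
  by rewrite sumr_const card_ord -[leLHS]mulr_natl invfM mulrCA [leRHS]mulrC.
move=> x; rewrite negb_or => /andP[px /existsPn nb].
have mass0 (k : 'I_n.+1) : 0 < prefix_mass p k (prefix_of k (path_of q x)).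
  apply: (@lt_le_trans _ _ (p (path_of q x))); first by rewrite lt_neqAle eq_sym px p0.
  by rewrite /prefix_mass (bigD1 (path_of q x))//= lerDl; exact: sumr_ge0.
split => // f /(list_In_nth (fun=> 0))[i ->]; rewrite -/(fi i) ev_empirical//.
rewrite -mulrBr -sumrB; set N : R := n.+1%:R; have N0 : 0 < N by rewrite ltr0n.
rewrite normrM gtr0_norm ?invr_gt0// mulrC ltr_pdivrMr//.
have step k : `|fi i (x k) - ev (fi i) (m k (prefix_of k (path_of q x))) - dv i k (path_of q x)| <= e / 5 + e / 5.
  have -> : fi i (x k) - ev (fi i) (m k (prefix_of k (path_of q x))) - dv i k (path_of q x) =
      (fi i (x k) - g i (q (x k))) - (ev (fi i) (m k (prefix_of k (path_of q x))) - prefix_mean p (g i) k (prefix_of k (path_of q x))).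
    by rewrite /dv /dev ffunE; ring.
  apply: (le_trans (ler_normB _ _)); apply: lerD; first exact: fg.
  apply: (@ev_close _ _ _ _ (g i \o q)) => //.
  - by apply: (measurable_fun_finvalued (g i)) => s; rewrite setTI; exact: mq.
  - by move=> y; have /andP[] := g01 i (q y).
  - exact: ltW.
  - by apply: prefix_laws_mean => //; exact: mass0.
have : `|\sum_k (fi i (x k) - ev (fi i) (m k (prefix_of k (path_of q x))) - dv i k (path_of q x))| <= N * (e / 5 + e / 5).
  apply: (le_trans (ler_norm_sum _ _ _)); apply: (le_trans (ler_sum _ (fun k _ => step k))).
  by rewrite sumr_const card_ord -[leLHS]mulr_natl.
have := nb i; rewrite /badi -ltNge -/N => h1.
pose s2 := \sum_k (fi i (x k) - ev (fi i) (m k (prefix_of k (path_of q x)))).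
pose s1 := \sum_k dv i k (path_of q x).
have -> : \sum_k (fi i (x k) - ev (fi i) (m k (prefix_of k (path_of q x)))
    - dv i k (path_of q x)) = s2 - s1 by rewrite [LHS]sumrB.
rewrite -/s2; move: h1; rewrite -/s1 => h1 h2.
have e0' : 0 < N * e by rewrite mulr_gt0.
have E1 : e / 2 * N = N * e / 2 by ring.
have E2 : N * (e / 5 + e / 5) = N * e * (2 / 5) by field.
move: h1 h2 e0'; rewrite E1 E2 [e * N]mulrC; set w := N * e.
by rewrite ltr_norml ler_norml ltr_norml; lra.
Qed.

End prefix_law_of_large_numbers.

(** * Upper semicontinuity, uniformly on a sub-level set *)

Section uniform_upper_semicontinuity.
Context (R : realType) (E : pseudoPMetricType R).

(* A cluster point of the measures violating the bound for ever finer tests would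
   violate [F <= s + alpha]. *)
Lemma usc_uniform (alpha : PE R E -> \bar R) (F : PE R E -> R) (s a dlt : R) :
  (forall nu, alpha nu != -oo%E) ->
  lower_semicontinuous (fun nu : PEw R E => alpha nu) -> compact_sublevels alpha ->
  weak_usc F -> (forall nu, (F nu)%:E <= s%:E + alpha nu)%E -> 0 < dlt ->
  exists (fs : seq (E -> R)) (e : R), [/\ 0 < e,
    forall f, List.In f fs -> test_fun f &
    forall m l : PE R E, (alpha m <= a%:E)%E ->
      (forall f, List.In f fs -> `|ev f l - ev f m| < e) ->
      ((F l)%:E <= (s + dlt)%:E + alpha m)%E].
Proof.
move=> aNy la ka uF Fs d0; apply: contrapT => /forallNP H.
pose bad (t : seq (E -> R) * R) : set (PEw R E) := [set m : PE R E | (alpha m <= a%:E)%E /\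
  exists l : PE R E, (forall f, List.In f t.1 -> `|ev f l - ev f m| < t.2) /\
    ((s + dlt)%:E + alpha m < (F l)%:E)%E].
pose D := [set t : seq (E -> R) * R | 0 < t.2 /\ forall f, List.In f t.1 -> test_fun f].
have FF : ProperFilter (filter_from D bad).
  apply: filter_from_proper.
    apply: filter_from_filter; first by exists ([::], 1).
    move=> [g e] [g' e'] /= [e0 tg] [e'0 tg'].
    exists (g ++ g', Num.min e e') => /=.
      split; first by rewrite lt_min e0.
      by move=> f /List.in_app_iff[]; [exact: tg|exact: tg'].
    move=> m [am [l [lm Fl]]]; split; split => //; exists l; split => // f fg.
      by have := lm f (List.in_or_app _ _ _ (or_introl fg)); rewrite lt_min => /andP[].
    by have := lm f (List.in_or_app _ _ _ (or_intror fg)); rewrite lt_min => /andP[].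
  move=> [g e] [e0 tg]; have /forallNP/(_ e) := H g.
  move=> nh; apply: contrapT => nb; apply: nh; split => // m l am lm.
  rewrite leNgt; apply/negP => Fl; apply: nb; exists m; split => //.
  by exists l.
have [|m0 [am0 cm0]] := ka a (filter_from D bad) FF.
  exists ([::], 1); first by split.
  by move=> m [].
have [v vE] : exists v, alpha m0 = v%:E.
  move: am0 (aNy m0); rewrite /=; case: (alpha m0) => [v _ _|//|//].
  by exists v.
have Fm0 : F m0 <= s + v by rewrite -lee_fin EFinD -vE.
have lt1 : ((- F m0 - dlt / 2)%:E < (- F m0)%:E)%E by rewrite lte_fin; lra.
have lt2 : ((v - dlt / 2)%:E < alpha m0)%E by rewrite vE lte_fin; lra.
have [U1 nU1 hU1] := uF m0 _ lt1.
have [U2 nU2 hU2] := la m0 _ lt2.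
have [g [e [e0 tg gU]]] := nbhs_weakP (filterI nU1 nU2).
have e20 : 0 < e / 2 by rewrite divr_gt0.
have nW : nbhs m0 [set m : PEw R E | forall f, List.In f g -> `|ev f m - ev f m0| < e / 2].
  elim: g tg {gU} => [|f g ih] tg; first by apply: filterS filterT => m _ f.
  have tf : test_fun f by apply: tg; left.
  apply: filterS (filterI (nbhs_ev m0 tf e20) (ih _)).
    by move=> m [h1 h2] f' [<-//|]; exact: h2.
  by move=> f' hf'; apply: tg; right.
(* [m] is e/2-close to the cluster point [m0] and [l] is e/2-close to [m], so both lie where [F] and
   [alpha] have moved the wrong way by less than dlt/2. *)
have [|m [[am [l [lm Fl]]] mm0]] := cm0 (bad (g, e / 2)) _ _ nW.
  by exists (g, e / 2).
have [_ /hU2 am'] : (U1 `&` U2) m.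
  apply: gU => f fg; apply: lt_trans (mm0 f fg) _; lra.
have [/hU1 Fl' _] : (U1 `&` U2) l.
  apply: gU => f fg; have := mm0 f fg; have := lm f fg.
  rewrite /= !ltr_norml; lra.
move: Fl' am' Fl; case: (alpha m) => [w| |//].
  by rewrite -EFinD !lte_fin; lra.
by rewrite addey.
Qed.

End uniform_upper_semicontinuity.

(** * Extended real limits and shifted integrals *)

Section ereal_limits.
Context (R : realType).
Implicit Types (u : (\bar R)^nat) (b : \bar R).

Lemma limn_esup_le_near u b : (\forall n \near \oo, (u n <= b)%E) -> (limn_esup u <= b)%E.
Proof.
move=> h; apply: (@le_trans _ _ (ereal_sup [set u n | n in [set n | (u n <= b)%E]])).
  by apply: ereal_inf_lbound; exists [set n | (u n <= b)%E].
by apply: ge_ereal_sup => _ [n /= un <-].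
Qed.

Lemma le_limn_einf_near u b : (\forall n \near \oo, (b <= u n)%E) -> (b <= limn_einf u)%E.
Proof.
move=> h; rewrite /limn_einf leeNr; apply: limn_esup_le_near.
by apply: filterS h => n; rewrite leeN2.
Qed.

Lemma bounded_fun_bound T (F : T -> R) : bounded_fun F ->
  exists B : R, 0 <= B /\ forall x, `|F x| <= B.
Proof.
by move=> /pinfty_ex_gt0[B B0 h]; exists B; split => [|x]; [exact: ltW|exact: h].
Qed.

End ereal_limits.

Section shift.
Context d (T : measurableType d) (R : realType) (P : probability T R).
Local Open Scope ereal_scope.

(** Here [r] may be negative and the integral of [g] infinite. In that case the negative part of g +
    r is at most |r|, so the right-hand side is [+oo] too. *)
Lemma ge0_integral_shift (g : T -> \bar R) (r : R) : (forall x, 0 <= g x) ->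
  measurable_fun setT g -> \int[P]_x g x + r%:E <= \int[P]_x (g x + r%:E).
Proof.
move=> g0 mg; have [gy|gy] := eqVneq (\int[P]_x g x) +oo; last first.
  have ig : P.-integrable setT g.
    apply/integrableP; split => //; rewrite ltey.
    by under eq_integral do rewrite gee0_abs//.
  have ir : P.-integrable setT (cst r%:E) by exact: finite_measure_integrable_cst.
  have -> : \int[P]_x (g x + r%:E) = \int[P]_x (g x + cst r%:E x) by [].
  by rewrite integralD// (integral_cst_probability P).
pose f x := g x + r%:E.
have mf : measurable_fun setT f by apply: emeasurable_funD => //; exact: measurable_cst.
have fneg : \int[P]_x (f^\- x) <= (`|r|%R)%:E.
  rewrite -(integral_cst_probability P); apply: ge0_le_integral => //.
  - exact: measurable_funeneg.
  - move=> x _; rewrite funenegE /f ge_max lee_fin normr_ge0 andbT.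
    rewrite leeNl -EFinN; apply: (@le_trans _ _ r%:E); last by rewrite leeDr.
    by rewrite lee_fin; have := ler_norm (- r)%R; rewrite normrN; lra.
have fpos : \int[P]_x (f^\+ x) = +oo.
  have : \int[P]_x g x <= \int[P]_x (f^\+ x + cst (`|r|%R)%:E x).
    apply: ge0_le_integral => //.
    - apply: emeasurable_funD; [exact: measurable_funepos|exact: measurable_cst].
    - move=> x _; apply: (@le_trans _ _ (f x + (`|r|%R)%:E)).
        rewrite /f -addeA -EFinD leeDl// lee_fin.
        by have := ler_norm (- r)%R; rewrite normrN; lra.
      by rewrite leeD2r// funeposE le_max lexx.
  rewrite gy (ge0_integralD P measurableT _ (measurable_funepos mf) _ (measurable_cst _))//.
  rewrite (integral_cst_probability P); case: (\int[P]_x f^\+ x) => [v| |]//.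
  by move=> x _; rewrite /= lee_fin.
rewrite gy addye// -/(f _) [leRHS](integralE P _ f) fpos.
by move: fneg; case: (\int[P]_x f^\- x) => [v _|//|_]; rewrite ?addye.
Qed.

End shift.

(** * The upper bound *)

Section upper_bound.
Context (R : realType) (E : pseudoPMetricType R).
Hypothesis sepE : exists D : set E, countable D /\ dense D.

Lemma measurable_empirical n :
  measurable_fun setT (@empirical R E n : EnB R E n.+1 -> PEB R E).
Proof.
apply: measurable_PEB => // B mB.
rewrite (_ : (fun x => _) = (fun x : EnB R E n.+1 =>
   (\sum_(k < n.+1) (n.+1%:R^-1)%:E * (\1_B (x k))%:E)%E)); last first.
  by apply/funext => x; rewrite empiricalE; apply: eq_bigr => k _; rewrite diracE indicE.
apply: emeasurable_sum => k; apply: measurable_funeM; apply/measurable_EFinP.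
apply: (measurableT_comp (@measurable_indic _ (EB R E) R setT B mB)).
exact: (@measurable_coord R E n.+1 k).
Qed.

Lemma measurable_usc (F : PE R E -> R) : weak_usc F ->
  measurable_fun setT (F : PEB R E -> R).
Proof.
move=> uF; apply: (measurability _ (RGenInftyO.measurableE R)).
move=> _ [_ [a ->] <-]; rewrite setTI.
rewrite (_ : _ @^-1` _ = [set m : PEw R E | ((- a)%:E < (- F m)%:E)%E]).
  by apply: sub_sigma_algebra => /=; exact: (lower_semicontinuousP _).1 uF (- a).
by apply/seteqP; split => m /=; rewrite in_itv/= lte_fin ltrN2.
Qed.

(** Makes a prefix event a condition on the coordinates other than [k], so that averaging [kappa]
    over it gives the law of coordinate [k] there. *)
Lemma prefix_path_ins n (S : finType) (q : E -> S) (k : 'I_n) (x : 'I_n -> E) e :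
  prefix_of k (path_of q (ins_coord k (drop_coord k x) e)) = prefix_of k (path_of q x).
Proof.
apply/ffunP => j; rewrite !ffunE; case: ifP => // jk; congr (Some (q _)).
have : j != k by rewrite -val_eqE/= neq_ltn jk.
rewrite eq_sym => /unlift_some[i -> _]; rewrite ins_coord_lift; by rewrite /drop_coord.
Qed.

(* Jensen's inequality given the quantised past: this is where the law of X_k given all
   other coordinates is traded for its law given the past. *)
Lemma prefix_jensen (a : PE R E -> \bar R) n (nu : PEn R E n) (S : finType) (q : E -> S)
    m (k : 'I_n) (kappa : ('I_n.-1 -> E) -> PE R E) :
  (forall mu, 0 <= a mu)%E -> alpha_convex a -> alpha_measurable a ->
  lower_semicontinuous (fun mu : PEw R E => a mu) ->
  (forall s, measurable ([set x | q x = s] : set (EB R E))) ->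
  prefix_laws nu q m -> is_cond_law nu k kappa ->
  (\int[nu]_x a (m k (prefix_of k (path_of q x))) <=
    \int[nu]_x a (kappa (drop_coord k x)))%E.
Proof.
move=> a0 ca ma la mq hm [mkap hkap].
have mdrop := measurable_drop_coord k sepE.
have mkd : measurable_fun setT
    ((fun x : EnB R E n => kappa (drop_coord k x)) : EnB R E n -> PEB R E).
  exact: (measurableT_comp mkap mdrop).
have mak : measurable_fun setT (fun x : EnB R E n => a (kappa (drop_coord k x))).
  exact: (measurableT_comp (ma : measurable_fun setT (a : PEB R E -> _)) mkd).
pose idx (x : EnB R E n) := prefix_of k (path_of q x).
have midx t : measurable ([set: EnB R E n] `&` [set x | idx x = t]).
  by rewrite setTI; exact: (measurable_prefix mq).
rewrite (@ge0_integral_finvalued _ _ R nu _ idx setT (fun t => a (m k t)))//.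
rewrite (@ge0_integral_finpart _ _ R nu _ idx setT)//.
apply: lee_sum => t _; rewrite !setTI.
pose w := prefix_mass (path_prob nu q) k t.
have wE : (nu : {measure set (EnB R E n) -> \bar R}) [set x | idx x = t] = w%:E.
  exact: (prefix_massE nu mq k t).
rewrite wE muleC.
have w0 : 0 <= w by apply: prefix_mass_ge0; exact: path_prob_ge0.
have [wz|wnz] := eqVneq w 0; first by rewrite wz mul0e integral_ge0.
have wp : 0 < w by rewrite lt_neqAle eq_sym wnz.
have mA := measurable_prefix mq k t.
apply: (@jensen_PE R E a _ _ nu [set x | idx x = t] w
  (fun x => kappa (drop_coord k x)) (m k t)) => //.
move=> B mB; rewrite hm// hkap; last first.
  rewrite (_ : [set x | _] = [set x | prefix_of k (path_of q x) = t] `&`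
     ((fun x : EnB R E n => x k : EB R E) @^-1` B)).
    apply: measurableI => //; rewrite -[X in measurable X]setTI.
    exact: (@measurable_coord R E n k).
  by apply/seteqP; split => x /= [].
rewrite [RHS]integral_mkcond; apply: eq_integral => x _; rewrite patchE.
case: ifPn => [|/negP]; rewrite inE => xt.
  congr (kappa _ _); apply/seteqP; split => e /=; rewrite prefix_path_ins ins_coordK.
    by case.
  by move=> Be; split.
rewrite (_ : [set e | _] = set0) ?measure0//.
by apply/seteqP; split => // e /=; rewrite prefix_path_ins => -[].
Qed.

Hypothesis hausE : hausdorff_space E.
Hypothesis complE : forall G : set_system E, ProperFilter G -> cauchy G -> cvg G.

(** Off the bad set [empirical x] is close to the average [M] of the prefix laws, hence F <= s + dlt
    + alpha(M) there, and convexity bounds alpha(M). The bad set costs K0 C/(n+1). Integration and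
    [prefix_jensen] bring in the conditional laws. *)
Lemma scaled_rho_le (alpha : PE R E -> \bar R) (F : PE R E -> R) (c B s dlt : R) :
  alpha_measurable alpha -> (forall nu, c%:E <= alpha nu)%E ->
  alpha_convex alpha -> compact_sublevels alpha -> weak_usc F ->
  (forall nu, `|F nu| <= B) -> (forall nu, (F nu)%:E <= s%:E + alpha nu)%E -> 0 < dlt ->
  exists K : R, forall n, (scaled_rho alpha F n <= (s + dlt + K / n.+1%:R)%:E)%E.
Proof.
move=> ma alb ca ka uF FB Fs d0.
have aNy nu : alpha nu != -oo%E.
  by have := alb nu; case: (alpha nu).
have la := lsc_of_compact_sublevels ma ka.
(* Subtracting the lower bound makes the function nonnegative without affecting convexity or
   semicontinuity. *)
pose a nu := (alpha nu - c%:E)%E.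
have a0 nu : (0 <= a nu)%E by rewrite /a sube_ge0.
have aE nu : alpha nu = (a nu + c%:E)%E by rewrite /a subeK.
have maa : alpha_measurable a.
  by apply: emeasurable_funB => //; exact: measurable_cst.
have caa : alpha_convex a.
  move=> m1 m2 m t t01 hm; have := ca m1 m2 m t t01 hm.
  rewrite !aE !muleDr ?fin_num_adde_defl// addeACA -!EFinM -EFinD.
  by rewrite (_ : t * c + (1 - t) * c = c) ?leeD2rE//; ring.
have laa : lower_semicontinuous (fun mu : PEw R E => a mu).
  move=> x b bx; have bx' : ((b + c)%:E < alpha x)%E by rewrite aE EFinD lteD2rE.
  have [V nV hV] := la x _ bx'; exists V => // y /hV.
  by rewrite aE EFinD lteD2rE.
(* Above the level B - s the bound s + alpha already exceeds [B], hence [F]; uniformity is needed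
   only below it. *)
have [fs [e [e0 tfs husc]]] := usc_uniform (B - s) aNy la ka uF Fs d0.
have [S [q [C [mq hlln]]]] := prefix_lln tfs e0.
(* Large enough that s + dlt + c + K0 dominates [B], the worst value of [F] on the bad set. *)
pose K0 := `|s| + `|c| + `|B| + dlt.
exists (K0 * C) => n; set N : R := n.+1%:R; have N0 : 0 < N by rewrite ltr0n.
rewrite /scaled_rho -/N lee_pdivrMl//; apply: ge_ereal_sup => _ [nu _ <-].
have /choice[kappa hkappa] := fun k => cond_law_exists nu k hausE complE sepE.
pose I := (\int[nu]_x (\sum_(k < n.+1) alpha (kappa k (drop_coord k x))))%E.
(* For an upper bound one choice of versions is enough. *)
have Ile : (I <= alpha_n alpha nu)%E by apply: ereal_sup_ubound; exists kappa.
pose I0 := (\sum_(k < n.+1) \int[nu]_x a (kappa k (drop_coord k x)))%E.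
have mak k : measurable_fun setT (fun x : EnB R E n.+1 => a (kappa k (drop_coord k x))).
  apply: (measurableT_comp (maa : measurable_fun setT (a : PEB R E -> _))).
  have mdrop := measurable_drop_coord k sepE.
  exact: (measurableT_comp (hkappa k).1 mdrop).
have I0le : (I0 + (N * c)%:E <= I)%E.
  have -> : I = (\int[nu]_x ((\sum_(k < n.+1) a (kappa k (drop_coord k x))) + (N * c)%:E))%E.
    apply: eq_integral => x _; under eq_bigr do rewrite aE.
    by rewrite big_split/= sumEFin sumr_const card_ord -[c *+ _]mulr_natl.
  rewrite /I0 -ge0_integral_sum//; apply: ge0_integral_shift => //.
    by move=> x; exact: sume_ge0.
  exact: emeasurable_sum.
have [m hm] := exists_prefix_laws nu mq.
have [bad [badP hbad]] := hlln n nu m hm.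
pose am k (x : EnB R E n.+1) := a (m k (prefix_of k (path_of q x))).
have pointwise x : ((F (empirical x))%:E <= (s + dlt + c + K0 * \1_[set y | bad (path_of q y)] x)%:E
    + (N^-1)%:E * \sum_(k < n.+1) am k x)%E.
  have sum0 : (0 <= (N^-1)%:E * \sum_(k < n.+1) am k x)%E.
    by rewrite mule_ge0 ?lee_fin ?invr_ge0 ?(ltW N0)// sume_ge0// => k _; exact: a0.
  have FB' := FB (empirical x); rewrite ler_norml in FB'.
  have s1 := ler_norm (- s); have c1 := ler_norm (- c); have B1 := ler_norm B.
  rewrite !normrN in s1 c1.
  rewrite indicE; have [xb|xb] := pselect (bad (path_of q x)).
    rewrite mem_set//=.
    apply: (@le_trans _ _ (s + dlt + c + K0 * 1)%:E); last by rewrite leeDl.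
    by rewrite lee_fin mulr1 /K0; lra.
  rewrite memNset//=; have [_ close] := hbad x (introN idP xb).
  pose mu k := m k (prefix_of k (path_of q x)).
  have w1 : \sum_(k < n.+1) N^-1 = 1 :> R.
    by rewrite sumr_const card_ord -[LHS]mulr_natl divff// gt_eqF.
  have w0 (k : 'I_n.+1) : 0 <= N^-1 by rewrite invr_ge0 ltW.
  have [M [ME aM]] := alpha_convex_mixture a0 caa (s := index_enum _) mu w0 w1.
  have evM f : test_fun f -> ev f M = N^-1 * \sum_k ev f (mu k).
    by move=> tf; rewrite (ev_mixture tf w0 (fun B _ => ME B)) mulr_sumr.
  rewrite mulr0 addr0.
  have aM' : (a M <= (N^-1)%:E * \sum_(k < n.+1) am k x)%E.
    by apply: (le_trans aM); rewrite ge0_sume_distrr// => k _; exact: a0.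
  apply: (@le_trans _ _ ((s + dlt + c)%:E + a M)%E); last exact: leeD2l.
  have -> : ((s + dlt + c)%:E + a M = (s + dlt)%:E + alpha M)%E.
    by rewrite aE EFinD -addeA [(c%:E + _)%E]addeC.
  have [aMB|aMB] := leP (alpha M) (B - s)%:E.
    by apply: husc => // f ff; rewrite evM; [exact: close|exact: tfs].
  apply: (@le_trans _ _ ((s + dlt)%:E + (B - s)%:E)%E); last by rewrite leeD2l// ltW.
  rewrite -EFinD lee_fin (_ : s + dlt + (B - s) = B + dlt); last by ring.
  by rewrite (le_trans (proj2 (andP FB')))// lerDl ltW.
have am_le k : (\int[nu]_x am k x <= \int[nu]_x a (kappa k (drop_coord k x)))%E.
  exact: prefix_jensen.
pose J := (\int[nu]_x (F (empirical x))%:E)%E.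
have mF : measurable_fun setT (fun x : EnB R E n.+1 => F (empirical x)).
  exact: (measurableT_comp (measurable_usc uF) (@measurable_empirical n)).
have IF : (nu : probability _ _).-integrable setT (EFin \o (fun x : EnB R E n.+1 => F (empirical x))).
  by apply: (@integrable_bounded _ _ _ _ _ B) => // x; exact: FB.
have Jfin : J \is a fin_num by exact: integrable_fin_num.
(* A shift by [D] makes both sides nonnegative, so they can be integrated term by term even if some
   terms are infinite. *)
pose D := `|s| + `|c| + B + dlt.
have s1 := ler_norm (- s); have c1 := ler_norm (- c); have B1 := ler_norm B.
rewrite !normrN in s1 c1.
have B0 : 0 <= B by apply: le_trans (FB point); exact: normr_ge0.
have K00 : 0 <= K0 by rewrite /K0 !addr_ge0// ltW.
have mbad : measurable ([set y | bad (path_of q y)] : set (EnB R E n.+1)).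
  exact: measurable_path.
have mam k : measurable_fun setT (am k).
  rewrite /am; apply: (@measurable_fun_finvalued _ (EnB R E n.+1) _ _ _
    (fun x => prefix_of k (path_of q x)) setT (fun t => a (m k t))) => t.
  by rewrite setTI; exact: measurable_prefix.
have bad0 x : (0 <= (K0 * \1_[set y | bad (path_of q y)] x)%:E)%E.
  by rewrite lee_fin mulr_ge0.
have sum0 x : (0 <= (N^-1)%:E * \sum_(k < n.+1) am k x)%E.
  by rewrite mule_ge0 ?lee_fin ?invr_ge0 ?(ltW N0)// sume_ge0// => k _; exact: a0.
have mbad' : measurable_fun setT
    (fun x : EnB R E n.+1 => (K0 * \1_[set y | bad (path_of q y)] x)%:E).
  apply/measurable_EFinP; apply: measurable_funM; first exact: measurable_cst.
  exact: (@measurable_indic _ (EnB R E n.+1) R setT _ mbad).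
have msum : measurable_fun setT (fun x : EnB R E n.+1 => \sum_(k < n.+1) am k x)%E.
  exact: emeasurable_sum.
have msum' := measurable_funeM (N^-1)%:E msum.
have main : (J <= (s + dlt + c + K0 * C / N)%:E + (N^-1)%:E * I0)%E.
  have JD : (J + D%:E = \int[nu]_x (F (empirical x) + D)%:E)%E.
    under eq_integral do rewrite EFinD.
    rewrite integralD//; last exact: finite_measure_integrable_cst.
    by rewrite (integral_cst_probability (nu : probability _ _)).
  rewrite -(@leeD2rE _ D%:E)// JD.
  apply: (@le_trans _ _ (\int[nu]_x ((s + dlt + c + D)%:E
     + ((K0 * \1_[set y | bad (path_of q y)] x)%:E + (N^-1)%:E * \sum_(k < n.+1) am k x)))%E).
    apply: ge0_le_integral => //.
    - move=> x _; rewrite lee_fin /D; have := FB (empirical x); rewrite ler_norml.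
      have := normr_ge0 s; have := normr_ge0 c; lra.
    - by apply/measurable_EFinP; apply: measurable_funD.
    - by apply: emeasurable_funD; [exact: measurable_cst|exact: emeasurable_funD mbad' msum'].
    - move=> x _; rewrite EFinD; apply: (le_trans (leeD2r D%:E (pointwise x))).
      have E3 (u v w : R) (z : \bar R) :
          ((u + v)%:E + z + w%:E = (u + w)%:E + (v%:E + z))%E.
        by rewrite addeAC -EFinD addeA -EFinD; congr (_%:E + _)%E; ring.
      by rewrite E3.
  have r1 (x : EnB R E n.+1) : setT x -> (0 <= cst (s + dlt + c + D)%:E x)%E.
    by move=> _; rewrite /= lee_fin /D; lra.
  rewrite (ge0_integralD nu measurableT r1 (measurable_cst _)
    (fun x _ => adde_ge0 (bad0 x) (sum0 x)) (emeasurable_funD mbad' msum')).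
  rewrite (ge0_integralD nu measurableT (fun x _ => bad0 x) mbad' (fun x _ => sum0 x) msum').
  rewrite (integral_cst_probability (nu : probability _ _)).
  have -> : (\int[nu]_x (K0 * \1_[set y | bad (path_of q y)] x)%:E =
      K0%:E * nu [set y | bad (path_of q y)])%E.
    under eq_integral do rewrite EFinM.
    have i0 (x : EnB R E n.+1) : setT x -> (0 <= (\1_[set y | bad (path_of q y)] x : R)%:E)%E.
      by move=> _; rewrite lee_fin.
    have mi : measurable_fun setT
        (fun x : EnB R E n.+1 => (\1_[set y | bad (path_of q y)] x : R)%:E).
      by apply/measurable_EFinP; exact: (@measurable_indic _ (EnB R E n.+1) R setT _ mbad).
    by rewrite (ge0_integralZl_EFin nu measurableT i0 mi K00) integral_indic// setIT.
  have N'0 : 0 <= N^-1 by rewrite invr_ge0 ltW.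
  have sum0' (x : EnB R E n.+1) : setT x -> (0 <= \sum_(k < n.+1) am k x)%E.
    by move=> _; apply: sume_ge0 => k _; exact: a0.
  rewrite (ge0_integralZl_EFin nu measurableT sum0' msum N'0).
  rewrite ge0_integral_sum//; last by move=> k x _; exact: a0.
  have -> : ((s + dlt + c + K0 * C / N)%:E + (N^-1)%:E * I0 + D%:E =
    (s + dlt + c + D)%:E + ((K0 * (C / N))%:E + (N^-1)%:E * I0))%E.
    by rewrite addeAC !addeA -!EFinD; congr (_%:E + _)%E; ring.
  rewrite leeD2l// leeD//.
    by rewrite [(K0 * _)%:E]EFinM lee_wpmul2l// lee_fin.
  by rewrite lee_wpmul2l ?lee_fin ?invr_ge0 ?(ltW N0)//; exact: lee_sum.
have NJ : (\int[nu]_x (N * F (empirical x))%:E = N%:E * J)%E.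
  by under eq_integral do rewrite EFinM; rewrite integralZl.
rewrite NJ.
have I00 : (0 <= I0)%E by apply: sume_ge0 => k _; apply: integral_ge0.
have := le_trans I0le Ile; move: Jfin main I00.
case: (J) => [j| |//] _ //; case: (I0) => [i0| |//].
  rewrite -EFinM -!EFinD !lee_fin => main I00; case: (alpha_n alpha nu) => [v| |//].
    rewrite -EFinD !lee_fin => iv.
    have : N * j <= N * (s + dlt + c + K0 * C / N + N^-1 * i0) by rewrite ler_pM2l.
    have -> : N * (s + dlt + c + K0 * C / N + N^-1 * i0) =
        N * (s + dlt + K0 * C / N) + N * c + i0 by field; rewrite gt_eqF.
    move: iv; move: (N * (s + _ + _)) (N * j) (N * c) => z1 z2 z3; lra.
  by move=> _; rewrite addeNy leNye.
(* An infinite [I0] forces [alpha_n] to be infinite, and such a [nu] contributes [-oo] to the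
   supremum. *)
move=> _ _; rewrite addye// leye_eq => /eqP ->.
by rewrite addeNy leNye.
Qed.

Lemma limn_esup_scaled_rho_le (alpha : PE R E -> \bar R) (F : PE R E -> R) :
  alpha_measurable alpha -> (exists c : R, forall nu, (c%:E <= alpha nu)%E) ->
  (exists nu, alpha nu != +oo%E) ->
  alpha_convex alpha -> compact_sublevels alpha -> bounded_fun F -> weak_usc F ->
  (limn_esup (scaled_rho alpha F) <= rate_sup alpha F)%E.
Proof.
move=> ma [c alb] [nu0 anu0] ca ka /bounded_fun_bound[B [B0 FB]] uF.
have aNy nu : alpha nu != -oo%E by have := alb nu; case: (alpha nu).
have [v0 v0E] : exists v, alpha nu0 = v%:E.
  by move: anu0 (aNy nu0); case: (alpha nu0) => [v _ _|//|//]; exists v.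
have ub nu : ((F nu)%:E - alpha nu <= rate_sup alpha F)%E.
  by apply: ereal_sup_ubound; exists nu.
(* [nu0] bounds the supremum from below and the lower bound on [alpha] from above, so it can serve
   as the real [s]. *)
have [s sE] : exists s, rate_sup alpha F = s%:E.
  have : (rate_sup alpha F <= (B - c)%:E)%E.
    apply: ge_ereal_sup => _ [nu _ <-]; rewrite EFinB; apply: leeB => //.
    by rewrite lee_fin (le_trans (ler_norm _)).
  have := ub nu0; rewrite v0E -EFinB.
  by case: (rate_sup alpha F) => [s _ _|//|//]; exists s.
have Fs nu : ((F nu)%:E <= s%:E + alpha nu)%E.
  have := ub nu; rewrite sE; have := aNy nu; case: (alpha nu) => [v| |//] _.
    by rewrite -EFinB -EFinD !lee_fin; lra.
  by rewrite addey// leey.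
rewrite sE; apply/lee_addgt0Pr => e e0.
have e20 : 0 < e / 2 by rewrite divr_gt0.
have [K hK] := scaled_rho_le ma alb ca ka uF FB Fs e20.
apply: limn_esup_le_near; near=> n; apply: (le_trans (hK n)).
rewrite -EFinD lee_fin -addrA lerD2l [leRHS]splitr lerD2l ler_pdivrMr//.
rewrite -ler_pdivrMl//; near: n.
have := nbhs_infty_ger ((e / 2)^-1 * K); apply: filterS => n /le_trans; apply.
by rewrite ler_nat.
Unshelve. all: by end_near. Qed.

End upper_bound.

(** * Product laws and the lower bound *)

Section independent_coordinates.
Context (R : realType) (E : pseudoPMetricType R).
Hypothesis sepE : exists D : set E, countable D /\ dense D.

Lemma probability_eq_pi d (T : measurableType d) (G : set (set T)) (P Q : probability T R) :
  @measurable _ T = <<s G >> -> setI_closed G -> G setT ->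
  (forall A, G A -> P A = Q A) -> forall A, measurable A -> P A = Q A.
Proof.
move=> mG GI GT PQ; apply: (measure_unique G (fun=> setT)) => //.
- by rewrite bigcup_const//; exists 0%N.
- by move=> _; rewrite (le_lt_trans (@probability_le1 _ _ _ P _ measurableT))// ltry.
Qed.

Definition box n (B : 'I_n -> set E) : set ('I_n -> E) := [set x | forall i, B i (x i)].

Definition boxes n : set (set {ptws 'I_n -> E}) :=
  [set A | exists B : 'I_n -> set E,
     (forall i, measurable (B i : set (EB R E))) /\ A = box B].

Lemma setI_closed_boxes n : setI_closed (@boxes n).
Proof.
move=> _ _ [B [mB ->]] [B' [mB' ->]]; exists (fun i => B i `&` B' i); split.
  by move=> i; exact: (@measurableI _ (EB R E)).
by apply/seteqP; split => [x [h h'] i|x h]; split => // i; have [] := h i.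
Qed.

Lemma measurable_boxes n : @measurable _ (EnB R E n) = <<s @boxes n >>.
Proof.
apply/seteqP; split => [A mA|].
  have mid : measurable_fun setT (id : g_sigma_algebraType (@boxes n) -> EnB R E n).
    apply: measurable_EnB => // i _ B mB; rewrite setTI; apply: sub_sigma_algebra.
    exists (fun j => if j == i then B else setT); split.
      by move=> j; case: ifP => // _; exact: (@measurableT _ (EB R E)).
    apply/seteqP; split => [x Bx j|x h]; first by case: eqP => [->|].
    by have := h i; rewrite eqxx.
  by have := mid (@measurableT _ _) A mA; rewrite setTI.
apply: smallest_sub; first exact: (@sigma_algebra_measurable _ (EnB R E n)).
move=> _ [B [mB ->]].
rewrite (_ : box B = \bigcap_(i in [set: 'I_n]) ((fun x : EnB R E n => x i : EB R E) @^-1` B i)).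
  apply: (@fin_bigcap_measurable _ (EnB R E n)) => // i _.
  rewrite -[X in measurable X]setTI.
  exact: (@measurable_coord R E n i).
by apply/seteqP; split => [x h i _|x h i]; exact: h.
Qed.

(** The product law, described on the generating pi-system of boxes. *)
Definition iid (mu : PE R E) n (nu : PEn R E n) :=
  forall B : 'I_n -> set E, (forall i, measurable (B i : set (EB R E))) ->
  nu (box B) = (\prod_(i < n) fine (mu (B i)))%:E.

Lemma exists_iid (mu : PE R E) n : exists nu : PEn R E n, iid mu nu.
Proof.
elim: n => [|n [nu nuE]].
  exists (@dirac _ (EnB R E 0) (fun=> point) R) => B mB.
  rewrite big_ord0 /= /dirac /= indicE mem_set//; by case.
pose f (p : EnB R E n * EB R E) : EnB R E n.+1 := ins_coord ord0 (p.1 : 'I_n.+1.-1 -> E) p.2.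
have mf : measurable_fun setT f.
  by apply: (@measurable_ins_coord R E _ _ n.+1 ord0 fst snd).
have [m mE] := exists_pushforward (nu \x mu)%E mf.
exists m => B mB; rewrite mE.
rewrite (_ : f @^-1` _ = (box (fun i => B (lift ord0 i)) : set (EnB R E n)) `*` (B ord0 : set (EB R E))).
  have mX : measurable (box (fun i => B (lift ord0 i)) : set (EnB R E n)).
    by rewrite measurable_boxes; apply: sub_sigma_algebra; exists (fun i => B (lift ord0 i)).
  apply: (etrans (@product_measure1E _ _ (EnB R E n) (EB R E) R nu mu _ _ mX (mB ord0))).
  transitivity ((\prod_(i < n) fine (mu (B (lift ord0 i))))%:E * mu (B ord0))%E.
    by congr (_ * _)%E; exact: nuE.
  rewrite big_ord_recl mulrC EFinM fineK// fin_num_measure//; exact: mB.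
apply/seteqP; split => -[y e]/=.
  move=> h; split => [j|]; last by have := h ord0; rewrite /f ins_coordK.
  by have := h (lift ord0 j); rewrite /f ins_coord_lift.
move=> [h1 h2] i; rewrite /f /=; have [->|] := eqVneq i ord0; first by rewrite ins_coordK.
by rewrite eq_sym => /unlift_some[j -> _]; rewrite ins_coord_lift; exact: h1.
Qed.

(** Resampling coordinate [k] independently from [mu] leaves the law unchanged; this is checked on
    boxes. *)
Lemma iid_cond_law (mu : PE R E) n (nu : PEn R E n) k : iid mu nu ->
  is_cond_law nu k (fun=> mu).
Proof.
move=> nuE; split; first exact: measurable_cst.
pose f (p : EnB R E n * EB R E) : EnB R E n := ins_coord k (drop_coord k p.1) p.2.
have mf : measurable_fun setT f.
  have m1 : measurable_fun setT ((fun p : EnB R E n * EB R E => drop_coord k p.1) :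
      _ -> EnB R E n.-1).
    exact: (measurableT_comp (measurable_drop_coord k sepE) (@measurable_fst _ _ _ _)).
  have m2 : measurable_fun setT ((fun p : EnB R E n * EB R E => p.2) : _ -> EB R E).
    exact: measurable_snd.
  exact: (measurable_ins_coord k sepE m1 m2).
have [m mE] := exists_pushforward (nu \x mu)%E mf.
move=> A mA; transitivity (m A); last first.
  rewrite mE /= /product_measure1; apply: eq_integral => x _ /=; congr (mu _).
  by apply/seteqP; split => e; rewrite /xsection/= inE.
apply: (probability_eq_pi (@measurable_boxes n) (@setI_closed_boxes n)) mA.
  exists (fun=> setT); split; first by move=> i; exact: (@measurableT _ (EB R E)).
  by apply/seteqP.
move=> _ [B [mB ->]]; rewrite mE nuE//.
pose B' i := if i == k then setT else B i.
have mB' i : measurable (B' i : set (EB R E)).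
  by rewrite /B'; case: ifP => // _; exact: (@measurableT _ (EB R E)).
rewrite (_ : f @^-1` _ = (box B' : set (EnB R E n)) `*` (B k : set (EB R E))).
  have mX : measurable (box B' : set (EnB R E n)).
    by rewrite measurable_boxes; apply: sub_sigma_algebra; exists B'.
  apply/esym; apply: (etrans (@product_measure1E _ _ (EnB R E n) (EB R E) R nu mu _ _ mX (mB k))).
  transitivity ((\prod_(i < n) fine (mu (B' i)))%:E * mu (B k))%E.
    by congr (_ * _)%E; exact: nuE.
  have mukE : mu (B k) = (fine (mu (B k)))%:E.
    by rewrite fineK// fin_num_measure//; exact: mB.
  rewrite mukE -EFinM (bigD1 k)//= [in RHS](bigD1 k)//=; congr EFin.
  have -> : B' k = setT by rewrite /B' eqxx.
  have -> : mu setT = 1%E by exact: (@probability_setT _ _ _ mu).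
  rewrite mul1r mulrC; congr (_ * _); apply: eq_bigr => i ik.
  by rewrite /B' (negbTE ik).
apply/seteqP; split => -[x e]/=.
  move=> h; split => [i|]; last by have := h k; rewrite /f ins_coordK.
  rewrite /B'; have [//|ik] := eqVneq i k; have := h i; rewrite /f /=.
  by move: ik; rewrite eq_sym => /unlift_some[j -> _]; rewrite ins_coord_lift.
move=> [h1 h2] i; rewrite /f /=; have [->|ik] := eqVneq i k; first by rewrite ins_coordK.
have := h1 i; rewrite /B' (negbTE ik).
by move: ik; rewrite eq_sym => /unlift_some[j -> _]; rewrite ins_coord_lift.
Qed.

(** Finite intersections of a countable base form a countable pi-system generating the Borel sets.
    Countability lets almost sure equalities hold simultaneously. *)
Lemma PE_eq_countable : exists V : nat -> set (EB R E), (forall j, measurable (V j)) /\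
  forall mu nu : PE R E, (forall j, mu (V j) = nu (V j)) ->
  forall B : set (EB R E), measurable B -> mu B = nu B.
Proof.
have [U [oU bU]] := separable_open_base sepE.
pose W (s : seq nat) : set (EB R E) := \bigcap_(j in [set j | j \in s]) U j.
have mU j : measurable (U j : set (EB R E)) by exact: sub_sigma_algebra.
have mW s : measurable (W s).
  apply: bigcap_measurableType => j _; exact: mU.
exists (fun j => odflt setT (omap W (unpickle j))); split.
  by move=> j; case: unpickle => [s|]/=; [exact: mW|exact: (@measurableT _ (EB R E))].
move=> mu nu h.
have hW s : mu (W s) = nu (W s) by have := h (pickle s); rewrite pickleK.
apply: (@probability_eq_pi _ (EB R E) [set W s | s in setT]).
- apply/seteqP; split; last first.
    apply: smallest_sub; first exact: (@sigma_algebra_measurable _ (EB R E)).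
    by move=> _ [s _ <-].
  apply: smallest_sub; first exact: smallest_sigma_algebra.
  move=> G oG.
  have -> : G = \bigcup_(j in [set j | U j `<=` G]) W [:: j].
    have WE j : W [:: j] = U j.
      apply/seteqP; split => [x|x Ux i /=]; first by apply => /=; rewrite inE.
      by rewrite inE => /eqP ->.
    apply/seteqP; split => [x Gx|x [j /= UG]]; last by rewrite WE; exact: UG.
    have [j [Ujx UjG]] := bU x G (open_nbhs_nbhs (conj oG Gx)).
    by exists j => //; rewrite WE.
  rewrite bigcup_mkcond; apply: sigma_algebra_bigcup => j; case: ifPn => _.
    by apply: sub_sigma_algebra; exists [:: j].
  by apply: sigma_algebra0; exact: smallest_sigma_algebra.
- move=> _ _ [s _ <-] [t _ <-]; exists (s ++ t) => //.
  apply/seteqP; split => [x h'|x [hs ht] j /=]; last first.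
    by rewrite mem_cat => /orP[]; [exact: hs|exact: ht].
  by split => j /= js; apply: h' => /=; rewrite mem_cat js ?orbT.
- by exists [::] => //; apply/seteqP; split.
- by move=> _ [s _ <-].
Qed.

(** Two versions have the same integrals over every event in the other coordinates, so they agree
    almost everywhere on each set of a countable determining class. *)
Lemma cond_law_cst_ae (alpha : PE R E -> \bar R) (mu : PE R E) n (nu : PEn R E n) k kappa :
  alpha_measurable alpha -> is_cond_law nu k (fun=> mu) -> is_cond_law nu k kappa ->
  {ae (nu : probability (EnB R E n) R), forall x, alpha (kappa (drop_coord k x)) = alpha mu}.
Proof.
move=> ma [_ hmu] [mk hk]; have mdrop := measurable_drop_coord k sepE.
have [V [mV hV]] := PE_eq_countable.
have [m mE] := exists_pushforward nu mdrop.
have mkB (B : set (EB R E)) (mB : measurable B) :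
  measurable_fun setT (fun y : EnB R E n.-1 => kappa y B) by exact: measurable_PEB_eval.
have intE (g : EnB R E n.-1 -> \bar R) C : measurable C -> (forall y, 0 <= g y)%E ->
    measurable_fun setT g -> (\int[m]_(y in C) g y =
    \int[nu]_(x in drop_coord k @^-1` C) g (drop_coord k x))%E.
  move=> mC g0 mg.
  rewrite (eq_measure_integral (pushforward nu (drop_coord k : EnB R E n -> EnB R E n.-1))).
    rewrite (ge0_integral_pushforward mdrop nu mC)//.
    exact: measurable_funTS.
  by move=> A _ _; exact: mE.
have aeV j : {ae m, forall y, kappa y (V j) = mu (V j)}.
  have : ae_eq m setT (fun=> mu (V j)) (fun y => kappa y (V j)).
    apply: integral_ae_eq => //.
      have -> : mu (V j) = (fine (mu (V j)))%:E by rewrite fineK// fin_num_measure//; exact: mV.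
      exact: finite_measure_integrable_cst.
      by apply: mkB; exact: mV.
    move=> C _ mC.
    have A0 (kp : ('I_n.-1 -> E) -> PE R E) : is_cond_law nu k kp ->
      (\int[m]_(y in C) kp y (V j) =
       nu [set x | C (drop_coord k x) /\ V j (x k)])%E.
      move=> [mkp hkp]; rewrite intE//; last exact: measurable_PEB_eval.
      rewrite hkp; last first.
        rewrite (_ : [set x | _] = (drop_coord k @^-1` C) `&`
          ((fun x : EnB R E n => x k : EB R E) @^-1` V j)); last by apply/seteqP; split => x /= [].
        apply: measurableI; rewrite -[X in measurable X]setTI; first exact: mdrop.
        by apply: (@measurable_coord R E n k); [|exact: mV].
      rewrite [LHS]integral_mkcond; apply: eq_integral => x _; rewrite patchE.
      case: ifPn => [|/negP]; rewrite inE /= => Cx.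
        congr (kp _ _); apply/seteqP; split => e /=; rewrite drop_ins_coord ins_coordK.
          by [].
        by case.
      rewrite (_ : [set e | _] = set0) ?measure0//.
      by apply/seteqP; split => // e /=; rewrite drop_ins_coord => -[].
    by rewrite (A0 (fun=> mu))// (A0 kappa).
  by move=> [N [mN N0 hN]]; exists N; split => // y /= ny; apply: hN => h; exact/ny/esym/h.
have /ae_foralln [N [mN N0 hN]] := aeV.
exists (drop_coord k @^-1` N); split.
- by rewrite -[X in measurable X]setTI; exact: mdrop.
- by have := mE N; rewrite N0.
- move=> x /= nx; apply: hN => /= hx; apply: nx.
  (* Agreement on Borel sets is not equality in [PE]; measurability of [alpha] turns it into
     equality of its values. *)
  apply: (measurable_sublevel_cst ma) => f tf; rewrite /ev; congr fine.
  apply: eq_measure_integral => B mB _; exact: hV.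
Qed.

Lemma alpha_n_iid_le (alpha : PE R E -> \bar R) (mu : PE R E) n (nu : PEn R E n) (v : R) :
  alpha_measurable alpha -> (forall k, is_cond_law nu k (fun=> mu)) -> alpha mu = v%:E ->
  (alpha_n alpha nu <= (n%:R * v)%:E)%E.
Proof.
move=> ma hmu av; apply: ge_ereal_sup => _ [kappa hkappa <-].
rewrite (@ae_eq_integral _ (EnB R E n) R nu setT (fun=> (n%:R * v)%:E))//.
- by rewrite (integral_cst_probability (nu : probability _ _)).
- apply: emeasurable_sum => k.
  have mkd : measurable_fun setT
      ((fun x : EnB R E n => kappa k (drop_coord k x)) : EnB R E n -> PEB R E).
    have mdrop := measurable_drop_coord k sepE.
    exact: (measurableT_comp (hkappa k).1 mdrop).
  exact: (measurableT_comp (ma : measurable_fun setT (alpha : PEB R E -> _)) mkd).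
have h k := cond_law_cst_ae ma (hmu k) (hkappa k).
have : {ae (nu : probability (EnB R E n) R),
    forall x, forall k, alpha (kappa k (drop_coord k x)) = alpha mu}.
  exact: filter_forall.
move=> [N [mN N0 hN]]; exists N; split => // x /= nx; apply: hN => hx; apply: nx => _.
under eq_bigr do rewrite hx av.
by rewrite sumEFin sumr_const card_ord -[v *+ _]mulr_natl.
Qed.

(** With constant prefix laws, [prefix_lln] becomes the weak law of large numbers for independent
    samples from [mu]. *)
Lemma iid_prefix_laws (mu : PE R E) n (nu : PEn R E n) (S : finType) (q : E -> S) :
  (forall s, measurable ([set x | q x = s] : set (EB R E))) ->
  (forall k, is_cond_law nu k (fun=> mu)) -> prefix_laws nu q (fun _ _ => mu).
Proof.
move=> mq hmu k t B mB; have mA := measurable_prefix mq k t.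
rewrite (hmu k).2; last first.
  rewrite (_ : [set x | _] = [set x | prefix_of k (path_of q x) = t] `&`
     ((fun x : EnB R E n => x k : EB R E) @^-1` B)); last by apply/seteqP; split => x /= [].
  apply: measurableI => //; rewrite -[X in measurable X]setTI.
  exact: (@measurable_coord R E n k).
rewrite -(prefix_massE nu mq k t) muleC -integral_cst// integral_mkcond.
apply: eq_integral => x _; rewrite patchE.
case: ifPn => [|/negP]; rewrite inE => xt.
  congr (mu _); apply/seteqP; split => e /=; rewrite prefix_path_ins ins_coordK.
    by move=> Be; split.
  by case.
rewrite (_ : [set e | _] = set0) ?measure0//.
by apply/seteqP; split => // e /=; rewrite prefix_path_ins => -[].
Qed.

Lemma weak_usc_opp (F : PE R E -> R) : weak_lsc F -> weak_usc (fun mu => - F mu).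
Proof.
move=> lF; rewrite /weak_usc.
rewrite (_ : (fun nu : PEw R E => _) = (fun nu : PEw R E => (F nu)%:E))//.
by apply/funext => nu; rewrite opprK.
Qed.

Lemma scaled_rho_ge (alpha : PE R E -> \bar R) (F : PE R E -> R) (B v e : R) (mu : PE R E) :
  alpha_measurable alpha -> weak_lsc F -> (forall nu, `|F nu| <= B) ->
  alpha mu = v%:E -> 0 < e ->
  exists K : R, forall n, ((F mu - v - e - K / n.+1%:R)%:E <= scaled_rho alpha F n)%E.
Proof.
move=> ma lF FB av e0.
have [V nV hV] : exists2 V, nbhs (mu : PEw R E) V &
    forall y, V y -> ((F mu - e)%:E < (F y)%:E)%E.
  by apply: lF; rewrite lte_fin gtrBl.
have [fs [d [d0 tfs hfs]]] := nbhs_weakP nV.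
have [S [q [C [mq hlln]]]] := prefix_lln tfs d0.
have B0 : 0 <= B by apply: le_trans (FB mu); exact: normr_ge0.
(* On the bad set [F] can fall below [F mu] by at most 2B, and that set has probability at most
   C/(n+1). *)
exists (2 * B * C) => n; set N : R := n.+1%:R; have N0 : 0 < N by rewrite ltr0n.
have [nu nuE] := exists_iid mu n.+1.
have hmu k := iid_cond_law k nuE.
have [bad [badP hbad]] := hlln n nu _ (iid_prefix_laws mq hmu).
have good x : ~~ bad (path_of q x) -> F mu - e <= F (empirical x).
  move=> /hbad[_ close]; have : V (empirical x).
    apply: hfs => f ff; have := close f ff.
    by rewrite sumr_const card_ord -[X in _ * X]mulr_natl -/N mulKf// gt_eqF.
  by move=> /hV; rewrite lte_fin => /ltW.
have FBx x : - B <= F x <= B by rewrite -ler_norml.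
have mF : measurable_fun setT (fun x : EnB R E n.+1 => F (empirical x)).
  have mF' : measurable_fun setT (F : PEB R E -> R).
    rewrite (_ : F = (fun y => - - F y)); last by apply/funext => y; rewrite opprK.
    apply: measurable_funN; exact: (measurable_usc (weak_usc_opp lF)).
  exact: (measurableT_comp mF' (@measurable_empirical R E sepE n)).
have IF : (nu : probability _ _).-integrable setT (EFin \o (fun x : EnB R E n.+1 => F (empirical x))).
  by apply: (@integrable_bounded _ _ _ _ _ B) => // x; exact: FB.
pose J := (\int[nu]_x (F (empirical x))%:E)%E.
have Jfin : J \is a fin_num by exact: integrable_fin_num.
have mbad : measurable ([set y | bad (path_of q y)] : set (EnB R E n.+1)).
  exact: measurable_path.
have K00 : 0 <= 2 * B by rewrite mulr_ge0.
have i0 (x : EnB R E n.+1) : setT x -> (0 <= (\1_[set y | bad (path_of q y)] x : R)%:E)%E.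
  by move=> _; rewrite lee_fin.
have mi : measurable_fun setT
    (fun x : EnB R E n.+1 => (\1_[set y | bad (path_of q y)] x : R)%:E).
  by apply/measurable_EFinP; exact: (@measurable_indic _ (EnB R E n.+1) R setT _ mbad).
have i1 (x : EnB R E n.+1) : setT x ->
    (0 <= (2 * B)%:E * (\1_[set y | bad (path_of q y)] x : R)%:E)%E.
  by move=> _; rewrite mule_ge0 ?lee_fin.
have g0 (x : EnB R E n.+1) : setT x -> (0 <= (F (empirical x) + B)%:E)%E.
  by move=> _; rewrite lee_fin; have := FBx (empirical x); lra.
have mg : measurable_fun setT (fun x : EnB R E n.+1 => (F (empirical x) + B)%:E).
  by apply/measurable_EFinP; apply: measurable_funD.
have JD : (\int[nu]_x (F (empirical x) + B)%:E = J + B%:E)%E.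
  under eq_integral do rewrite EFinD.
  rewrite integralD//; last exact: finite_measure_integrable_cst.
  by rewrite (integral_cst_probability (nu : probability _ _)).
have main : ((F mu - e)%:E <= J + (2 * B * (C / N))%:E)%E.
  have h : ((F mu - e + B)%:E <= \int[nu]_x ((F (empirical x) + B)%:E +
      (2 * B)%:E * (\1_[set y | bad (path_of q y)] x : R)%:E))%E.
    (* The comparison of integrals asks for a nonnegative constant on the left; otherwise the bound
       is trivial. *)
    have [c0|c0] := leP (F mu - e + B) 0.
      apply: (@le_trans _ _ 0%E); first by rewrite lee_fin.
      by apply: integral_ge0 => x _; apply: adde_ge0; [exact: g0|exact: i1].
    rewrite -(integral_cst_probability (nu : probability _ _)).
    apply: ge0_le_integral => //.
    - by move=> x _; rewrite lee_fin ltW.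
    - by apply: emeasurable_funD => //; exact: measurable_funeM.
    move=> x _; rewrite -EFinM -EFinD lee_fin indicE.
    have [xb|xb] := pselect (bad (path_of q x)).
      rewrite mem_set// mulr1; have := FBx (empirical x); have := FBx mu; lra.
    rewrite memNset// mulr0 addr0 lerD2r; exact: good (introN idP xb).
  rewrite (ge0_integralD nu measurableT g0 mg i1 (measurable_funeM _ mi)) in h.
  rewrite (ge0_integralZl_EFin nu measurableT i0 mi K00) integral_indic// setIT JD in h.
  have h2 : ((2 * B)%:E * nu [set y | bad (path_of q y)] <= (2 * B * (C / N))%:E)%E.
    by rewrite [leRHS]EFinM lee_wpmul2l// lee_fin.
  have := le_trans h (leeD2l (J + B%:E)%E h2).
  by move: Jfin; case: (J) => [j| |]// _; rewrite -!EFinD !lee_fin; move: (2 * B * (C / N)) => z; lra.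
have NJ : (\int[nu]_x (N * F (empirical x))%:E = N%:E * J)%E.
  by under eq_integral do rewrite EFinM; rewrite integralZl.
rewrite /scaled_rho -/N lee_pdivlMl//.
apply: (@le_trans _ _ (\int[nu]_x (N * F (empirical x))%:E - alpha_n alpha nu)%E); last first.
  by apply: ereal_sup_ubound; exists nu.
rewrite NJ; apply: (@le_trans _ _ (N%:E * J - (N * v)%:E)%E); last first.
  by apply: leeB => //; exact: alpha_n_iid_le.
move: Jfin main; case: (J) => [j| |]// _; rewrite -!EFinM -?EFinB -!EFinD !lee_fin.
rewrite -mulrBr ler_pM2l// => h.
have -> : 2 * B * C / N = 2 * B * (C / N) by rewrite mulrA.
move: h; move: (2 * B * (C / N)) => z h.
lra.
Qed.

Lemma le_limn_einf_scaled_rho (alpha : PE R E -> \bar R) (F : PE R E -> R) :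
  alpha_measurable alpha -> (forall nu, alpha nu != -oo%E) -> bounded_fun F -> weak_lsc F ->
  (rate_sup alpha F <= limn_einf (scaled_rho alpha F))%E.
Proof.
move=> ma aNy /bounded_fun_bound[B [B0 FB]] lF.
apply: ge_ereal_sup => _ [mu _ <-].
case av: (alpha mu) (aNy mu) => [v| |//] _; last by rewrite addeNy leNye.
apply/lee_subgt0Pr => e e0; have e20 : 0 < e / 2 by rewrite divr_gt0.
have [K hK] := scaled_rho_ge ma lF FB av e20.
apply: le_limn_einf_near; near=> n; apply: (le_trans _ (hK n)).
rewrite -!EFinB lee_fin.
suff : K / n.+1%:R <= e / 2 by move: (K / n.+1%:R) => z; lra.
rewrite ler_pdivrMr// -ler_pdivrMl//; near: n.
have := nbhs_infty_ger ((e / 2)^-1 * K); apply: filterS => n /le_trans; apply.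
by rewrite ler_nat.
Unshelve. all: by end_near. Qed.

End independent_coordinates.

Theorem mainTheorem4 (R : realType) (E : pseudoPMetricType R)
  (* (E, d) is a complete separable metric space *)
  (E_hausdorff : hausdorff_space E)
  (E_complete : forall G : set_system E, ProperFilter G -> cauchy G -> cvg G)
  (E_separable : exists D : set E, countable D /\ dense D)
  (alpha : PE R E -> \bar R)
  (alpha_meas : alpha_measurable alpha)
  (alpha_lb : exists c : R, forall nu, (c%:E <= alpha nu)%E)
  (alpha_fin : exists nu, alpha nu != +oo%E) :
  (forall F : PE R E -> R, bounded_fun F -> weak_lsc F ->
     (rate_sup alpha F <= limn_einf (scaled_rho alpha F))%E)
  /\
  (alpha_convex alpha -> compact_sublevels alpha ->
   forall F : PE R E -> R, bounded_fun F -> weak_usc F ->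
     (limn_esup (scaled_rho alpha F) <= rate_sup alpha F)%E).
Proof.
split=> [F bF lF|calpha kalpha F bF uF]; last exact: limn_esup_scaled_rho_le.
apply: le_limn_einf_scaled_rho => // nu.
by have [c /(_ nu)] := alpha_lb; case: (alpha nu).
Qed.
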